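(* Let $p\ge2$ and let $\psi$ be a smooth function, not identically zero, with compact support contained in $\mathbb J_\ast:=\{(t,s)\in\mathbb R^2:0<s<t\}$. Set $\tilde{\mathcal A}_t^sf(x)=\psi(t,s)\,\mathcal A_t^sf(x)$, regarded as a function of $(x,t,s)\in\mathbb R^5$. If $\alpha>\min\{1/2,4/p\}$, then $f\mapsto\tilde{\mathcal A}_t^sf$ is not bounded from $L^p(\mathbb R^3)$ to $L^p_\alpha(\mathbb R^5)$.
   Context: For $0<s<t$ set $\Phi_t^s(\theta,\phi)=\big((t+s\cos\theta)\cos\phi,\,(t+s\cos\theta)\sin\phi,\,s\sin\theta\big)$, a parametrization of the torus $\mathbb T_t^s\subset\mathbb R^3$. The measure $\sigma_t^s$ is defined by $\langle f,\sigma_t^s\rangle=\int_{[0,2\pi)^2}f(\Phi_t^s(\theta,\phi))\,d\theta\,d\phi$, and $\mathcal A_t^sf=f*\sigma_t^s$, i.e. $\mathcal A_t^sf(x)=\int_{[0,2\pi)^2}f(x-\Phi_t^s(\theta,\phi))\,d\theta\,d\phi$. $L^p_\alpha(\mathbb R^d)$ is the $L^p$ Sobolev (Bessel potential) space of order $\alpha$, with norm $\|\mathcal F^{-1}((1+|\zeta|^2)^{\alpha/2}\mathcal FF)\|_{L^p(\mathbb R^d)}$. *)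

(* Defs.v *)
From HB Require Import structures.
From mathcomp Require Import all_boot all_order all_algebra.
From mathcomp Require Import all_classical all_reals all_analysis.
From mathcomp Require Export complex.

Set Implicit Arguments.
Unset Strict Implicit.
Unset Printing Implicit Defensive.
Import Order.TTheory GRing.Theory Num.Theory.
Import numFieldNormedType.Exports.

Local Open Scope classical_set_scope.
Local Open Scope ring_scope.

Local Notation Re := (@complex.Re _).
Local Notation Im := (@complex.Im _).

(* R^d is an iterated product, so that it carries both the normed-space
   structure used for derivatives and the product Borel sigma-algebra.  The
   library's norm on products is the sup norm; it is used only where
   equivalent norms give the same notion. *)
Notation R2 R := (R * R)%type.
Notation R3 R := (R * R * R)%type.
(* z = (x, t, s) with x = z.1.1, t = z.1.2, s = z.2 *)
Notation R5 R := (R3 R * R * R)%type.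

Section measures.
Variable R : realType.
Local Notation mR := (measurableTypeR R).
Local Notation lam := (@lebesgue_measure R).

Definition leb2 : {measure set (mR * mR) -> \bar R} := (lam \x lam)%E.
Definition leb3 : {measure set (mR * mR * mR) -> \bar R} := (leb2 \x lam)%E.
Definition leb5 : {measure set (mR * mR * mR * mR * mR) -> \bar R} :=
  (leb3 \x lam \x lam)%E.

End measures.

Section complex_functions.
Variable R : realType.

Definition cintegral d (T : measurableType d) (mu : {measure set T -> \bar R})
    (D : set T) (f : T -> R[i]) : R[i] :=
  Complex (\int[mu]_(x in D) Re (f x))
          (\int[mu]_(x in D) Im (f x)).

Definition cexp (a : R) : R[i] := Complex (cos a) (sin a).

Definition cabs (z : R[i]) : R := ComplexField.Normc.normc z.

Definition Lp_norm d (T : measurableType d) (mu : {measure set T -> \bar R})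
    (p : R) (f : T -> R[i]) : \bar R :=
  Lnorm mu p%:E (EFin \o (cabs \o f)).

Definition cmeasurable d (T : measurableType d) (f : T -> R[i]) : Prop :=
  measurable_fun setT (Re \o f) /\
  measurable_fun setT (Im \o f).

Definition Lp d (T : measurableType d) (mu : {measure set T -> \bar R})
    (p : R) (f : T -> R[i]) : Prop :=
  cmeasurable f /\ (Lp_norm mu p f < +oo)%E.

End complex_functions.

Section smoothness.
Variables (R : realType) (V : normedModType R).

Definition iter_derive (vs : seq V) (f : V -> R) : V -> R :=
  foldr (fun v g => 'D_v g) f vs.

Definition smooth (f : V -> R[i]) : Prop := forall (vs : seq V) (x : V),
  differentiable (iter_derive vs (Re \o f)) x /\
  differentiable (iter_derive vs (Im \o f)) x.

Definition supp (f : V -> R[i]) : set V := closure [set x | f x != 0].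

Definition schwartz (f : V -> R[i]) : Prop :=
  smooth f /\
  forall (N : nat) (vs : seq V), exists M : R, forall x : V,
    (1 + `|x|) ^+ N * `|iter_derive vs (Re \o f) x| <= M /\
    (1 + `|x|) ^+ N * `|iter_derive vs (Im \o f) x| <= M.

End smoothness.

Section sobolev.
Variable R : realType.

Definition dot5 (x y : R5 R) : R :=
  x.1.1.1.1 * y.1.1.1.1 + x.1.1.1.2 * y.1.1.1.2 + x.1.1.2 * y.1.1.2
  + x.1.2 * y.1.2 + x.2 * y.2.

Definition fourier (f : R5 R -> R[i]) (zeta : R5 R) : R[i] :=
  cintegral (leb5 R) setT (fun x => cexp (- dot5 x zeta) * f x).

Definition inv_fourier (f : R5 R -> R[i]) (x : R5 R) : R[i] :=
  Complex ((2 * pi) ^- 5) 0 *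
  cintegral (leb5 R) setT (fun zeta => cexp (dot5 x zeta) * f zeta).

(* For p > 2 the Fourier transform of an L^p function is only a tempered
   distribution.  Distributions are functionals of which only the values on
   Schwartz functions matter; the operations on them are defined by duality. *)
Definition distribution : Type := (R5 R -> R[i]) -> R[i].

Definition dist_eq (S T : distribution) : Prop :=
  forall phi, schwartz phi -> S phi = T phi.

Definition dist_fun (F : R5 R -> R[i]) : distribution :=
  fun phi => cintegral (leb5 R) setT (fun z => F z * phi z).

Definition dist_fourier (T : distribution) : distribution :=
  fun phi => T (fourier phi).

Definition dist_inv_fourier (T : distribution) : distribution :=
  fun phi => T (inv_fourier phi).

Definition dist_mul (m : R5 R -> R[i]) (T : distribution) : distribution :=
  fun phi => T (fun zeta => m zeta * phi zeta).

(* The pairings of F with Schwartz functions converge, so that dist_fun F is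
   not defined through the default value of a divergent integral. *)
Definition tempered (F : R5 R -> R[i]) : Prop :=
  @cmeasurable R _ (R5 (measurableTypeR R)) F /\
  forall phi, schwartz phi ->
    (\int[leb5 R]_z (cabs (F z * phi z))%:E < +oo)%E.

Definition bessel_symbol (alpha : R) (zeta : R5 R) : R[i] :=
  Complex ((1 + dot5 zeta zeta) `^ (alpha / 2)) 0.

Definition bessel (alpha : R) (F : R5 R -> R[i]) : distribution :=
  dist_inv_fourier
    (dist_mul (bessel_symbol alpha) (dist_fourier (dist_fun F))).

(* The L^p norm of the function g representing bessel alpha F (unique up to a
   null set), and +oo when there is no such g in L^p, that is, when F is not
   in the Sobolev space. *)
Definition sobolev_norm (p alpha : R) (F : R5 R -> R[i]) : \bar R :=
  ereal_inf [set Lp_norm (leb5 R) p g | g in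
    [set g | [/\ tempered F, Lp (leb5 R) p g &
                 dist_eq (bessel alpha F) (dist_fun g)]]].

Definition sobolev (p alpha : R) (F : R5 R -> R[i]) : Prop :=
  (sobolev_norm p alpha F < +oo)%E.

Definition bounded_Lp_sobolev (p alpha : R)
    (T : (R3 R -> R[i]) -> (R5 R -> R[i])) : Prop :=
  exists K : R, forall f : R3 R -> R[i], Lp (leb3 R) p f ->
    sobolev p alpha (T f) /\
    (sobolev_norm p alpha (T f) <= K%:E * Lp_norm (leb3 R) p f)%E.

End sobolev.

Section torus_averages.
Variable R : realType.

Definition torus_param (t s : R) (a : R2 R) : R3 R :=
  ((t + s * cos a.1) * cos a.2, (t + s * cos a.1) * sin a.2, s * sin a.1).

(* f |-> <f, sigma_t^s> *)
Definition torus_measure (t s : R) (f : R3 R -> R[i]) : R[i] :=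
  cintegral (leb2 R) (`[0, 2 * pi[ `*` `[0, 2 * pi[)
    (fun a => f (torus_param t s a)).

Definition torus_avg (t s : R) (f : R3 R -> R[i]) (x : R3 R) : R[i] :=
  torus_measure t s (fun y => f (x - y)).

Definition local_torus_avg (psi : R2 R -> R[i]) (f : R3 R -> R[i])
    (z : R5 R) : R[i] :=
  psi (z.1.2, z.2) * torus_avg z.1.2 z.2 f z.1.1.

Definition Jstar : set (R2 R) := [set ts | 0 < ts.2 /\ ts.2 < ts.1].

End torus_averages.

(* Main.v *)
(** If the operator were bounded, then by duality
    |<F, G>| <= K |f|_p |(1 - Laplacian)^(- alpha/2) G|_q for F = psi A f.
    Only modulated Gaussians G are needed: as M^(- alpha/2) is the average of
    exp (- u M) against u^(alpha/2) du/u, the bound becomes an integral over u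
    of the explicit norms of the heat evolutions of G.

    For alpha > 4/p, take for f the indicator of the 1/n-neighbourhood of a
    patch of the torus T_t0^s0 and for G a Gaussian of width 1/n centred at
    (0, t0, s0): the pairing stays bounded below while the upper bound is
    O(n^(4/p - beta)) with 4/p < beta < alpha.

    For alpha > 1/2, let f be exp (i l x_3) on a cube and modulate G so that
    the phase of the pairing is l s (1 - sin theta), degenerate at
    theta = pi/2.  Instead of stationary phase, average over l against a
    Gaussian of width y = n^(2k): the integrand becomes nonnegative near
    (t0, s0), the points with |theta - pi/2| <= y^(-1/2) contribute y^(1/2),
    and the upper bound is O(n^(2/p) y^(1 - beta)) with 1/2 < beta < alpha.

    In both cases the points where psi / psi (t0, s0) may be negative lie at a
    fixed distance from (t0, s0), where G is exponentially small in n. *)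

(* For a Gaussian G, the function (1 - Laplacian)^(- alpha/2) G is not Gaussian, while [bessel] is
   only known through its values on Schwartz functions. With u = exp (- v) and M = 1 + |zeta|^2,
   [gamma_kernel] (alpha/2) at v - ln M equals (u M)^(alpha/2) exp (- u M): the Bessel symbol times
   a Gaussian in zeta, with integral Gamma (alpha/2) over v whatever M is. So each v gives an
   admissible Gaussian test, and integrating over v removes the symbol. Each of the five coordinates
   contributes (a + 2 u)^(- 1/(2 p)) to the dual norm, a being the squared width of the packet.
   Since beta < alpha, a factor u^(- beta/2) can be traded for powers of the width while the
   integral over u still converges. Five widths 1/n give n^(5/p - beta), and |f|_p = O(n^(- 1/p))
   for a patch neighbourhood of volume O(1/n). In the oscillating example only t and s are
   localised, at the price n^(2/p); this is beaten by choosing k with k (2 beta - 1) > 2/p. As y is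
   itself a power of n, tails of size exp (- c n^2) still beat every power of y. *)
From HB Require Import structures.
Require Import Defs.
From mathcomp Require Import all_boot all_order all_algebra.
From mathcomp Require Import all_classical all_reals all_analysis.
From mathcomp Require Import measurable_realfun unstable ring lra.
Set Implicit Arguments.
Unset Strict Implicit.
Unset Printing Implicit Defensive.
Import Order.TTheory GRing.Theory Num.Theory.
Import numFieldNormedType.Exports.

Local Open Scope classical_set_scope.
Local Open Scope ring_scope.

Local Notation Re := (@complex.Re _).
Local Notation Im := (@complex.Im _).

(** * Gaussian integrals on the line *)

Section line_integrals.
Variable R : realType.
Local Notation mu := (@lebesgue_measure R).

Lemma ge0_integral_affine (k c : R) (G : R -> R) : 0 < k ->
  continuous G -> (forall x, 0 <= G x) ->
  (\int[mu]_x (G x)%:E = \int[mu]_x (G (k * x + c) * k)%:E)%E.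
Proof.
move=> k0 cG G0.
pose F (x : R) : R := k * x + c.
have dF (x : R) : is_derive x 1 F k.
  rewrite /F; apply: is_derive_eq.
  by rewrite addr0 /GRing.scale/= mulr1.
have F'E : F^`()%classic = cst k by apply/funext => x; rewrite derive1E derive_val.
rewrite (@increasing_ge0_integration_by_substitutionT R F G) ?F'E //.
- by move=> x y xy; rewrite /F ltrD2r ltr_pM2l.
- by move=> x; exact: cst_continuous.
- by apply: is_cvg_cst.
- by apply: is_cvg_cst.
- apply/cvgrNyPle => M; near=> x; rewrite /F -lerBrDr mulrC -ler_pdivlMr//.
- apply/cvgryPge => M; near=> x; rewrite /F -lerBlDr mulrC -ler_pdivrMr//.
Unshelve. all: by end_near. Qed.

(** Exhaustion by the intervals from - (n + 1) to n + 1: the fundamental theorem of calculus leaves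
    boundary terms tending to 0, and dominated convergence identifies the limit with the integral
    over the line. The endpoints are integers, hence the form of the decay hypotheses. *)
Lemma integral_derive_eq0 (h f : R -> R) : continuous f ->
  (forall x : R, is_derive x 1 h (f x)) -> mu.-integrable setT (EFin \o f) ->
  h n%:R @[n --> \oo] --> (0 : R) -> h (- n%:R) @[n --> \oo] --> (0 : R) ->
  (\int[mu]_x f x = 0)%R.
Proof.
move=> cf dh intf h1 h2.
pose I n : set R := `[- n.+1%:R, n.+1%:R]%classic.
have mf : measurable_fun setT f by exact: continuous_measurable_fun.
have HE n : (\int[mu]_(x in I n) (f x)%:E = (h n.+1%:R)%:E - (h (- n.+1%:R))%:E)%E.
  rewrite /I; apply: continuous_FTC2.
  - by rewrite -subr_gt0 opprK -natrD ltr0n.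
  - exact: continuous_subspaceT.
  - have ch : continuous h.
      by move=> x; apply/differentiable_continuous/derivable1_diffP; exact: ex_derive.
    split=> [x _|//|//]; first exact: ex_derive.
      by apply: cvg_at_right_filter; exact: ch.
      by apply: cvg_at_left_filter; exact: ch.
  - by move=> x _; rewrite derive1E derive_val.
have C1 : (\int[mu]_x ((f \_ (I n)) x)%:E @[n --> \oo] --> \int[mu]_x (f x)%:E)%E.
  apply: (@dominated_cvg _ _ _ mu _ _ (fun n x => ((f \_ (I n)) x)%:E) _ (EFin \o (fun x => `|f x|))) => //.
  - move=> n; apply/measurable_EFinP; apply/(measurable_restrictT f) => //.
    exact: measurable_itv.
  exact: measurable_funTS.
  - move=> x _; apply: cvg_near_cst; near=> n.
    rewrite patchE ifT// inE /I/= in_itv/= -ler_norml.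
    apply: (@le_trans _ _ n%:R); last by rewrite ler_nat.
    near: n; exact: (nbhs_infty_ger (`|x : R|)%R).
  - exact: (integrable_abse intf).
  - by move=> n x _; rewrite lee_fin patchE; case: ifPn => // _; rewrite normr0.
have C2 : (\int[mu]_x ((f \_ (I n)) x)%:E @[n --> \oo] --> (0 : \bar R))%E.
  have -> : (fun n => \int[mu]_x ((f \_ (I n)) x)%:E)%E = (fun n => (h n.+1%:R - h (- n.+1%:R))%:E).
    apply/funext => n; rewrite EFinB -HE [RHS]integral_mkcond; apply: eq_integral => x _.
    by rewrite !patchE; case: ifP.
  apply: cvg_EFin; first by near=> n.
  rewrite /= -[X in _ --> X](subr0 (0 : R)); apply: cvgB.
    by rewrite (cvg_shiftS (fun n => h n%:R)).
  by rewrite (cvg_shiftS (fun n => h (- n%:R))).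
by rewrite /Rintegral -(cvg_unique _ C2 C1).
Unshelve. all: by end_near. Qed.
Lemma le_integrable_real d (T : measurableType d) (nu : {measure set T -> \bar R})
    (f g : T -> R) : measurable_fun setT f -> (forall x, `|f x| <= g x) ->
  nu.-integrable setT (EFin \o g) -> nu.-integrable setT (EFin \o f).
Proof.
move=> mf fg; apply: le_integrable => //; first exact/measurable_EFinP.
by move=> x _ /=; rewrite lee_fin (le_trans (fg x)) ?ler_norm.
Qed.

Definition gauss (a c x : R) : R := expR (- (a * (x - c) ^+ 2 / 2)).

Lemma continuous_gauss a c : continuous (gauss a c).
Proof.
move=> x; apply: (@continuous_comp _ _ _ (fun x : R => - (a * (x - c) ^+ 2 / 2)) expR).
  apply: cvgN; apply: cvgMl; apply: cvgMr.
  apply: (@continuous_comp _ _ _ (fun x : R => x - c) (fun z => z ^+ 2)).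
    by apply: cvgB; [exact: cvg_id|exact: cvg_cst].
  exact: exprn_continuous.
exact: continuous_expR.
Qed.

Lemma measurable_gauss a c : measurable_fun setT (gauss a c).
Proof. exact: continuous_measurable_fun (@continuous_gauss a c). Qed.

Lemma gauss_gt0 a c x : 0 < gauss a c x.
Proof. exact: expR_gt0. Qed.

Lemma gauss_le1 a c x : 0 <= a -> gauss a c x <= 1.
Proof.
by move=> a0; rewrite /gauss -[leRHS]expR0 ler_expR oppr_le0 divr_ge0// mulr_ge0// sqr_ge0.
Qed.

Lemma gaussE a c x : 0 < a ->
  gauss a c x = gauss_fun (Num.sqrt (a / 2) * x + - (Num.sqrt (a / 2) * c)).
Proof.
move=> a0; rewrite /gauss /gauss_fun -mulrBr exprMn sqr_sqrtr ?divr_ge0 ?ltW//.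
by congr (expR (- _)); ring.
Qed.

Lemma integral_gauss a c : 0 < a ->
  (\int[mu]_x (gauss a c x)%:E = (Num.sqrt (2 * pi / a))%:E)%E.
Proof.
move=> a0; have k0 : 0 < Num.sqrt (a / 2) by rewrite sqrtr_gt0 divr_gt0.

have := @ge0_integral_affine _ (- (Num.sqrt (a / 2) * c)) _ k0 (@continuous_gauss_fun R) (@gauss_fun_ge0 R).
rewrite integralT_gauss => E.
have E2 : (\int[mu]_x (gauss a c x * Num.sqrt (a / 2))%:E = (Num.sqrt pi)%:E)%E.
  by rewrite E; apply: eq_integral => x _; rewrite gaussE.
have {E E2} : (\int[mu]_x (gauss a c x)%:E * (Num.sqrt (a / 2))%:E = (Num.sqrt pi)%:E)%E.
  rewrite -E2 -ge0_integralZr//.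
  - by apply/measurable_EFinP; exact: measurable_gauss.
  - by move=> x _; rewrite lee_fin ltW// gauss_gt0.
have -> : Num.sqrt pi = Num.sqrt (2 * pi / a) * Num.sqrt (a / 2) :> R.
  rewrite -sqrtrM ?divr_ge0 ?mulr_ge0 ?pi_ge0 ?ltW//.
  by congr Num.sqrt; field; rewrite gt_eqF.
move: k0; set k := Num.sqrt (a / 2); set S := Num.sqrt (2 * pi / a) => k0 E; apply/esym/eqP.
rewrite -[X in X == _]mul1e -(mulVf (lt0r_neq0 k0)) EFinM -muleA eqe_pdivrMl ?lt0r_neq0//.
by rewrite -EFinM mulrC -E muleC.
Qed.

Lemma integrable_gauss a c : 0 < a -> mu.-integrable setT (EFin \o gauss a c).
Proof.
move=> a0; apply/integrableP; split.
  by apply/measurable_EFinP; exact: measurable_gauss.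
under eq_integral => x _ do rewrite /= ger0_norm ?ltW ?gauss_gt0//.
by rewrite integral_gauss// ltry.
Qed.

Lemma continuous_affine (t b : R) : continuous (fun x : R => t * x + b).
Proof. by move=> x; apply: cvgD; [apply: cvgMr; exact: cvg_id|exact: cvg_cst]. Qed.

Lemma continuous_cos_affine t b : continuous (fun x : R => cos (t * x + b)).
Proof.
move=> x; apply: (@continuous_comp _ _ _ (fun x : R => t * x + b) cos); last exact: continuous_cos.
exact: continuous_affine.
Qed.

Lemma continuous_sin_affine t b : continuous (fun x : R => sin (t * x + b)).
Proof.
move=> x; apply: (@continuous_comp _ _ _ (fun x : R => t * x + b) sin); last exact: continuous_sin.
exact: continuous_affine.
Qed.

Lemma measurable_cos_affine t b : measurable_fun setT (fun x : R => cos (t * x + b)).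
Proof. exact: continuous_measurable_fun (@continuous_cos_affine t b). Qed.

Lemma measurable_sin_affine t b : measurable_fun setT (fun x : R => sin (t * x + b)).
Proof. exact: continuous_measurable_fun (@continuous_sin_affine t b). Qed.

(** Domination for differentiating under the integral sign: half of the exponent absorbs |x|,
    because |x| <= 1 + x^2 / 2 <= exp (x^2 / 2). *)
Lemma norm_mul_gauss_fun_le (x : R) : `|x| * gauss_fun x <= gauss 1 0 x.
Proof.
rewrite /gauss_fun /gauss mul1r subr0 -ler_pdivlMr ?expR_gt0// -expRB.
apply: (le_trans _ (expR_ge1Dx _)).
have -> : - (x ^+ 2 / 2) - - x ^+ 2 = `|x| ^+ 2 / 2 by rewrite real_normK ?num_real//; field.
have := sqr_ge0 (`|x| - 1); nra.
Qed.

(** The phase [b] is kept free so that the sine integral is the same function with [b] shifted by pi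
    / 2. *)
Let gphase (b t : R) : R := (\int[mu]_x (cos (t * x + b) * gauss_fun x))%R.

Lemma integrable_cos_gauss_fun t b :
  mu.-integrable setT (EFin \o (fun x => cos (t * x + b) * gauss_fun x)).
Proof.
apply: le_integrable_real (@integrableT_gauss R).
  apply: measurable_funM; first exact: measurable_cos_affine.
  exact: measurable_gauss_fun.
move=> x; rewrite normrM (ger0_norm (gauss_fun_ge0 x)) ler_piMl ?gauss_fun_ge0//.
by rewrite ler_norml cos_geN1 cos_le1.
Qed.

Lemma is_derive_gauss_fun (x : R) : is_derive x 1 gauss_fun (- 2 * x * gauss_fun x).
Proof.
rewrite /gauss_fun; apply: is_derive_eq.
rewrite /GRing.scale/=; ring.
Qed.

(** The classical differential equation for the Fourier transform of a Gaussian. Differentiation in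
    t produces the integral of - x sin (t x + b) exp (- x^2); as the derivative of sin (t x + b) exp
    (- x^2) has integral 0, this is a multiple of [gphase] again. *)
Lemma is_derive_gphase b (t : R) : is_derive t 1 (gphase b) (- (t / 2) * gphase b t).
Proof.
pose f (s x : R) : R := cos (s * x + b) * gauss_fun x.
have df (s x : R) : is_derive s 1 (f^~ x) (- x * sin (s * x + b) * gauss_fun x).
  rewrite /f; apply: is_derive_eq; rewrite /GRing.scale/=; ring.
have pf (s x : R) : partial1of2 f s x = - x * sin (s * x + b) * gauss_fun x.
  by rewrite /partial1of2 derive1E derive_val.
have It : `]t - 1, t + 1[%classic t by rewrite /= in_itv/= gtrDl ltrDl ltrN10 ltr01.
have i1 (s : R) : `]t - 1, t + 1[%classic s -> mu.-integrable setT (EFin \o f s).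
  by move=> _; exact: integrable_cos_gauss_fun.
have i2 (s x : R) : `]t - 1, t + 1[%classic s -> setT x -> derivable (f^~ x) s 1.
  by move=> _ _; exact: ex_derive.
have i3 (x : R) : 0 <= gauss 1 0 x by rewrite ltW ?gauss_gt0.
have i4 : mu.-integrable setT (EFin \o gauss 1 0) by exact: integrable_gauss.
have i5 (s x : R) : `]t - 1, t + 1[%classic s -> setT x -> `|partial1of2 f s x| <= gauss 1 0 x.
  move=> _ _; rewrite pf !normrM normrN; apply: le_trans (norm_mul_gauss_fun_le x).
  rewrite (ger0_norm (gauss_fun_ge0 x)) ler_wpM2r ?gauss_fun_ge0// ler_piMr//.
  by rewrite ler_norml sin_geN1 sin_le1.
have D := @derivable_under_integral _ _ _ mu f setT measurableT t (t - 1) (t + 1) It i1 i2 (gauss 1 0) i3 i4 i5.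
have DE := @differentiation_under_integral _ _ _ mu f setT measurableT t (t - 1) (t + 1) It i1 i2 (gauss 1 0) i3 i4 i5.
apply: DeriveDef; first exact: D.
rewrite -derive1E DE.
have ms : mu.-integrable setT (EFin \o (fun x => x * sin (t * x + b) * gauss_fun x)).
  apply: le_integrable_real i4.
    apply: measurable_funM; last exact: measurable_gauss_fun.
    apply: measurable_funM; first exact: measurable_id.
    exact: measurable_sin_affine.
  by move=> x; have := i5 t x It I; rewrite pf mulNr mulNr normrN.
pose h (x : R) : R := sin (t * x + b) * gauss_fun x.
pose h' (x : R) : R := t * (cos (t * x + b) * gauss_fun x) - 2 * (x * sin (t * x + b) * gauss_fun x).
have J1 := integrableZl measurableT t (integrable_cos_gauss_fun t b).
have J2 := integrableZl measurableT 2 ms.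
have hle (x : R) : `|h x| <= gauss_fun x.
  rewrite /h normrM (ger0_norm (gauss_fun_ge0 x)) ler_piMl ?gauss_fun_ge0//.
  by rewrite ler_norml sin_geN1 sin_le1.
have g0 : (gauss_fun n%:R : R) @[n --> \oo] --> (0 : R).
  by apply: (cvg_comp _ _ (@cvgr_idn R)); exact: cvg_gauss_fun.
have h0 (u : nat -> R) : (forall n, u n ^+ 2 = n%:R ^+ 2) -> h (u n) @[n --> \oo] --> (0 : R).
  move=> uE; apply/norm_cvg0P; apply: squeeze_cvgr (cvg_cst (0 : R)) g0.
  by near=> n; rewrite normr_ge0 (le_trans (hle _))// /gauss_fun uE.
have : (\int[mu]_x h' x = 0)%R.
  apply: (@integral_derive_eq0 h).
  - move=> x; apply: cvgB; apply: cvgMr; (apply: cvgM; last exact: continuous_gauss_fun).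
      exact: continuous_cos_affine.
    by apply: cvgM; [exact: cvg_id|exact: continuous_sin_affine].
  - move=> x; rewrite /h /h'.
    have ? := is_derive_gauss_fun x.
    apply: is_derive_eq; rewrite /GRing.scale/=; ring.
  - exact: (integrableB measurableT J1 J2).
  - by apply: (h0 (fun n => n%:R)).
  - by apply: (h0 (fun n => - n%:R)) => n; rewrite sqrrN.
rewrite /h' RintegralB//.
rewrite RintegralZl//; last exact: integrable_cos_gauss_fun.
rewrite RintegralZl// -/(gphase b t) => E.
under eq_Rintegral => x _ do rewrite pf mulNr mulNr -mulN1r.
rewrite RintegralZl//; move: E; set A := (\int[mu]_x _)%R; set B := gphase b t; lra.
Unshelve. all: by end_near. Qed.

(** By the differential equation, [gphase b t] times exp (t^2 / 4) is constant in t, and its value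
    at t = 0 is the Gaussian integral. *)
Lemma cos_gauss_fun_integral b t :
  (\int[mu]_x (cos (t * x + b) * gauss_fun x) = cos b * Num.sqrt pi * expR (- (t ^+ 2 / 4)))%R.
Proof.
pose h (t : R) : R := gphase b t * expR (t ^+ 2 / 4).
have dh (s : R) : is_derive s 1 h 0.
  have H1 := is_derive_gphase b s.
  have H2 : is_derive s 1 (fun t : R => expR (t ^+ 2 / 4)) (s / 2 * expR (s ^+ 2 / 4)).
    by apply: is_derive_eq; rewrite /GRing.scale/=; field.
  have H := is_deriveM H1 H2.
  by apply: (is_derive_eq H); rewrite /GRing.scale/=; ring.
have h0 : h t = h 0 by apply: is_derive_0_is_cst.
have : h 0 = cos b * Num.sqrt pi.
  rewrite /h /gphase expr0n mul0r expR0 mulr1.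
  under eq_Rintegral => x _ do rewrite mul0r add0r.
  rewrite RintegralZl//; last exact: integrableT_gauss.
  by rewrite /Rintegral integralT_gauss.
by rewrite -h0 /h => <-; rewrite -/(gphase b t) -mulrA -expRD subrr expR0 mulr1.
Qed.

Lemma integrable_phase_gauss (phase : R -> R) a c : 0 < a ->
  measurable_fun setT phase -> (forall x, `|phase x| <= 1) ->
  mu.-integrable setT (EFin \o (fun x => phase x * gauss a c x)).
Proof.
move=> a0 mp p1; apply: le_integrable_real (integrable_gauss c a0).
  by apply: measurable_funM => //; exact: measurable_gauss.
by move=> x; rewrite normrM (gtr0_norm (gauss_gt0 _ _ _)) ler_piMl ?(ltW (gauss_gt0 _ _ _)).
Qed.

Lemma norm_cos_le1 (x : R) : `|cos x| <= 1.
Proof. by rewrite ler_norml cos_geN1 cos_le1. Qed.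

Lemma norm_sin_le1 (x : R) : `|sin x| <= 1.
Proof. by rewrite ler_norml sin_geN1 sin_le1. Qed.

(* Adding the Gaussian makes the integrand nonnegative, so that the change of variables for nonnegative functions applies. *)
Lemma cos_gauss_integral a c t b : 0 < a ->
  (\int[mu]_x (cos (t * x + b) * gauss a c x) =
   cos (t * c + b) * Num.sqrt (2 * pi / a) * expR (- (t ^+ 2 / (2 * a))))%R.
Proof.
move=> a0; set k := Num.sqrt (a / 2).
have k0 : 0 < k by rewrite sqrtr_gt0 divr_gt0.
have kE : k ^+ 2 = a / 2 by rewrite sqr_sqrtr// divr_ge0// ltW.
pose G (y : R) : R := (cos (t / k * y + (t * c + b)) + 1) * gauss_fun y.
have G0 y : 0 <= G y.
  by rewrite /G mulr_ge0 ?gauss_fun_ge0// -lerBlDr sub0r cos_geN1.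
have cG : continuous G.
  move=> y; apply: cvgM; last exact: continuous_gauss_fun.
  by apply: cvgD; [exact: continuous_cos_affine|exact: cvg_cst].
have E := ge0_integral_affine (- (k * c)) k0 cG G0.
have GE x : G (k * x + - (k * c)) = cos (t * x + b) * gauss a c x + gauss a c x.
  rewrite /G (gaussE _ _ a0) mulrDl mul1r; congr (cos _ * _ + _).
  by field; rewrite gt_eqF.
have I1 : mu.-integrable setT (EFin \o (fun x => cos (t * x + b) * gauss a c x)).
  apply: integrable_phase_gauss => //; first exact: measurable_cos_affine.
  by move=> x; exact: norm_cos_le1.
have I2 := integrable_gauss c a0.
have I3 := integrableD measurableT I1 I2.
have F1 : (\int[mu]_x G x = (\int[mu]_x (cos (t * x + b) * gauss a c x) + Num.sqrt (2 * pi / a)) * k)%R.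
  have <- : (\int[mu]_x gauss a c x = Num.sqrt (2 * pi / a))%R.
    by rewrite /Rintegral integral_gauss.
  rewrite -RintegralD// -RintegralZr//; rewrite /Rintegral E.
  by congr fine; apply: eq_integral => x _; rewrite GE.
have F2 : (\int[mu]_x G x = cos (t * c + b) * Num.sqrt pi * expR (- (t ^+ 2 / (2 * a))) + Num.sqrt pi)%R.
  under eq_Rintegral => x _ do rewrite /G mulrDl mul1r.
  rewrite RintegralD//; [|exact: integrable_cos_gauss_fun|exact: integrableT_gauss].
  rewrite cos_gauss_fun_integral /Rintegral integralT_gauss/=.
  congr (_ * expR _ + _).
  by rewrite exprMn exprVn kE; field; rewrite gt_eqF.
have SE : Num.sqrt (2 * pi / a) = Num.sqrt pi / k.
  rewrite -sqrtrV ?divr_ge0 ?ltW// -sqrtrM ?pi_ge0//.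
  by congr Num.sqrt; field; rewrite gt_eqF.
move: F1; rewrite F2 SE.
set A := (\int[mu]_x _)%R; set S := Num.sqrt pi => F1.
apply: (mulIf (lt0r_neq0 k0)).
have -> : A * k = (A + S / k) * k - S by field; rewrite gt_eqF.
by rewrite -F1; field; rewrite gt_eqF.
Qed.

Lemma sin_gauss_integral a c t b : 0 < a ->
  (\int[mu]_x (sin (t * x + b) * gauss a c x) =
   sin (t * c + b) * Num.sqrt (2 * pi / a) * expR (- (t ^+ 2 / (2 * a))))%R.
Proof.
move=> a0.
have sE y : sin (t * y + b) = cos (t * y + (b - pi / 2)).
  by rewrite addrA cosB cos_pihalf sin_pihalf mulr0 add0r mulr1.
under eq_Rintegral => x _ do rewrite sE.
by rewrite cos_gauss_integral// -sE.
Qed.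

End line_integrals.

(** * Product measures and complex-valued integrals *)

Section product_integrals.
Context d1 d2 (T1 : measurableType d1) (T2 : measurableType d2) (R : realType).
Variables (m1 : {sigma_finite_measure set T1 -> \bar R}).
Variables (m2 : {sigma_finite_measure set T2 -> \bar R}).

Lemma measurable_fun_tensor (f : T1 -> R) (g : T2 -> R) :
  measurable_fun setT f -> measurable_fun setT g ->
  measurable_fun setT (fun w : T1 * T2 => f w.1 * g w.2).
Proof.
move=> mf mg; apply: measurable_funM.
  by apply: measurableT_comp.
by apply: measurableT_comp.
Qed.

Lemma ge0_integral_tensor (f : T1 -> R) (g : T2 -> R) :
  measurable_fun setT f -> measurable_fun setT g ->
  (forall x, 0 <= f x) -> (forall y, 0 <= g y) ->
  (\int[m1 \x m2]_w (f w.1 * g w.2)%:E =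
   \int[m1]_x (f x)%:E * \int[m2]_y (g y)%:E)%E.
Proof.
move=> mf mg f0 g0.
rewrite fubini_tonelli1/=; last 2 first.
- by apply/measurable_EFinP; exact: measurable_fun_tensor.
- by move=> w; rewrite lee_fin mulr_ge0.
rewrite /fubini_F/=.
rewrite -ge0_integralZr//; last 3 first.
- by apply/measurable_EFinP.
- by move=> x _; rewrite lee_fin.
- by apply: integral_ge0 => y _; rewrite lee_fin.
apply: eq_integral => x _.
under eq_integral => y _ do rewrite EFinM.
by rewrite ge0_integralZl//; [exact/measurable_EFinP|by move=> y _; rewrite lee_fin|rewrite lee_fin].
Qed.

Lemma integrable_tensor (f : T1 -> R) (g : T2 -> R) :
  m1.-integrable setT (EFin \o f) -> m2.-integrable setT (EFin \o g) ->
  (m1 \x m2)%E.-integrable setT (EFin \o (fun w => f w.1 * g w.2)).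
Proof.
move=> /integrableP[/measurable_EFinP mf fi] /integrableP[/measurable_EFinP mg gi].
apply/integrableP; split.
  by apply/measurable_EFinP; exact: measurable_fun_tensor.
under eq_integral => w _ do rewrite /= normrM.
rewrite (@ge0_integral_tensor (fun x => `|f x|) (fun y => `|g y|))//.
- by apply: lte_mul_pinfty => //; [exact: integral_ge0|rewrite ge0_fin_numE//; exact: integral_ge0].
- exact: measurableT_comp.
- exact: measurableT_comp.
Qed.

Lemma Rintegral_tensor (f : T1 -> R) (g : T2 -> R) :
  m1.-integrable setT (EFin \o f) -> m2.-integrable setT (EFin \o g) ->
  (\int[(m1 \x m2)%E]_w (f w.1 * g w.2) = (\int[m1]_x f x) * (\int[m2]_y g y))%R.
Proof.
move=> fi gi; have fgi := integrable_tensor fi gi.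
rewrite {1}/Rintegral -(integral12_prod_meas1 fgi)/= /fubini_F/=.
rewrite -RintegralZr// /Rintegral; congr fine; apply: eq_integral => x _.
rewrite EFinM fineK; last exact: integrable_fin_num.
by rewrite -(integralZl measurableT gi); apply: eq_integral => y _; rewrite EFinM.
Qed.

End product_integrals.

Section real_integrals.
Context d (T : measurableType d) (R : realType).
Variable mu : {measure set T -> \bar R}.
Implicit Types f g : T -> R.

Lemma integrableD_real f g : mu.-integrable setT (EFin \o f) ->
  mu.-integrable setT (EFin \o g) -> mu.-integrable setT (EFin \o (fun x => f x + g x)).
Proof. by move=> fi gi; exact: (integrableD measurableT fi gi). Qed.

Lemma integrableB_real f g : mu.-integrable setT (EFin \o f) ->
  mu.-integrable setT (EFin \o g) -> mu.-integrable setT (EFin \o (fun x => f x - g x)).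
Proof. by move=> fi gi; exact: (integrableB measurableT fi gi). Qed.

Lemma integrableZl_real k f : mu.-integrable setT (EFin \o f) ->
  mu.-integrable setT (EFin \o (fun x => k * f x)).
Proof. by move=> fi; exact: (integrableZl measurableT k fi). Qed.

End real_integrals.

Section complex_integrals.
Context d (T : measurableType d) (R : realType).
Implicit Type mu : {measure set T -> \bar R}.

Definition cintegrable mu (f : T -> R[i]) : Prop :=
  mu.-integrable setT (EFin \o (Re \o f)) /\ mu.-integrable setT (EFin \o (Im \o f)).

Lemma complexReM (x y : R[i]) : Re (x * y) = Re x * Re y - Im x * Im y.
Proof. by case: x; case: y. Qed.

Lemma complexImM (x y : R[i]) : Im (x * y) = Re x * Im y + Im x * Re y.
Proof. by case: x; case: y. Qed.

Lemma complex_eq (x y : R[i]) : Re x = Re y -> Im x = Im y -> x = y.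
Proof. by case: x => a b; case: y => c e /= -> ->. Qed.

Lemma cintegrableZl mu (k : R[i]) f : cintegrable mu f -> cintegrable mu (fun x => k * f x).
Proof.
move=> [f1 f2]; split.
  rewrite (_ : Re \o _ = fun x => Re k * Re (f x) - Im k * Im (f x)).
    by apply: integrableB_real; exact: integrableZl_real.
  by apply/funext => x /=; rewrite complexReM.
rewrite (_ : Im \o _ = fun x => Re k * Im (f x) + Im k * Re (f x)).
  by apply: integrableD_real; exact: integrableZl_real.
by apply/funext => x /=; rewrite complexImM.
Qed.

Lemma cintegralZl mu (k : R[i]) f : cintegrable mu f ->
  cintegral mu setT (fun x => k * f x) = k * cintegral mu setT f.
Proof.
move=> [f1 f2]; apply: complex_eq; rewrite ?complexReM ?complexImM /=.
  under eq_Rintegral => x _ do rewrite complexReM.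
  by rewrite RintegralB ?RintegralZl//; exact: integrableZl_real.
under eq_Rintegral => x _ do rewrite complexImM.
by rewrite RintegralD ?RintegralZl//; exact: integrableZl_real.
Qed.

Lemma eq_cintegral mu (f g : T -> R[i]) : f =1 g -> cintegral mu setT f = cintegral mu setT g.
Proof. by move=> /funext ->. Qed.

End complex_integrals.

Section complex_tensor.
Context d1 d2 (T1 : measurableType d1) (T2 : measurableType d2) (R : realType).
Variables (m1 : {sigma_finite_measure set T1 -> \bar R}).
Variables (m2 : {sigma_finite_measure set T2 -> \bar R}).

Lemma cintegrable_tensor (f : T1 -> R[i]) (g : T2 -> R[i]) :
  cintegrable m1 f -> cintegrable m2 g -> cintegrable (m1 \x m2)%E (fun w => f w.1 * g w.2).
Proof.
move=> [f1 f2] [g1 g2]; split.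
  rewrite (_ : Re \o _ = fun w => Re (f w.1) * Re (g w.2) - Im (f w.1) * Im (g w.2)).
    by apply: integrableB_real; [exact: (integrable_tensor f1 g1)|exact: (integrable_tensor f2 g2)].
  by apply/funext => x /=; rewrite complexReM.
rewrite (_ : Im \o _ = fun w => Re (f w.1) * Im (g w.2) + Im (f w.1) * Re (g w.2)).
  by apply: integrableD_real; [exact: (integrable_tensor f1 g2)|exact: (integrable_tensor f2 g1)].
by apply/funext => x /=; rewrite complexImM.
Qed.

Lemma cintegral_tensor (f : T1 -> R[i]) (g : T2 -> R[i]) :
  cintegrable m1 f -> cintegrable m2 g ->
  cintegral (m1 \x m2)%E setT (fun w => f w.1 * g w.2) =
  cintegral m1 setT f * cintegral m2 setT g.
Proof.
move=> [f1 f2] [g1 g2]; apply: complex_eq.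
  transitivity (\int[(m1 \x m2)%E]_w (Re (f w.1) * Re (g w.2) - Im (f w.1) * Im (g w.2)))%R.
    by apply: eq_Rintegral => w _; rewrite complexReM.
  rewrite RintegralB//; [|exact: (integrable_tensor f1 g1)|exact: (integrable_tensor f2 g2)].
  by rewrite (Rintegral_tensor f1 g1) (Rintegral_tensor f2 g2) complexReM.
transitivity (\int[(m1 \x m2)%E]_w (Re (f w.1) * Im (g w.2) + Im (f w.1) * Re (g w.2)))%R.
  by apply: eq_Rintegral => w _; rewrite complexImM.
rewrite RintegralD//; [|exact: (integrable_tensor f1 g2)|exact: (integrable_tensor f2 g1)].
by rewrite (Rintegral_tensor f1 g2) (Rintegral_tensor f2 g1) complexImM.
Qed.

End complex_tensor.

Section sigma_finite_product.
Context d1 d2 (T1 : measurableType d1) (T2 : measurableType d2) (R : realType).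
Variables (m1 : {sigma_finite_measure set T1 -> \bar R}).
Variables (m2 : {sigma_finite_measure set T2 -> \bar R}).

(* A copy of the product measure, on which the sigma-finite structure can be declared: the canonical structure of the library is the one of products of finite measures. *)
Definition sprod : set (T1 * T2) -> \bar R := (m1 \x m2)%E.

HB.instance Definition _ := Measure.on sprod.

Lemma sprod_sigma_finite : sigma_finite setT sprod.
Proof.
have /sigma_finiteP[F [FT ndF Foo]] := sigma_finiteT m1.
have /sigma_finiteP[G [GT ndG Goo]] := sigma_finiteT m2.
exists (fun n => F n `*` G n) => [|k].
  apply/seteqP; split => // -[x y] _.
  have [n _ Fx] : (\bigcup_n F n) x by rewrite -FT.
  have [k _ Gy] : (\bigcup_n G n) y by rewrite -GT.
  exists (maxn n k) => //; split => /=.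
    by move: x Fx; exact/subsetPset/ndF/leq_maxl.
  by move: y Gy; exact/subsetPset/ndG/leq_maxr.
have [? ?] := Foo k; have [? ?] := Goo k; split; first exact: measurableX.
by rewrite /sprod product_measure1E// lte_mul_pinfty// ge0_fin_numE.
Qed.

HB.instance Definition _ := @Measure_isSigmaFinite.Build _ _ _ sprod sprod_sigma_finite.

End sigma_finite_product.

Section R5_tensor.
Variable R : realType.
Local Notation mR := (measurableTypeR R).
Local Notation lam := (@lebesgue_measure R).

(** Iterating [sprod] keeps sigma-finiteness at every stage, so that Fubini and Tonelli apply to all
    the factors; [leb5E] carries the results back to [leb5]. *)
Definition sleb2 : {sigma_finite_measure set (mR * mR)%type -> \bar R} := sprod lam lam.
Definition sleb3 : {sigma_finite_measure set (mR * mR * mR)%type -> \bar R} := sprod sleb2 lam.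
Definition sleb4 : {sigma_finite_measure set (mR * mR * mR * mR)%type -> \bar R} := sprod sleb3 lam.
Definition sleb5 : {sigma_finite_measure set (mR * mR * mR * mR * mR)%type -> \bar R} := sprod sleb4 lam.

Lemma leb2E : (leb2 R : set _ -> \bar R) = sleb2. Proof. by []. Qed.

Lemma leb3E : (leb3 R : set _ -> \bar R) = sleb3. Proof. by rewrite /leb3/= leb2E. Qed.

Lemma leb5E : (leb5 R : set _ -> \bar R) = sleb5.
Proof. by rewrite /leb5/= leb3E. Qed.

Lemma integral_leb5 (f : R5 mR -> \bar R) : (\int[leb5 R]_z f z = \int[sleb5]_z f z)%E.
Proof. exact: (congr1 (fun m : set _ -> \bar R => integral m setT f) leb5E). Qed.

Lemma cintegral_leb5 (f : R5 mR -> R[i]) : cintegral (leb5 R) setT f = cintegral sleb5 setT f.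
Proof.
exact: (congr2 (fun x y => Complex (fine x) (fine y)) (integral_leb5 _) (integral_leb5 _)).
Qed.

Definition tensor5 (S : Type) (op : S -> S -> S) (f1 f2 f3 f4 f5 : R -> S) (z : R5 R) : S :=
  op (op (op (op (f1 z.1.1.1.1) (f2 z.1.1.1.2)) (f3 z.1.1.2)) (f4 z.1.2)) (f5 z.2).

Lemma cintegrable_tensor5 (f1 f2 f3 f4 f5 : mR -> R[i]) :
  cintegrable lam f1 -> cintegrable lam f2 -> cintegrable lam f3 ->
  cintegrable lam f4 -> cintegrable lam f5 ->
  cintegrable (leb5 R) (tensor5 *%R f1 f2 f3 f4 f5).
Proof.
move=> h1 h2 h3 h4 h5.
have H2 := cintegrable_tensor h1 h2.
have H3 := cintegrable_tensor (m1 := sleb2) H2 h3.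
have H4 := cintegrable_tensor (m1 := sleb3) H3 h4.
have [H5 H5'] := cintegrable_tensor (m1 := sleb4) H4 h5.
by split; rewrite leb5E.
Qed.

Lemma cintegral_tensor5 (f1 f2 f3 f4 f5 : mR -> R[i]) :
  cintegrable lam f1 -> cintegrable lam f2 -> cintegrable lam f3 ->
  cintegrable lam f4 -> cintegrable lam f5 ->
  cintegral (leb5 R) setT (tensor5 *%R f1 f2 f3 f4 f5) =
  tensor5 *%R (fun=> cintegral lam setT f1) (fun=> cintegral lam setT f2) (fun=> cintegral lam setT f3)
    (fun=> cintegral lam setT f4) (fun=> cintegral lam setT f5) 0.
Proof.
move=> h1 h2 h3 h4 h5.
have H2 := cintegrable_tensor h1 h2.
have H3 := cintegrable_tensor (m1 := sleb2) H2 h3.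
have H4 := cintegrable_tensor (m1 := sleb3) H3 h4.
rewrite cintegral_leb5; apply: etrans (cintegral_tensor (m1 := sleb4) H4 h5) _.
rewrite /tensor5 -(cintegral_tensor h1 h2) -(cintegral_tensor (m1 := sleb2) H2 h3).
by rewrite -(cintegral_tensor (m1 := sleb3) H3 h4).
Qed.

Lemma ge0_integral_tensor5 (f1 f2 f3 f4 f5 : mR -> R) :
  measurable_fun setT f1 -> measurable_fun setT f2 -> measurable_fun setT f3 ->
  measurable_fun setT f4 -> measurable_fun setT f5 ->
  (forall x, 0 <= f1 x) -> (forall x, 0 <= f2 x) -> (forall x, 0 <= f3 x) ->
  (forall x, 0 <= f4 x) -> (forall x, 0 <= f5 x) ->
  (\int[leb5 R]_z (tensor5 *%R f1 f2 f3 f4 f5 z)%:E =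
  \int[lam]_x (f1 x)%:E * \int[lam]_x (f2 x)%:E * \int[lam]_x (f3 x)%:E *
  \int[lam]_x (f4 x)%:E * \int[lam]_x (f5 x)%:E)%E.
Proof.
move=> m1 m2 m3 m4 m5 p1 p2 p3 p4 p5.
have M2 := measurable_fun_tensor m1 m2.
have M3 := measurable_fun_tensor M2 m3.
have M4 := measurable_fun_tensor M3 m4.
rewrite leb5E -(ge0_integral_tensor lam lam m1 m2)//.
rewrite -(ge0_integral_tensor sleb2 lam M2 m3)//; last by move=> w; rewrite mulr_ge0.
rewrite -(ge0_integral_tensor sleb3 lam M3 m4)//; last by move=> w; rewrite !mulr_ge0.
by rewrite -(ge0_integral_tensor sleb4 lam M4 m5)// => w; rewrite !mulr_ge0.
Qed.

End R5_tensor.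

(** * Schwartz functions of Gaussian type *)

Section oscillating_gaussians.
Variables (R : realType) (V : normedModType R).
Implicit Types f g h : V -> R.

(** Affinity is encoded by the three facts in use: a multiplier can be differentiated, its
    directional derivatives are constants, and multiplying by it costs one power of 1 + |x|. *)
Definition affine_fun h : Prop :=
  [/\ forall x, differentiable h x,
      forall v, exists d, forall x, 'D_v h x = d
    & exists K, forall x, `|h x| <= K * (1 + `|x|)].

Lemma affine_cst k : affine_fun (fun=> k).
Proof.
split=> [x|v|]; first exact: differentiable_cst.
  by exists 0 => x; rewrite derive_cst.
exists `|k| => x; rewrite ler_peMr// lerDl//.
Qed.

Lemma affineD h1 h2 : affine_fun h1 -> affine_fun h2 -> affine_fun (fun x => h1 x + h2 x).
Proof.
move=> [d1 e1 [K1 b1]] [d2 e2 [K2 b2]]; split=> [x|v|].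
- exact: differentiableD.
- have [c1 E1] := e1 v; have [c2 E2] := e2 v; exists (c1 + c2) => x.
  by rewrite -(E1 x) -(E2 x) -deriveD//; exact: diff_derivable.
- by exists (K1 + K2) => x; rewrite mulrDl (le_trans (ler_normD _ _))// lerD.
Qed.

Lemma affineZ k h : affine_fun h -> affine_fun (fun x => k * h x).
Proof.
move=> [d1 e1 [K1 b1]]; split=> [x|v|].
- exact: (@differentiableZ _ _ _ h).
- have [c1 E1] := e1 v; exists (k * c1) => x.
  by rewrite -(E1 x); apply: (@deriveZ _ _ _ h k); exact: diff_derivable.
- by exists (`|k| * K1) => x; rewrite normrM -mulrA ler_wpM2l.
Qed.

Lemma derive_comp_real (F : R -> R) g (x v : V) dF : is_derive (g x) 1 F dF ->
  differentiable g x -> differentiable (F \o g) x /\ 'D_v (F \o g) x = dF * 'D_v g x.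
Proof.
move=> HF dg.
have dF1 : differentiable F (g x) by apply/derivable1_diffP; exact: ex_derive.
have dFg : differentiable (F \o g) x by exact: differentiable_comp.
split=> //; rewrite deriveE// diff_comp//= -(deriveE v dg).
have -> : 'D_v g x = 'D_v g x *: (1 : R) by rewrite /GRing.scale/= mulr1.
rewrite (linearZ _ (1 : R))/= -deriveE// derive_val.
by rewrite /GRing.scale/= mulr1 mulrC.
Qed.

Variables (q l : V -> R).
Hypothesis dq : forall x, differentiable q x.
Hypothesis q' : forall v, affine_fun ('D_v q).
Hypothesis al : affine_fun l.
Hypothesis decay_q : forall N, exists M, forall x, (1 + `|x|) ^+ N * expR (- q x) <= M.

(** A class stable under differentiation: a generator differentiates to an affine multiple of itself
    plus a constant multiple of the generator whose phase is shifted by pi / 2. Phase shifts stand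
    for sines, so one kind of generator covers real parts, imaginary parts and all their
    derivatives. *)
Inductive osc : (V -> R) -> Prop :=
| osc_base b : osc (fun x => expR (- q x) * cos (l x + b))
| osc_add f g : osc f -> osc g -> osc (fun x => f x + g x)
| osc_mul h f : affine_fun h -> osc f -> osc (fun x => h x * f x).

Lemma osc_derive_base b x v :
  differentiable (fun x => expR (- q x) * cos (l x + b)) x /\
  'D_v (fun x => expR (- q x) * cos (l x + b)) x =
   (- 'D_v q x) * (expR (- q x) * cos (l x + b)) +
   'D_v l x * (expR (- q x) * cos (l x + (b + pi / 2))).
Proof.
have [dl _ _] := al.
have dNq : differentiable (- q) x by exact: differentiableN.
have dlb : differentiable (fun x => l x + b) x by apply: differentiableD.
have [d1 E1] := @derive_comp_real expR (- q) x v _ (is_derive_expR _) dNq.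
have [d2 E2] := @derive_comp_real cos (fun x => l x + b) x v _ (is_derive_cos _) dlb.
split; first exact: (differentiableM d1 d2).
rewrite (@deriveM _ _ (expR \o (- q)) (cos \o (fun x => l x + b))); [|exact: diff_derivable..].
rewrite E1 E2 deriveN; last exact: diff_derivable.
have -> : 'D_v (fun x => l x + b) x = 'D_v l x.
  by rewrite (@deriveD _ _ _ l (cst b)) ?derive_cst ?addr0//; exact: diff_derivable.
have -> : cos (l x + (b + pi / 2)) = - sin (l x + b).
  by rewrite addrA cosD cos_pihalf sin_pihalf mulr0 mulr1 sub0r.
rewrite /GRing.scale/=; ring.
Qed.

Lemma osc_differentiable f : osc f -> forall x, differentiable f x.
Proof.
elim=> {f} [b|f g _ df _ dg|h f [dh _ _] _ df] x.
- by have [] := osc_derive_base b x 0.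
- exact: differentiableD.
- exact: (differentiableM (dh x) (df x)).
Qed.

Lemma osc_derive v f : osc f -> osc ('D_v f).
Proof.
elim=> {f} [b|f g of_ df og dg|h f ah of_ df].
- have [_ /(_ v)[c cE] _] := al.
  rewrite (_ : 'D_v _ = fun x => (-1 * 'D_v q x) * (expR (- q x) * cos (l x + b)) +
     c * (expR (- q x) * cos (l x + (b + pi / 2)))).
    apply: osc_add; first by apply: osc_mul (osc_base _); exact: affineZ.
    by apply: (osc_mul (affine_cst c)) (osc_base _).
  by apply/funext => x; have [_ ->] := osc_derive_base b x v; rewrite cE mulN1r.
- rewrite (_ : 'D_v _ = fun x => 'D_v f x + 'D_v g x); first exact: osc_add.
  apply/funext => x; rewrite -deriveD//; apply: diff_derivable; exact: osc_differentiable.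
- have [dh /(_ v)[c cE] _] := ah.
  rewrite (_ : 'D_v _ = fun x => h x * 'D_v f x + c * f x).
    by apply: osc_add; [exact: osc_mul|exact: (osc_mul (affine_cst c))].
  apply/funext => x; rewrite (@deriveM _ _ h f); [|exact: diff_derivable|].
    by rewrite cE /GRing.scale/= [_ * c]mulrC.
  by apply: diff_derivable; exact: osc_differentiable.
Qed.

Lemma osc_decay f : osc f -> forall N, exists M, forall x, (1 + `|x|) ^+ N * `|f x| <= M.
Proof.
have p0 (x : V) : 0 <= 1 + `|x| by rewrite addr_ge0.
elim=> {f} [b|f g _ df _ dg|h f [_ _ [K bK]] _ df] N.
- have [M HM] := decay_q N; exists M => x; apply: le_trans (HM x).
  rewrite ler_wpM2l ?exprn_ge0// normrM (gtr0_norm (expR_gt0 _)) ler_piMr ?expR_ge0//.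
  by rewrite ler_norml cos_geN1 cos_le1.
- have [M1 H1] := df N; have [M2 H2] := dg N; exists (M1 + M2) => x.
  by rewrite (le_trans _ (lerD (H1 x) (H2 x)))// -mulrDr ler_wpM2l ?exprn_ge0// ler_normD.
(* The linear growth of [h] is paid by one more power of 1 + |x| in the induction hypothesis. *)
- have [M HM] := df N.+1; exists (K * M) => x.
  have K0 : 0 <= K.
    by have := le_trans (normr_ge0 _) (bK 0); rewrite normr0 addr0 mulr1.
  rewrite normrM mulrCA.
  apply: (@le_trans _ _ (K * (1 + `|x|) * ((1 + `|x|) ^+ N * `|f x|))).
    by rewrite ler_wpM2r// mulr_ge0// exprn_ge0.
  by rewrite -mulrA ler_wpM2l// mulrA -exprS.
Qed.

Lemma osc_iter_derive vs f : osc f -> osc (iter_derive vs f).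
Proof. by move=> of_; elim: vs => //= v vs; exact: osc_derive. Qed.

Lemma schwartz_osc (F : V -> R[i]) : osc (@complex.Re _ \o F) -> osc (@complex.Im _ \o F) -> schwartz F.
Proof.
move=> o1 o2; split=> [vs x|N vs].
  by split; apply: osc_differentiable; exact: osc_iter_derive.
have [M1 H1] := osc_decay (osc_iter_derive vs o1) N.
have [M2 H2] := osc_decay (osc_iter_derive vs o2) N.
exists (Num.max M1 M2) => x; split; rewrite le_max ?H1//.
by rewrite H2 orbT.
Qed.

End oscillating_gaussians.

Section gaussian_decay.
Variable R : realType.

Lemma exprn_expR_le (n : nat) (x : R) : 0 <= x -> x ^+ n * expR (- x) <= n`!%:R.
Proof.
move=> x0; rewrite expRN ler_pdivrMr ?expR_gt0//.
case: n => [|n]; first by rewrite expr0 mul1r -expR0 ler_expR.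
rewrite mulrC -ler_pdivrMr ?ltr0n ?fact_gt0//.
apply: le_trans (expR_ge1Dxn n x0); by rewrite lerDr.
Qed.

Lemma poly_gauss_decay (k : R) (N : nat) : 0 < k ->
  exists M, forall y, 0 <= y -> (1 + y) ^+ N * expR (- (k * y ^+ 2)) <= M.
Proof.
(* The minimum of k y^2 - y is - 1 / (4 k), so - k y^2 <= - (1 + y) + C, and the Gaussian is
   replaced by an exponential in 1 + y. *)
move=> k0; pose C := 1 + 1 / (4 * k).
exists (N`!%:R * expR C) => y y0.
have y1 : 0 <= 1 + y by rewrite addr_ge0.
apply: le_trans (_ : (1 + y) ^+ N * (expR (- (1 + y)) * expR C) <= _); last first.
  by rewrite mulrA ler_wpM2r ?expR_ge0// exprn_expR_le.
rewrite ler_wpM2l ?exprn_ge0// -expRD ler_expR /C.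
have : 0 <= k * (y - 1 / (2 * k)) ^+ 2 by rewrite mulr_ge0 ?sqr_ge0// ltW.
rewrite sqrrB => H.
have -> : - (k * y ^+ 2) = - (k * (y ^+ 2 - y * (1 / (2 * k)) *+ 2 + (1 / (2 * k)) ^+ 2)) - y + 1 / (4 * k).
  by field; rewrite gt_eqF.
lra.
Qed.

End gaussian_decay.

Section coordinates.
Variable R : realType.

Lemma affine_linear (V : normedModType R) (p : V -> R) : linear p ->
  (forall z, `|p z| <= `|z|) -> affine_fun p.
Proof.
move=> lp pz.
pose p' : {linear V -> R} := HB.pack p (GRing.isLinear.Build _ _ _ _ p lp).
have cp : continuous p'.
  apply/bounded_linear_continuous/linear_boundedP; near=> r => x.
  apply: le_trans (pz x) _; rewrite ler_peMl//.
split=> [z|v|].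
- exact: (linear_differentiable (f := p')).
- exists (p v) => z; rewrite deriveE; last exact: (linear_differentiable (f := p')).
  by rewrite (diff_lin (f := p')).
- by exists 1 => z; rewrite mul1r (le_trans (pz z))// lerDr.
Unshelve. all: by end_near. Qed.

Lemma norm_fst_le (V W : normedModType R) (z : V * W) : `|z.1| <= `|z|.
Proof. by rewrite prod_normE le_max lexx. Qed.

Lemma norm_snd_le (V W : normedModType R) (z : V * W) : `|z.2| <= `|z|.
Proof. by rewrite prod_normE le_max lexx orbT. Qed.

Lemma affine_coord1 : affine_fun (fun z : R5 R => z.1.1.1.1).
Proof.
apply: affine_linear => // z.
by rewrite (le_trans (norm_fst_le _))// (le_trans (norm_fst_le _))// (le_trans (norm_fst_le _)) ?norm_fst_le.
Qed.

Lemma affine_coord2 : affine_fun (fun z : R5 R => z.1.1.1.2).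
Proof.
apply: affine_linear => // z.
by rewrite (le_trans (norm_snd_le _))// (le_trans (norm_fst_le _))// (le_trans (norm_fst_le _)) ?norm_fst_le.
Qed.

Lemma affine_coord3 : affine_fun (fun z : R5 R => z.1.1.2).
Proof.
apply: affine_linear => // z.
by rewrite (le_trans (norm_snd_le _))// (le_trans (norm_fst_le _)) ?norm_fst_le.
Qed.

Lemma affine_coord4 : affine_fun (fun z : R5 R => z.1.2).
Proof. by apply: affine_linear => // z; rewrite (le_trans (norm_snd_le _)) ?norm_fst_le. Qed.

Lemma affine_coord5 : affine_fun (fun z : R5 R => z.2).
Proof. by apply: affine_linear => // z; exact: norm_snd_le. Qed.

Lemma derive_half_square (V : normedModType R) (h : V -> R) a c : affine_fun h ->
  (forall z, differentiable (fun z => a * (h z - c) ^+ 2 / 2) z) /\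
  forall v, affine_fun ('D_v (fun z => a * (h z - c) ^+ 2 / 2)).
Proof.
move=> ah; have [dh e _] := ah.
have dF (y : R) : is_derive y 1 (fun y => a * (y - c) ^+ 2 / 2) (a * (y - c)).
  by apply: is_derive_eq; rewrite /GRing.scale/=; field.
split=> [z|v].
  by have [] := derive_comp_real 0 (dF (h z)) (dh z).
have [d dE] := e v.
rewrite (_ : 'D_v _ = fun z => d * a * (h z + - c)).
  by apply: affineZ; apply: affineD => //; exact: affine_cst.
apply/funext => z; have [_ ->] := derive_comp_real v (dF (h z)) (dh z).
by rewrite dE; ring.
Qed.

End coordinates.

(** * Fourier transforms of Gaussian packets *)

Section waves.
Variable R : realType.
Local Notation mR := (measurableTypeR R).
Local Notation lam := (@lebesgue_measure R).

(* x |-> exp (- a (x - c)^2 / 2 + i (t x + b)) *)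
Record wave_param := Wave { wa : R; wc : R; wt : R; wb : R }.
Implicit Type w : wave_param.

Definition polar (r th : R) : R[i] := Complex (r * cos th) (r * sin th).

Definition wave w (x : R) : R[i] := polar (gauss (wa w) (wc w) x) (wt w * x + wb w).

Lemma polarM r1 r2 th1 th2 : polar r1 th1 * polar r2 th2 = polar (r1 * r2) (th1 + th2).
Proof.
by apply: complex_eq; rewrite ?complexReM ?complexImM /= ?cosD ?sinD; ring.
Qed.

Lemma cexpE th : cexp th = polar 1 th.
Proof. by rewrite /cexp /polar !mul1r. Qed.

Lemma real_polarE (r : R) : Complex r 0 = polar r 0.
Proof. by rewrite /polar cos0 sin0 mulr1 mulr0. Qed.

Lemma cabs_polar r th : 0 <= r -> cabs (polar r th) = r.
Proof.
move=> r0; rewrite /cabs /= !exprMn -mulrDr cos2Dsin2 mulr1 sqrtr_sqr ger0_norm//.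
Qed.

(** Fourier integrals exchange the centre and the frequency of a packet, up to sign, and invert its
    width parameter. [inv_wave] is for the kernel exp (i s x), [dir_wave] for exp (- i s x), both
    without the amplitude [amp]. In [heat_wave] the weight exp (- u x^2) is absorbed into the
    packet, up to a constant factor. *)
Definition inv_wave w := Wave (wa w)^-1 (- wt w) (wc w) (wt w * wc w + wb w).
Definition dir_wave w := Wave (wa w)^-1 (wt w) (- wc w) (wt w * wc w + wb w).
Definition heat_wave u w :=
  Wave (wa w + 2 * u) (wa w * wc w / (wa w + 2 * u)) (wt w) (wb w).

Lemma wave_mod s w x : cexp (s * x) * wave w x = wave (Wave (wa w) (wc w) (s + wt w) (wb w)) x.
Proof. by rewrite cexpE polarM mul1r /wave/=; congr polar; ring. Qed.

Lemma cintegrable_wave w : 0 < wa w -> cintegrable lam (wave w).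
Proof.
move=> a0; split; rewrite /=.
  rewrite (_ : _ \o _ = fun x => cos (wt w * x + wb w) * gauss (wa w) (wc w) x).
    apply: integrable_phase_gauss => //; first exact: measurable_cos_affine.
    by move=> x; exact: norm_cos_le1.
  by apply/funext => x /=; rewrite mulrC.
rewrite (_ : _ \o _ = fun x => sin (wt w * x + wb w) * gauss (wa w) (wc w) x).
  apply: integrable_phase_gauss => //; first exact: measurable_sin_affine.
  by move=> x; exact: norm_sin_le1.
by apply/funext => x /=; rewrite mulrC.
Qed.

Lemma cintegral_wave w : 0 < wa w -> cintegral lam setT (wave w) =
  polar (Num.sqrt (2 * pi / wa w) * expR (- (wt w ^+ 2 / (2 * wa w)))) (wt w * wc w + wb w).
Proof.
move=> a0; apply: complex_eq => /=.
  transitivity (\int[lam]_x (cos (wt w * x + wb w) * gauss (wa w) (wc w) x))%R.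
    by apply: eq_Rintegral => x _; rewrite mulrC.
  by rewrite cos_gauss_integral//; ring.
transitivity (\int[lam]_x (sin (wt w * x + wb w) * gauss (wa w) (wc w) x))%R.
  by apply: eq_Rintegral => x _; rewrite mulrC.
by rewrite sin_gauss_integral//; ring.
Qed.

Lemma cintegral_wave_inv w s : 0 < wa w ->
  cintegral lam setT (fun x => cexp (s * x) * wave w x) =
  Complex (Num.sqrt (2 * pi / wa w)) 0 * wave (inv_wave w) s.
Proof.
move=> a0; transitivity (cintegral lam setT (wave (Wave (wa w) (wc w) (s + wt w) (wb w)))).
  by apply: eq_cintegral => x; exact: wave_mod.
rewrite cintegral_wave//= real_polarE polarM.
rewrite /gauss /=; congr polar; last by ring.
congr (_ * expR (- _)); field; rewrite gt_eqF//.
Qed.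

Lemma cintegral_wave_dir w s : 0 < wa w ->
  cintegral lam setT (fun x => cexp (- s * x) * wave w x) =
  Complex (Num.sqrt (2 * pi / wa w)) 0 * wave (dir_wave w) s.
Proof.
move=> a0; rewrite cintegral_wave_inv//; congr (_ * polar _ _) => /=; last by ring.
by rewrite /gauss/= ; congr (expR (- _)); ring.
Qed.

Lemma cintegrable_wave_mod w s : 0 < wa w -> cintegrable lam (fun x => cexp (s * x) * wave w x).
Proof.
move=> a0; rewrite (_ : (fun x => _) = wave (Wave (wa w) (wc w) (s + wt w) (wb w))).
  exact: cintegrable_wave.
by apply/funext => x; rewrite wave_mod.
Qed.

Variables w1 w2 w3 w4 w5 : wave_param.

Definition tmap (f : wave_param -> R -> R[i]) : R5 R -> R[i] :=
  tensor5 *%R (f w1) (f w2) (f w3) (f w4) (f w5).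

Definition amp w : R[i] := Complex (Num.sqrt (2 * pi / wa w)) 0.

Hypotheses (a1 : 0 < wa w1) (a2 : 0 < wa w2) (a3 : 0 < wa w3) (a4 : 0 < wa w4) (a5 : 0 < wa w5).

Lemma cintegrable_tmap_wave : cintegrable (leb5 R) (tmap wave).
Proof. by apply: cintegrable_tensor5; exact: cintegrable_wave. Qed.

Lemma fourier_wave k z :
  fourier (fun x => k * tmap wave x) z = k * tmap (fun w x => amp w * wave (dir_wave w) x) z.
Proof.
rewrite /fourier.
pose f w s x := cexp (- s * x) * wave w x.
have fi w s : 0 < wa w -> cintegrable lam (f w s) by exact: cintegrable_wave_mod.
transitivity (cintegral (leb5 R) setT (fun x => k * (tensor5 *%R (f w1 z.1.1.1.1) (f w2 z.1.1.1.2)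
    (f w3 z.1.1.2) (f w4 z.1.2) (f w5 z.2)) x)).
  apply: eq_cintegral => x; rewrite /tmap /tensor5 /f !cexpE /wave /dot5 !polarM mulrCA !polarM.
  by congr (_ * polar _ _); ring.
rewrite cintegralZl; last by apply: cintegrable_tensor5; exact: fi.
rewrite cintegral_tensor5 ?fi//; do 1? exact: fi.
by rewrite /tmap /tensor5 /f !cintegral_wave_dir.
Qed.

Lemma inv_fourier_wave k z :
  inv_fourier (fun x => k * tmap wave x) z =
  Complex ((2 * pi) ^- 5) 0 * (k * tmap (fun w x => amp w * wave (inv_wave w) x) z).
Proof.
rewrite /inv_fourier; congr (_ * _).
pose f w s x := cexp (s * x) * wave w x.
have fi w s : 0 < wa w -> cintegrable lam (f w s) by exact: cintegrable_wave_mod.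
transitivity (cintegral (leb5 R) setT (fun x => k * (tensor5 *%R (f w1 z.1.1.1.1) (f w2 z.1.1.1.2)
    (f w3 z.1.1.2) (f w4 z.1.2) (f w5 z.2)) x)).
  apply: eq_cintegral => x; rewrite /tmap /tensor5 /f !cexpE /wave /dot5 !polarM mulrCA !polarM.
  by congr (_ * polar _ _); ring.
rewrite cintegralZl; last by apply: cintegrable_tensor5; exact: fi.
rewrite cintegral_tensor5 ?fi//; do 1? exact: fi.
by rewrite /tmap /tensor5 /f !cintegral_wave_inv.
Qed.

Let q (z : R5 R) : R :=
  wa w1 * (z.1.1.1.1 - wc w1) ^+ 2 / 2 + wa w2 * (z.1.1.1.2 - wc w2) ^+ 2 / 2 +
  wa w3 * (z.1.1.2 - wc w3) ^+ 2 / 2 + wa w4 * (z.1.2 - wc w4) ^+ 2 / 2 +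
  wa w5 * (z.2 - wc w5) ^+ 2 / 2.

Let l (z : R5 R) : R :=
  wt w1 * z.1.1.1.1 + wt w2 * z.1.1.1.2 + wt w3 * z.1.1.2 + wt w4 * z.1.2 + wt w5 * z.2.

Lemma tmap_waveE z :
  tmap wave z = polar (expR (- q z)) (l z + (wb w1 + wb w2 + wb w3 + wb w4 + wb w5)).
Proof.
rewrite /tmap /tensor5 /wave !polarM /gauss -!expRD; congr (polar (expR _) _); rewrite /q /l; ring.
Qed.

Lemma smooth_q : (forall z, differentiable q z) /\ forall v, affine_fun ('D_v q).
Proof.
have [d1 e1] := derive_half_square (wa w1) (wc w1) (affine_coord1 R).
have [d2 e2] := derive_half_square (wa w2) (wc w2) (affine_coord2 R).
have [d3 e3] := derive_half_square (wa w3) (wc w3) (affine_coord3 R).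
have [d4 e4] := derive_half_square (wa w4) (wc w4) (affine_coord4 R).
have [d5 e5] := derive_half_square (wa w5) (wc w5) (affine_coord5 R).
have D2 z := differentiableD (d1 z) (d2 z).
have D3 z := differentiableD (D2 z) (d3 z).
have D4 z := differentiableD (D3 z) (d4 z).
have D5 z := differentiableD (D4 z) (d5 z).
split=> [z|v]; first exact: D5.
have F (f g : R5 R -> R) : (forall z, differentiable f z) -> (forall z, differentiable g z) ->
    affine_fun ('D_v f) -> affine_fun ('D_v g) -> affine_fun ('D_v (f + g)).
  move=> df dg af ag; rewrite (_ : 'D_v _ = fun z => 'D_v f z + 'D_v g z); first exact: affineD.
  by apply/funext => z; apply: deriveD; exact: diff_derivable.
exact: (F _ _ D4 d5 (F _ _ D3 d4 (F _ _ D2 d3 (F _ _ d1 d2 (e1 v) (e2 v)) (e3 v)) (e4 v)) (e5 v)).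
Qed.

Lemma affine_l : affine_fun l.
Proof.
apply: affineD; last by apply: affineZ; exact: affine_coord5.
apply: affineD; last by apply: affineZ; exact: affine_coord4.
apply: affineD; last by apply: affineZ; exact: affine_coord3.
apply: affineD; apply: affineZ; [exact: affine_coord1|exact: affine_coord2].
Qed.

Lemma norm_R5_cases (z : R5 R) :
  [\/ `|z| = `|z.1.1.1.1|, `|z| = `|z.1.1.1.2| | [\/ `|z| = `|z.1.1.2|, `|z| = `|z.1.2| | `|z| = `|z.2|]].
Proof.
have M (x y : R) : Num.max x y = x \/ Num.max x y = y.
  by rewrite /Num.max; case: ifP; [right|left].
case: z => [[[[x1 x2] x3] x4] x5]; rewrite !prod_normE/=.
case: (M (Num.max (Num.max (Num.max `|x1| `|x2|) `|x3|) `|x4|) `|x5|) => ->; last by apply: Or33; apply: Or33.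
case: (M (Num.max (Num.max `|x1| `|x2|) `|x3|) `|x4|) => ->; last by apply: Or33; apply: Or32.
case: (M (Num.max `|x1| `|x2|) `|x3|) => ->; last by apply: Or33; apply: Or31.
by case: (M `|x1| `|x2|) => ->; [apply: Or31|apply: Or32].
Qed.

(** The norm of z is the modulus of one of its coordinates, and the term of [q] belonging to that
    coordinate alone dominates m |z|^2 / 4 up to a constant; the other terms are nonnegative. *)
Lemma decay_q N : exists M, forall z, (1 + `|z|) ^+ N * expR (- q z) <= M.
Proof.
pose m := Num.min (wa w1) (Num.min (wa w2) (Num.min (wa w3) (Num.min (wa w4) (wa w5)))).
have m0 : 0 < m by rewrite !lt_min a1 a2 a3 a4 a5.
pose C := `|wc w1| + `|wc w2| + `|wc w3| + `|wc w4| + `|wc w5|.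
have [M HM] := @poly_gauss_decay R (m / 4) N (divr_gt0 m0 (ltr0n _ 4)).
exists (M * expR (m * C ^+ 2 / 2)) => z.
apply: le_trans (ler_wpM2r (expR_ge0 _) (HM _ (normr_ge0 z))).
rewrite -[leRHS]mulrA ler_wpM2l ?exprn_ge0 ?addr_ge0// -expRD ler_expR.
have [m1 m2 m3 m4 m5] : [/\ m <= wa w1, m <= wa w2, m <= wa w3, m <= wa w4 & m <= wa w5].
  by split; rewrite /m !ge_min lexx ?orbT.
have P (a c x : R) : m <= a -> 0 <= a * (x - c) ^+ 2 / 2.
  by move=> ma; rewrite divr_ge0// mulr_ge0 ?sqr_ge0// (le_trans (ltW m0)).
(* Rearranging (x - 2 c)^2 >= 0 gives (x - c)^2 >= x^2 / 2 - c^2. *)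
have K (a c x : R) : m <= a -> `|c| <= C -> `|z| = `|x| -> m / 4 * `|z| ^+ 2 - m * C ^+ 2 / 2 <= a * (x - c) ^+ 2 / 2.
  move=> ma cC ->; rewrite real_normK ?num_real//.
  apply: (@le_trans _ _ (m * (x - c) ^+ 2 / 2)); last first.
    by rewrite ler_pM2r ?invr_gt0// ler_wpM2r ?sqr_ge0.
  have c2 : c ^+ 2 <= C ^+ 2 by rewrite -(real_normK (num_real c)) lerXn2r ?nnegrE /C ?addr_ge0.
  have := mulr_ge0 (ltW m0) (sqr_ge0 (x - 2 * c)); have := ler_wpM2l (ltW m0) c2; lra.
have := P _ (wc w1) z.1.1.1.1 m1; have := P _ (wc w2) z.1.1.1.2 m2; have := P _ (wc w3) z.1.1.2 m3.
have := P _ (wc w4) z.1.2 m4; have := P _ (wc w5) z.2 m5.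
have N1 := normr_ge0 (wc w1); have N2 := normr_ge0 (wc w2); have N3 := normr_ge0 (wc w3).
have N4 := normr_ge0 (wc w4); have N5 := normr_ge0 (wc w5).
rewrite /q; case: (norm_R5_cases z) => [H|H|[H|H|H]].
- have := K _ (wc w1) _ m1 _ H; rewrite /C => /(_ ltac:(lra)); lra.
- have := K _ (wc w2) _ m2 _ H; rewrite /C => /(_ ltac:(lra)); lra.
- have := K _ (wc w3) _ m3 _ H; rewrite /C => /(_ ltac:(lra)); lra.
- have := K _ (wc w4) _ m4 _ H; rewrite /C => /(_ ltac:(lra)); lra.
- have := K _ (wc w5) _ m5 _ H; rewrite /C => /(_ ltac:(lra)); lra.
Qed.

Lemma schwartz_wave r : schwartz (fun z => Complex r 0 * tmap wave z).
Proof.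
have [dq q'] := smooth_q.
pose B := wb w1 + wb w2 + wb w3 + wb w4 + wb w5.
apply: (schwartz_osc dq q' affine_l decay_q).
  rewrite (_ : _ \o _ = fun z => r * (expR (- q z) * cos (l z + B))).
    by apply: (osc_mul (affine_cst _ r)); exact: osc_base.
  apply/funext => z; transitivity (Re (Complex r 0 * tmap wave z)); first by [].
  by rewrite complexReM tmap_waveE /= mul0r subr0.
rewrite (_ : _ \o _ = fun z => r * (expR (- q z) * cos (l z + (B - pi / 2)))).
  by apply: (osc_mul (affine_cst _ r)); exact: osc_base.
apply/funext => z; transitivity (Im (Complex r 0 * tmap wave z)); first by [].
rewrite complexImM tmap_waveE /= mul0r addr0.
by rewrite [in RHS]addrA cosB cos_pihalf sin_pihalf mulr0 add0r mulr1.
Qed.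

End waves.

(** * Subordination of Bessel potentials to the heat semigroup *)

Section gamma_kernel.
Variable R : realType.
Local Notation lam := (@lebesgue_measure R).
Variable a : R.
Hypothesis a0 : 0 < a.

(* The density of u^a exp(-u) du/u in the variable v = - ln u. *)
Definition gamma_kernel (v : R) : R := expR (- (a * v) - expR (- v)).

Lemma gamma_kernel_gt0 v : 0 < gamma_kernel v.
Proof. exact: expR_gt0. Qed.

Lemma continuous_gamma_kernel : continuous gamma_kernel.
Proof.
move=> x; apply: (@continuous_comp _ _ _ (fun x : R => - (a * x) - expR (- x)) expR).
  apply: cvgB; first by apply: cvgN; apply: cvgMr; exact: cvg_id.
  apply: (@continuous_comp _ _ _ (fun x : R => - x) expR); last exact: continuous_expR.
  by apply: cvgN; exact: cvg_id.
exact: continuous_expR.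
Qed.

Lemma measurable_gamma_kernel : measurable_fun setT gamma_kernel.
Proof. exact: continuous_measurable_fun continuous_gamma_kernel. Qed.

(** With u = exp (- v), the right-hand side is the maximum of u^a exp (- u), attained at u = a. *)
Lemma gamma_kernel_le v : gamma_kernel v <= expR (a * ln a - a).
Proof.
rewrite /gamma_kernel ler_expR.
have -> : expR (- v) = a * expR (- v - ln a).
  by rewrite expRB lnK ?posrE// mulrCA divff ?mulr1// gt_eqF.
have := ler_wpM2l (ltW a0) (expR_ge1Dx (- v - ln a)); lra.
Qed.

(** For v >= 0 only exp (- a v) is kept, a multiple of an exponential density. For v < 0, exp (- v)
    >= 1 + v^2 / 2 bounds the double exponential by a Gaussian; completing the square yields the
    centre - a and the factor exp (a^2 / 2). *)
Lemma gamma_kernel_dom v :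
  gamma_kernel v <= a^-1 * exponential_pdf a v + expR (a ^+ 2 / 2) * gauss 1 (- a) v.
Proof.
have [v0|v0] := leP 0 v.
  apply: (@le_trans _ _ (a^-1 * exponential_pdf a v)); last first.
    by rewrite lerDl mulr_ge0 ?expR_ge0// ltW// gauss_gt0.
  rewrite /exponential_pdf patchE ifT; last by rewrite inE/= in_itv/= v0.
  rewrite mulrA mulVf ?gt_eqF// mul1r /gamma_kernel ler_expR mulNr lerBlDr lerDl expR_ge0//.
apply: (@le_trans _ _ (expR (a ^+ 2 / 2) * gauss 1 (- a) v)); last first.
  by rewrite lerDr mulr_ge0 ?invr_ge0 ?(ltW a0)// exponential_pdf_ge0// ltW.
rewrite /gauss -expRD /gamma_kernel ler_expR.
have := @expR_ge1Dxn R (- v) 1 ltac:(by rewrite oppr_ge0 ltW).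
rewrite sqrrN (_ : 2`!%:R = 2 :> R)// => H.
have -> : a ^+ 2 / 2 - 1 * (v - - a) ^+ 2 / 2 = - (a * v) - v ^+ 2 / 2 by field.
lra.
Qed.

Lemma integrable_gamma_kernel : lam.-integrable setT (EFin \o gamma_kernel).
Proof.
have gi : lam.-integrable setT
    (EFin \o (fun v => a^-1 * exponential_pdf a v + expR (a ^+ 2 / 2) * gauss 1 (- a) v)).
  apply: integrableD_real; apply: integrableZl_real; last exact: integrable_gauss.
  apply/integrableP; split.
    by apply/measurable_EFinP; exact: measurable_exponential_pdf.
  under eq_integral => x _ do rewrite /= ger0_norm ?exponential_pdf_ge0 ?(ltW a0)//.
  by rewrite integral_exponential_pdf// ltry.
apply: le_integrable_real gi; first exact: measurable_gamma_kernel.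
by move=> v; rewrite gtr0_norm ?gamma_kernel_gt0// gamma_kernel_dom.
Qed.

(** This is Gamma (a), by the substitution u = exp (- v). *)
Definition gamma_const : R := (\int[lam]_v gamma_kernel v)%R.

Lemma integral_gamma_kernel c : (\int[lam]_v (gamma_kernel (v + c))%:E = gamma_const%:E)%E.
Proof.
rewrite /gamma_const /Rintegral fineK; last exact: integrable_fin_num integrable_gamma_kernel.
have := @ge0_integral_affine R 1 c gamma_kernel ltr01 continuous_gamma_kernel (fun v => ltW (gamma_kernel_gt0 v)).
by move=> ->; apply: eq_integral => v _; rewrite mul1r mulr1.
Qed.

Lemma gamma_const_gt0 : 0 < gamma_const.
Proof.
have H1 : (0 < \int[lam]_(v in `[0%R, 1%R]) (expR (- a - 1))%:E)%E.
  rewrite integral_cst//= lebesgue_measure_itv/= lte_fin ltr01.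
  by rewrite oppr0 adde0 mule1 lte_fin expR_gt0.
have mk : measurable_fun setT (fun v : R => gamma_kernel (v + 0)).
  by under eq_fun do rewrite addr0; exact: measurable_gamma_kernel.
have H2 : (\int[lam]_(v in `[0%R, 1%R]) (expR (- a - 1))%:E <= \int[lam]_(v in `[0%R, 1%R]) (gamma_kernel (v + 0))%:E)%E.
  apply: ge0_le_integral => //.
  - by apply/measurable_EFinP; exact: measurable_funTS.
  - move=> x /=; rewrite in_itv/= => /andP[x0 x1]; rewrite lee_fin addr0 /gamma_kernel ler_expR.
    have : a * x <= a by rewrite ler_piMr// ltW.
    have : expR (- x) <= 1 by rewrite -expR0 ler_expR oppr_le0.
    lra.
have H3 : (\int[lam]_(v in `[0%R, 1%R]) (gamma_kernel (v + 0))%:E <= \int[lam]_v (gamma_kernel (v + 0))%:E)%E.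
  apply: ge0_subset_integral => //; first exact/measurable_EFinP.
  by move=> x _; rewrite lee_fin ltW ?gamma_kernel_gt0.
have := lt_le_trans H1 (le_trans H2 H3).
by rewrite integral_gamma_kernel lte_fin.
Qed.

Lemma integrable_gamma_kernel_shift c : lam.-integrable setT (EFin \o (fun v => gamma_kernel (v + c))).
Proof.
apply/integrableP; split.
  apply/measurable_EFinP; apply: (measurableT_comp measurable_gamma_kernel).
  exact: measurable_funD.
under eq_integral => x _ do rewrite /= gtr0_norm ?gamma_kernel_gt0//.
by rewrite integral_gamma_kernel ltry.
Qed.

(** Translation by ln M in v is multiplication by M in u = exp (- v). The factor M^a is where the
    Bessel symbol will be recognised, with a = alpha / 2. *)
Lemma gamma_kernel_pow (v M : R) : 0 < M ->
  gamma_kernel (v - ln M) = expR (- (a * v)) * (M `^ a * expR (- (expR (- v) * M))).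
Proof.
move=> M0; rewrite /gamma_kernel /powR gt_eqF// -!expRD; congr expR.
have -> : expR (- (v - ln M)) = expR (- v) * M.
  by rewrite opprB addrC expRD lnK ?posrE.
ring.
Qed.

Section subordination.
Context d (X : measurableType d) (mu : {sigma_finite_measure set X -> \bar R}).
Variables (A M : X -> R).
Hypotheses (Ai : mu.-integrable setT (EFin \o A)) (mM : measurable_fun setT M).

Lemma measurable_subordination :
  measurable_fun setT (fun w : X * R => A w.1 * gamma_kernel (w.2 - ln (M w.1))).
Proof.
have mA : measurable_fun setT A by exact/measurable_EFinP/(measurable_int _ Ai).
apply: measurable_funM; first by apply: measurableT_comp.
apply: (measurableT_comp measurable_gamma_kernel).
apply: measurable_funB; first exact: measurable_snd.
apply: (@measurableT_comp _ _ _ _ _ _ (@ln R)); first exact: measurable_ln.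
by apply: measurableT_comp.
Qed.

Lemma integrable_subordination :
  (mu \x lam)%E.-integrable setT (EFin \o (fun w : X * R => A w.1 * gamma_kernel (w.2 - ln (M w.1)))).
Proof.
have mh := measurable_subordination.
apply/integrable12ltyP; first exact/measurable_EFinP.
have /integrableP[mA Afin] := Ai.
rewrite (_ : (fun x => _) = (fun x => `|A x|%:E * gamma_const%:E)%E).
  rewrite ge0_integralZr//.
  - apply: lte_mul_pinfty; [exact: integral_ge0|rewrite ge0_fin_numE//; exact: integral_ge0|by rewrite ltry].
  - by apply/measurable_EFinP; apply: measurableT_comp => //; exact/measurable_EFinP.
  - by rewrite lee_fin ltW ?gamma_const_gt0.
apply/funext => x; rewrite -(integral_gamma_kernel (- ln (M x))) -ge0_integralZl//.
- apply: eq_integral => y _ /=.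
  by rewrite normrM (gtr0_norm (gamma_kernel_gt0 _)).
- apply/measurable_EFinP; apply: (measurableT_comp measurable_gamma_kernel).
  exact: measurable_funD.
- by move=> y _; rewrite lee_fin ltW ?gamma_kernel_gt0.
Qed.

Lemma integrable_gamma_mul v : mu.-integrable setT (EFin \o (fun w => A w * gamma_kernel (v - ln (M w)))).
Proof.
have mA : measurable_fun setT A by exact/measurable_EFinP/(measurable_int _ Ai).
apply: (@le_integrable_real _ _ _ _ _ (fun w => expR (a * ln a - a) * `|A w|)).
- apply: measurable_funM => //; apply: (measurableT_comp measurable_gamma_kernel).
  apply: measurable_funB => //; apply: (@measurableT_comp _ _ _ _ _ _ (@ln R)) => //; exact: measurable_ln.
- move=> w; rewrite normrM mulrC (gtr0_norm (gamma_kernel_gt0 _)) ler_wpM2r//.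
  exact: gamma_kernel_le.
- by apply: integrableZl_real; exact: (integrable_abse Ai).
Qed.

(* M^-a is the average of exp(- u M) with respect to u^a du/u, up to the factor [gamma_const]. *)
Lemma subordination_le (B : R -> R) : measurable_fun setT B ->
  (forall v, `|\int[mu]_w (A w * gamma_kernel (v - ln (M w)))|%R <= B v) ->
  ((gamma_const * `|\int[mu]_w A w|)%:E <= \int[lam]_v (B v)%:E)%E.
Proof.
move=> mB HB.
have hi := integrable_subordination.
have mh := measurable_subordination.
have B0 v : 0 <= B v by apply: le_trans (HB v).
(* After Fubini the inner integral runs over v, and all translates of the kernel have the same
   integral, so [M] disappears. *)
have E1 : (\int[lam]_v \int[mu]_w (A w * gamma_kernel (v - ln (M w)))%:E = (gamma_const * \int[mu]_w A w)%:E)%E.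
  have := Fubini hi => /= <-.
  have Af : (\int[mu]_w (A w)%:E)%E \is a fin_num by exact: integrable_fin_num Ai.
  rewrite EFinM (fineK Af).
  rewrite -integralZl//; apply: eq_integral => x _.
  transitivity (\int[lam]_y ((A x)%:E * (gamma_kernel (y + - ln (M x)))%:E))%E; first by [].
  rewrite (integralZl measurableT (integrable_gamma_kernel_shift _)).
  by rewrite integral_gamma_kernel muleC.
have E2 : ((gamma_const * `|\int[mu]_w A w|)%:E = `| \int[lam]_v \int[mu]_w (A w * gamma_kernel (v - ln (M w)))%:E |)%E.
  by rewrite E1 /= normrM (gtr0_norm gamma_const_gt0).
rewrite E2; apply: le_trans (le_abse_integral _ measurableT _) _.
  exact: (measurable_fubini_G hi).
apply: ge0_le_integral => //.
- by apply: measurableT_comp => //; exact: (measurable_fubini_G hi).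
- exact/measurable_EFinP.
- move=> v _; apply: le_trans (_ : `|\int[mu]_w (A w * gamma_kernel (v - ln (M w)))|%R%:E <= _)%E; last by rewrite lee_fin.
  have fi : (\int[mu]_w (A w * gamma_kernel (v - ln (M w)))%:E)%E \is a fin_num.
    exact: integrable_fin_num (integrable_gamma_mul v).
  by rewrite -abse_EFin /Rintegral fineK.
Qed.

End subordination.
End gamma_kernel.

(** * Hoelder duality and subordination of oscillatory pairings *)

Section pairing_bounds.
Context d (T : measurableType d) (R : realType) (mu : {measure set T -> \bar R}).
Implicit Types f g : T -> R[i].

Lemma cabsE (z : R[i]) : cabs z = Num.sqrt (Re z ^+ 2 + Im z ^+ 2).
Proof. by case: z. Qed.

Lemma cabsM (x y : R[i]) : cabs (x * y) = cabs x * cabs y.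
Proof. exact: ComplexField.Normc.normcM. Qed.

Lemma cabs_ge0 (z : R[i]) : 0 <= cabs z.
Proof. by rewrite cabsE sqrtr_ge0. Qed.

Lemma norm_Re_le (z : R[i]) : `|Re z| <= cabs z.
Proof. by rewrite cabsE -sqrtr_sqr ler_wsqrtr// lerDl sqr_ge0. Qed.

Lemma norm_Im_le (z : R[i]) : `|Im z| <= cabs z.
Proof. by rewrite cabsE -sqrtr_sqr ler_wsqrtr// lerDr sqr_ge0. Qed.

Lemma cabs_le (z : R[i]) : cabs z <= `|Re z| + `|Im z|.
Proof.
rewrite cabsE -[leRHS]ger0_norm ?addr_ge0// -sqrtr_sqr ler_wsqrtr// sqrrD !real_normK ?num_real//.
by rewrite lerD2r lerDl mulrn_wge0// mulr_ge0.
Qed.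

Lemma measurable_cabs f : cmeasurable f -> measurable_fun setT (@cabs R \o f).
Proof.
move=> [mr mi]; rewrite (_ : _ \o _ = fun x => Num.sqrt ((Re \o f) x ^+ 2 + (Im \o f) x ^+ 2)).
  apply: measurableT_comp; first exact: (continuous_measurable_fun (@sqrt_continuous R)).
  by apply: measurable_funD; exact: measurable_funX.
by apply/funext => x /=; rewrite cabsE.
Qed.

Lemma cmeasurableM f g : cmeasurable f -> cmeasurable g -> cmeasurable (fun x => f x * g x).
Proof.
move=> [f1 f2] [g1 g2]; split.
  rewrite (_ : _ \o _ = fun x => Re (f x) * Re (g x) - Im (f x) * Im (g x)).
    by apply: measurable_funB; exact: measurable_funM.
  by apply/funext => x /=; rewrite -complexReM.
rewrite (_ : _ \o _ = fun x => Re (f x) * Im (g x) + Im (f x) * Re (g x)).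
  by apply: measurable_funD; exact: measurable_funM.
by apply/funext => x /=; rewrite -complexImM.
Qed.

Lemma cintegrable_cmeasurable f : cintegrable mu f -> cmeasurable f.
Proof. by move=> [f1 f2]; split; apply/measurable_EFinP; exact: (measurable_int mu). Qed.

Lemma le_cintegrable f (g : T -> R) : cmeasurable f -> (forall x, cabs (f x) <= g x) ->
  mu.-integrable setT (EFin \o g) -> cintegrable mu f.
Proof.
move=> [f1 f2] fg gi; split; apply: le_integrable_real gi => // x /=.
  by apply: le_trans (fg x); exact: norm_Re_le.
by apply: le_trans (fg x); exact: norm_Im_le.
Qed.

Lemma integrable_cabs f : cintegrable mu f -> mu.-integrable setT (EFin \o (@cabs R \o f)).
Proof.
move=> fi; have [f1 f2] := fi.
apply: (@le_integrable_real _ _ _ _ _ (fun x => `|Re (f x)| + `|Im (f x)|)).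
- exact/measurable_cabs/cintegrable_cmeasurable.
- by move=> x /=; rewrite ger0_norm ?cabs_ge0// cabs_le.
- by apply: integrableD_real; [exact: (integrable_abse f1)|exact: (integrable_abse f2)].
Qed.

Lemma Re_cintegral_hoelder (p q B C : R) f g : 0 < p -> 0 < q -> p^-1 + q^-1 = 1 ->
  cmeasurable f -> cmeasurable g ->
  (Lp_norm mu p f <= B%:E)%E -> (Lp_norm mu q g <= C%:E)%E ->
  `|Re (cintegral mu setT (fun x => f x * g x))| <= B * C.
Proof.
move=> p0 q0 pq mf mg fB gC.
have mfg := cmeasurableM mf mg.
have H : (\int[mu]_x (cabs (f x * g x))%:E <= (B * C)%:E)%E.
  have := hoelder mu (measurable_cabs mf) (measurable_cabs mg) p0 q0 pq.
  rewrite Lnorm1 => H; rewrite EFinM; apply: le_trans (le_trans H _).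
    by under [leRHS]eq_integral => x _ do rewrite /= -cabsM ger0_norm ?cabs_ge0//.
  by apply: lee_pmul => //; exact: Lnorm_ge0.
have fgi : mu.-integrable setT (EFin \o (@cabs R \o (fun x => f x * g x))).
  apply/integrableP; split; first by apply/measurable_EFinP; exact: measurable_cabs.
  under eq_integral => x _ do rewrite /= ger0_norm ?cabs_ge0//.
  by apply: le_lt_trans H _; rewrite ltry.
have [m1 m2] := mfg.
have Rei : mu.-integrable setT (EFin \o (Re \o (fun x => f x * g x))).
  by apply: le_integrable_real fgi => // x /=; exact: norm_Re_le.
rewrite -lee_fin; apply: le_trans H.
rewrite /cintegral /= EFin_normr_Rintegral//.
apply: le_trans (le_abse_integral _ measurableT _) _; first exact/measurable_EFinP.
apply: ge0_le_integral => //.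
- by apply: measurableT_comp => //; exact/measurable_EFinP.
- by apply/measurable_EFinP; exact: measurable_cabs.
- by move=> x _; rewrite /= lee_fin norm_Re_le.
Qed.

End pairing_bounds.

Lemma Re_mulr_real (R : realType) (z : R[i]) (k : R) : Re (z * Complex k 0) = Re z * k.
Proof. by rewrite complexReM mulr0 subr0. Qed.

Section oscillatory_pairing.
Context d1 d2 (X1 : measurableType d1) (X2 : measurableType d2) (R : realType).
Variables (m1 : {sigma_finite_measure set X1 -> \bar R}).
Variables (m2 : {sigma_finite_measure set X2 -> \bar R}).
Variable theta : X1 * X2 -> R.
Hypothesis mtheta : measurable_fun setT theta.

Lemma cabs_cexp (x : R) : cabs (cexp x) = 1.
Proof. by rewrite cexpE cabs_polar. Qed.

Lemma cmeasurable_cexp d (X : measurableType d) (f : X -> R) :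
  measurable_fun setT f -> cmeasurable (fun x => cexp (f x)).
Proof.
move=> mf; split; rewrite /comp /=.
  by apply: measurableT_comp => //; exact: (continuous_measurable_fun (@continuous_cos R)).
by apply: measurableT_comp => //; exact: (continuous_measurable_fun (@continuous_sin R)).
Qed.

Lemma cmeasurable_comp d d' (X : measurableType d) (Y : measurableType d')
    (f : X -> R[i]) (g : Y -> X) :
  cmeasurable f -> measurable_fun setT g -> cmeasurable (fun y => f (g y)).
Proof.
move=> [f1 f2] mg; split.
  exact: (measurableT_comp f1 mg).
exact: (measurableT_comp f2 mg).
Qed.

Section pairing.
Variables (F : X1 -> R[i]) (eta : X2 -> R[i]).
Hypotheses (Fi : cintegrable m1 F) (etai : cintegrable m2 eta).

Let A (w : X1 * X2) := Re (F w.1 * (cexp (theta w) * eta w.2)).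

Lemma integrable_oscillatory : (m1 \x m2)%E.-integrable setT (EFin \o A).
Proof.
have D : (m1 \x m2)%E.-integrable setT (EFin \o (fun w : X1 * X2 => cabs (F w.1) * cabs (eta w.2))).
  exact: (integrable_tensor (integrable_cabs Fi) (integrable_cabs etai)).
apply: le_integrable_real D.
  have := cmeasurableM (cmeasurable_comp (cintegrable_cmeasurable Fi) measurable_fst)
     (cmeasurableM (cmeasurable_cexp mtheta) (cmeasurable_comp (cintegrable_cmeasurable etai) measurable_snd)).
  by case.
by move=> w; rewrite /A (le_trans (norm_Re_le _))// !cabsM cabs_cexp mul1r.
Qed.

Lemma cintegrable_modulated z : cintegrable m2 (fun y => cexp (theta (z, y)) * eta y).
Proof.
apply: le_cintegrable (integrable_cabs etai).
  apply: cmeasurableM; last exact: cintegrable_cmeasurable etai.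
  apply: cmeasurable_cexp; apply: measurableT_comp => //.
by move=> y; rewrite cabsM cabs_cexp mul1r.
Qed.

Lemma Re_cintegral_oscillatory :
  Re (cintegral m1 setT (fun z => F z * cintegral m2 setT (fun y => cexp (theta (z, y)) * eta y))) =
  (\int[(m1 \x m2)%E]_w A w)%R.
Proof.
rewrite [in RHS]/Rintegral -(integral12_prod_meas1 integrable_oscillatory)/= /fubini_F/=.
rewrite /Rintegral; congr fine; apply: eq_integral => z _.
rewrite -(cintegralZl _ (cintegrable_modulated z)) /=.
rewrite /Rintegral fineK//.
have [H _] := cintegrableZl (F z) (cintegrable_modulated z).
exact: (integrable_fin_num measurableT H).
Qed.

End pairing.

(** The pairing of [F] with a Fourier-type integral of [eta] is unfolded into one integral over
    position and frequency. The kernel factor is real and depends on the frequency alone, so it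
    leaves the real part, and [subordination_le] applies on the product space. *)
Lemma oscillatory_subordination (a : R) (F : X1 -> R[i]) (eta : X2 -> R[i]) (M : X2 -> R) (B : R -> R) :
  0 < a -> cintegrable m1 F -> cintegrable m2 eta -> measurable_fun setT M -> measurable_fun setT B ->
  (forall v, `|Re (cintegral m1 setT (fun z => F z * cintegral m2 setT (fun y => cexp (theta (z, y)) *
     (Complex (gamma_kernel a (v - ln (M y))) 0 * eta y))))| <= B v) ->
  ((gamma_const a * `|Re (cintegral m1 setT (fun z => F z * cintegral m2 setT (fun y => cexp (theta (z, y)) * eta y)))|)%:E
   <= \int[@lebesgue_measure R]_v (B v)%:E)%E.
Proof.
move=> a0 Fi etai mM mB HB.
rewrite Re_cintegral_oscillatory//.
have mM2 : measurable_fun setT (fun w : X1 * X2 => M w.2) by apply: measurableT_comp.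
apply: (subordination_le (mu := sprod m1 m2) a0 (integrable_oscillatory Fi etai) mM2 mB) => v.
apply: le_trans (HB v); rewrite Re_cintegral_oscillatory//.
  rewrite le_eqVlt; apply/orP; left; apply/eqP; congr (`| _ |).
  apply: eq_Rintegral => w _.
  set k := gamma_kernel _ _; set x := F _; set e := cexp _; set y := eta _.
  have -> : x * (e * (Complex k 0 * y)) = (x * (e * y)) * Complex k 0 by rewrite [Complex k 0 * y]mulrC !mulrA.
  by rewrite Re_mulr_real.
apply: le_cintegrable (integrableZl_real (expR (a * ln a - a)) (integrable_cabs etai)).
  apply: cmeasurableM; last exact: cintegrable_cmeasurable etai.
  split; last exact: measurable_cst.
  apply: (measurableT_comp (measurable_gamma_kernel a)).
  apply: measurable_funB => //; apply: (@measurableT_comp _ _ _ _ _ _ (@ln R)) => //; exact: measurable_ln.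
move=> y; rewrite cabsM ler_wpM2r ?cabs_ge0// real_polarE cabs_polar ?(ltW (gamma_kernel_gt0 _ _))//.
exact: gamma_kernel_le.
Qed.

End oscillatory_pairing.

(** * Gaussian test functions and the norms of their heat evolutions *)

Section test_functions.
Variable R : realType.
Local Notation mR := (measurableTypeR R).
Local Notation lam := (@lebesgue_measure R).
Implicit Type w : wave_param R.

Lemma inv_dir_wave w : inv_wave (dir_wave w) = w.
Proof. by case: w => a c t b; rewrite /inv_wave /= invrK opprK; congr Wave; ring. Qed.

Definition heat_energy w u : R := u * (wa w * wc w ^+ 2 / (wa w + 2 * u)).

Lemma heat_waveE w u x : 0 < wa w -> 0 <= u ->
  wave (heat_wave u w) x = Complex (expR (heat_energy w u - u * x ^+ 2)) 0 * wave w x.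
Proof.
move=> a0 u0; rewrite real_polarE polarM add0r -expRD; congr (polar (expR _) _).
by rewrite /heat_energy /=; field; rewrite gt_eqF// ltr_wpDr// mulr_ge0.
Qed.

(** The share of one coordinate in the q-norm of [heat_test]: its share of [heat_scale], times the
    q-norm of a Gaussian with parameter 1 / (a + 2 u). *)
Definition heat_factor (q : R) w u : R :=
  expR (- heat_energy w u) * Num.sqrt (2 * pi / (wa w + 2 * u)) *
  Num.sqrt (2 * pi * (wa w + 2 * u) / q) `^ q^-1.

Lemma Lp_norm_integral d (T : measurableType d) (mu : {measure set T -> \bar R}) (q I : R)
    (f : T -> R[i]) : 0 < q ->
  (\int[mu]_x (cabs (f x) `^ q)%:E = I%:E)%E -> Lp_norm mu q f = (I `^ q^-1)%:E.
Proof.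
move=> q0 fI; rewrite /Lp_norm unlock /=.
have -> : (\int[mu]_x `|(cabs (f x))%:E| `^ q = I%:E)%E.
  by rewrite -fI; apply: eq_integral => x _ /=; rewrite ger0_norm ?cabs_ge0.
by rewrite poweR_EFin.
Qed.

Lemma gauss_powR (a c q x : R) : gauss a c x `^ q = gauss (q * a) c x.
Proof. by rewrite /gauss -expRM; congr expR; ring. Qed.

Lemma powRM5 (k x1 x2 x3 x4 x5 s : R) : 0 <= k -> 0 <= x1 -> 0 <= x2 -> 0 <= x3 -> 0 <= x4 -> 0 <= x5 ->
  (k * (x1 * x2 * x3 * x4 * x5)) `^ s =
  k `^ s * (x1 `^ s * x2 `^ s * x3 `^ s * x4 `^ s * x5 `^ s).
Proof.
move=> k0 y1 y2 y3 y4 y5.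
have z2 := mulr_ge0 y1 y2; have z3 := mulr_ge0 z2 y3.
have z4 := mulr_ge0 z3 y4; have z5 := mulr_ge0 z4 y5.
by rewrite (powRM _ k0 z5) (powRM _ z4 y5) (powRM _ z3 y4) (powRM _ z2 y3) (powRM _ y1 y2).
Qed.

Lemma measurable_coord : 
  [/\ measurable_fun setT (fun z : R5 mR => z.1.1.1.1), measurable_fun setT (fun z : R5 mR => z.1.1.1.2),
      measurable_fun setT (fun z : R5 mR => z.1.1.2), measurable_fun setT (fun z : R5 mR => z.1.2) &
      measurable_fun setT (fun z : R5 mR => z.2)].
Proof.
have f1 := @measurable_fst _ _ (mR * mR * mR * mR)%type mR.
have f2 := measurableT_comp (@measurable_fst _ _ (mR * mR * mR)%type mR) f1.
have f3 := measurableT_comp (@measurable_fst _ _ (mR * mR)%type mR) f2.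
split.
- exact: (measurableT_comp (@measurable_fst _ _ mR mR) f3).
- exact: (measurableT_comp (@measurable_snd _ _ mR mR) f3).
- exact: (measurableT_comp (@measurable_snd _ _ (mR * mR)%type mR) f2).
- exact: (measurableT_comp (@measurable_snd _ _ (mR * mR * mR)%type mR) f1).
- exact: measurable_snd.
Qed.

Lemma measurable_dot5 d (X : measurableType d) (f g : X -> R5 mR) :
  measurable_fun setT f -> measurable_fun setT g -> measurable_fun setT (fun x => dot5 (f x) (g x)).
Proof.
move=> mf mg; have [h1 h2 h3 h4 h5] := measurable_coord.
rewrite /dot5.
apply: measurable_funD; last first.
  by apply: measurable_funM; [exact: (measurableT_comp h5 mf)|exact: (measurableT_comp h5 mg)].
apply: measurable_funD; last first.
  by apply: measurable_funM; [exact: (measurableT_comp h4 mf)|exact: (measurableT_comp h4 mg)].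
apply: measurable_funD; last first.
  by apply: measurable_funM; [exact: (measurableT_comp h3 mf)|exact: (measurableT_comp h3 mg)].
apply: measurable_funD.
  by apply: measurable_funM; [exact: (measurableT_comp h1 mf)|exact: (measurableT_comp h1 mg)].
by apply: measurable_funM; [exact: (measurableT_comp h2 mf)|exact: (measurableT_comp h2 mg)].
Qed.

Lemma dot5_ge0 (z : R5 R) : 0 <= dot5 z z.
Proof. by rewrite /dot5 -!expr2 !addr_ge0 ?sqr_ge0. Qed.

Variables w1 w2 w3 w4 w5 : wave_param R.
Hypotheses (a1 : 0 < wa w1) (a2 : 0 < wa w2) (a3 : 0 < wa w3) (a4 : 0 < wa w4) (a5 : 0 < wa w5).

Let prod5 (f : wave_param R -> R) := f w1 * f w2 * f w3 * f w4 * f w5.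
Let sum5 (f : wave_param R -> R) := f w1 + f w2 + f w3 + f w4 + f w5.

Definition heat_scale (r u : R) : R :=
  r * expR (- sum5 (heat_energy ^~ u)) * prod5 (fun w => Num.sqrt (2 * pi / (wa w + 2 * u))).

Definition heat_test (r u : R) (z : R5 R) : R[i] :=
  Complex (heat_scale r u) 0 *
  tmap (dir_wave (heat_wave u w1)) (dir_wave (heat_wave u w2)) (dir_wave (heat_wave u w3))
    (dir_wave (heat_wave u w4)) (dir_wave (heat_wave u w5)) (@wave R) z.

Section fixed_time.
Variables r u : R.
Hypotheses (r0 : 0 <= r) (u0 : 0 <= u).

Let pos w : 0 < wa w -> 0 < wa w + 2 * u.
Proof. by move=> a0; rewrite ltr_wpDr// mulr_ge0. Qed.

Let ipos w : 0 < wa w -> 0 < wa (dir_wave (heat_wave u w)).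
Proof. by move=> a0; rewrite /= invr_gt0 pos. Qed.

Lemma schwartz_heat_test : schwartz (heat_test r u).
Proof. by apply: schwartz_wave; exact: ipos. Qed.

Lemma sqrt_dual (x : R) : 0 < x -> Num.sqrt (2 * pi / x) * Num.sqrt (2 * pi / x^-1) = 2 * pi.
Proof.
move=> x0; rewrite -sqrtrM ?divr_ge0 ?mulr_ge0 ?pi_ge0 ?ltW//.
have -> : 2 * pi / x * (2 * pi / x^-1) = (2 * pi) ^+ 2 by rewrite invrK; field; rewrite gt_eqF.
by rewrite sqrtr_sqr ger0_norm// mulr_ge0// pi_ge0.
Qed.

Lemma inv_fourier_heat_test z : inv_fourier (heat_test r u) z =
  Complex (r * expR (- (u * dot5 z z))) 0 * tmap w1 w2 w3 w4 w5 (@wave R) z.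
Proof.
rewrite inv_fourier_wave; do 1? exact: ipos.
rewrite /tmap /tensor5 /amp /= !inv_dir_wave !heat_waveE// !real_polarE !polarM !add0r.
congr polar.
set x1 := wa w1 + 2 * u; set x2 := wa w2 + 2 * u; set x3 := wa w3 + 2 * u.
set x4 := wa w4 + 2 * u; set x5 := wa w5 + 2 * u.
have -> : expR (- (u * dot5 z z)) = expR (- sum5 (heat_energy^~ u)) *
    (expR (heat_energy w1 u - u * z.1.1.1.1 ^+ 2) * expR (heat_energy w2 u - u * z.1.1.1.2 ^+ 2) *
     expR (heat_energy w3 u - u * z.1.1.2 ^+ 2) * expR (heat_energy w4 u - u * z.1.2 ^+ 2) *
     expR (heat_energy w5 u - u * z.2 ^+ 2)).
  by rewrite -!expRD; congr expR; rewrite /sum5 /dot5; ring.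
rewrite /heat_scale /prod5 -/x1 -/x2 -/x3 -/x4 -/x5.
set e1 := expR (_ - u * z.1.1.1.1 ^+ 2); set e2 := expR (_ - u * z.1.1.1.2 ^+ 2).
set e3 := expR (_ - u * z.1.1.2 ^+ 2); set e4 := expR (_ - u * z.1.2 ^+ 2).
set e5 := expR (_ - u * z.2 ^+ 2); set e := expR (- _).
have s1 := sqrt_dual (pos a1); have s2 := sqrt_dual (pos a2); have s3 := sqrt_dual (pos a3).
have s4 := sqrt_dual (pos a4); have s5 := sqrt_dual (pos a5).
rewrite -/x1 in s1; rewrite -/x2 in s2; rewrite -/x3 in s3; rewrite -/x4 in s4; rewrite -/x5 in s5.
move: s1 s2 s3 s4 s5.
set p1 := Num.sqrt (2 * pi / x1); set q1 := Num.sqrt (2 * pi / x1^-1).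
set p2 := Num.sqrt (2 * pi / x2); set q2 := Num.sqrt (2 * pi / x2^-1).
set p3 := Num.sqrt (2 * pi / x3); set q3 := Num.sqrt (2 * pi / x3^-1).
set p4 := Num.sqrt (2 * pi / x4); set q4 := Num.sqrt (2 * pi / x4^-1).
set p5 := Num.sqrt (2 * pi / x5); set q5 := Num.sqrt (2 * pi / x5^-1).
move=> s1 s2 s3 s4 s5.
have P0 : 2 * pi != 0 :> R by rewrite mulf_neq0// gt_eqF// pi_gt0.
set g1 := gauss _ _ _; set g2 := gauss _ _ _; set g3 := gauss _ _ _; set g4 := gauss _ _ _; set g5 := gauss _ _ _.
transitivity ((2 * pi) ^- 5 * ((p1 * q1) * (p2 * q2) * (p3 * q3) * (p4 * q4) * (p5 * q5)) *
   (r * e * (e1 * e2 * e3 * e4 * e5) * (g1 * g2 * g3 * g4 * g5))); first by ring.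
rewrite s1 s2 s3 s4 s5.
have -> : (2 * pi) ^- 5 * (2 * pi * (2 * pi) * (2 * pi) * (2 * pi) * (2 * pi)) = 1 :> R.
  by rewrite -!expr2 -!exprSr mulVf// expf_neq0.
ring.
Qed.

Lemma cabs_heat_test z : cabs (heat_test r u z) = heat_scale r u *
  tensor5 *%R (gauss (wa w1 + 2 * u)^-1 (wt w1)) (gauss (wa w2 + 2 * u)^-1 (wt w2))
    (gauss (wa w3 + 2 * u)^-1 (wt w3)) (gauss (wa w4 + 2 * u)^-1 (wt w4)) (gauss (wa w5 + 2 * u)^-1 (wt w5)) z.
Proof.
rewrite /heat_test /tmap /tensor5 real_polarE !polarM cabs_polar//.
rewrite !mulr_ge0 ?sqrtr_ge0 ?expR_ge0//.
Qed.

Lemma Lp_norm_heat_test (q : R) : 0 < q ->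
  Lp_norm (leb5 R) q (heat_test r u) =
  (r * (heat_factor q w1 u * heat_factor q w2 u * heat_factor q w3 u * heat_factor q w4 u * heat_factor q w5 u))%:E.
Proof.
move=> q0; pose S w := Num.sqrt (2 * pi * (wa w + 2 * u) / q).
have hs0 : 0 <= heat_scale r u by rewrite !mulr_ge0 ?sqrtr_ge0 ?expR_ge0.
rewrite (@Lp_norm_integral _ _ _ q (heat_scale r u `^ q * (S w1 * S w2 * S w3 * S w4 * S w5)))//.
  rewrite powRM5 ?powR_ge0 ?sqrtr_ge0// -powRrM mulfV ?gt_eqF// powRr1//.
  rewrite /heat_scale /heat_factor /prod5 /S /sum5 !opprD !expRD; congr (_%:E).
  set s1 := _ `^ _; set s2 := _ `^ _; set s3 := _ `^ _; set s4 := _ `^ _; set s5 := _ `^ _.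
  ring.
transitivity (\int[leb5 R]_z ((heat_scale r u `^ q)%:E * (tensor5 *%R (gauss (q * (wa w1 + 2 * u)^-1) (wt w1))
    (gauss (q * (wa w2 + 2 * u)^-1) (wt w2)) (gauss (q * (wa w3 + 2 * u)^-1) (wt w3))
    (gauss (q * (wa w4 + 2 * u)^-1) (wt w4)) (gauss (q * (wa w5 + 2 * u)^-1) (wt w5)) z)%:E))%E.
  apply: eq_integral => z _; rewrite cabs_heat_test -EFinM; congr (_%:E).
  by rewrite /tensor5 powRM5 ?(ltW (gauss_gt0 _ _ _))// !gauss_powR.
have g0 a c x : 0 <= gauss a c x :> R by rewrite ltW ?gauss_gt0.
have [h1 h2 h3 h4 h5] := measurable_coord.
rewrite ge0_integralZl//.
- rewrite ge0_integral_tensor5//; do ?exact: measurable_gauss.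
  have qp w : 0 < wa w -> 0 < q * (wa w + 2 * u)^-1 by move=> ?; rewrite mulr_gt0// invr_gt0 pos.
  rewrite !integral_gauss ?qp// -!EFinM; congr (_%:E).
  have E w : 0 < wa w -> 2 * pi / (q * (wa w + 2 * u)^-1) = 2 * pi * (wa w + 2 * u) / q.
    by move=> ?; field; rewrite !gt_eqF ?pos.
  by rewrite !E.
- apply/measurable_EFinP; rewrite /tensor5; do !apply: measurable_funM.
  + exact: (measurableT_comp (measurable_gauss _ _) h1).
  + exact: (measurableT_comp (measurable_gauss _ _) h2).
  + exact: (measurableT_comp (measurable_gauss _ _) h3).
  + exact: (measurableT_comp (measurable_gauss _ _) h4).
  + exact: (measurableT_comp (measurable_gauss _ _) h5).
- by move=> z _; rewrite lee_fin /tensor5 !mulr_ge0.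
- by rewrite lee_fin powR_ge0.
Qed.

End fixed_time.

End test_functions.

(** * The duality bound for functions with a Sobolev representative *)

Section master.
Variable R : realType.
Local Notation mR := (measurableTypeR R).
Local Notation lam := (@lebesgue_measure R).

Lemma integrable_sleb5 (f : R5 mR -> \bar R) :
  (leb5 R).-integrable setT f -> (sleb5 R).-integrable setT f.
Proof. by rewrite -leb5E. Qed.

Lemma cintegrable_sleb5 (F : R5 mR -> R[i]) : cintegrable (leb5 R) F -> cintegrable (sleb5 R) F.
Proof. by move=> [F1 F2]; split; [exact: (integrable_sleb5 F1)|exact: (integrable_sleb5 F2)]. Qed.

Lemma fourier_sleb5 (f : R5 R -> R[i]) z :
  fourier f z = cintegral (sleb5 R) setT (fun y => cexp (- dot5 y z) * f y).
Proof. exact: cintegral_leb5. Qed.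

Variables (p q alpha Bd : R) (F g : R5 R -> R[i]) (w1 w2 w3 w4 w5 : wave_param R) (B : R -> R).
Hypotheses (p0 : 0 < p) (q0 : 0 < q) (pq : p^-1 + q^-1 = 1) (alpha0 : 0 < alpha).
Hypotheses (a1 : 0 < wa w1) (a2 : 0 < wa w2) (a3 : 0 < wa w3) (a4 : 0 < wa w4) (a5 : 0 < wa w5).
Hypotheses (Fi : cintegrable (leb5 R) F) (mg : @cmeasurable R _ (R5 mR) g).
Hypotheses (gB : (Lp_norm (leb5 R) p g <= Bd%:E)%E).
Hypothesis Fg : dist_eq (bessel alpha F) (dist_fun g).
Hypothesis mB : measurable_fun setT B.
Hypothesis HB : forall v, let u := expR (- v) in
  Bd * (gamma_kernel (alpha / 2) v *
    (heat_factor q w1 u * heat_factor q w2 u * heat_factor q w3 u * heat_factor q w4 u * heat_factor q w5 u)) <= B v.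

Let gam : R5 R -> R[i] := tmap w1 w2 w3 w4 w5 (@wave R).

Let M (y : R5 R) : R := 1 + dot5 y y.

Let M0 y : 0 < M y.
Proof. by rewrite /M ltr_pwDl// dot5_ge0. Qed.

(** With u = exp (- v) the scale is u^(alpha/2) exp (- u). Multiplied by exp (- u |y|^2) and by the
    Bessel symbol, it becomes [gamma_kernel] at v - ln (M y). *)
Let phi (v : R) : R5 R -> R[i] :=
  heat_test w1 w2 w3 w4 w5 (expR (- (alpha / 2 * v)) * expR (- expR (- v))) (expR (- v)).

Lemma bessel_heat_test v y :
  bessel_symbol alpha y * inv_fourier (phi v) y =
  Complex (gamma_kernel (alpha / 2) (v - ln (M y))) 0 * gam y.
Proof.
rewrite /phi inv_fourier_heat_test ?expR_ge0// mulrA; congr (_ * _).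
rewrite /bessel_symbol !real_polarE polarM addr0 gamma_kernel_pow; last exact: M0.
congr polar; rewrite -/(M y).
have -> : expR (- (expR (- v) * M y)) = expR (- expR (- v)) * expR (- (expR (- v) * dot5 y y)).
  by rewrite -expRD /M; congr expR; ring.
ring.
Qed.

Lemma Re_bessel_pairing v :
  `|Re (cintegral (leb5 R) setT (fun z => F z *
      fourier (fun y => Complex (gamma_kernel (alpha / 2) (v - ln (M y))) 0 * gam y) z))| <= B v.
Proof.
have -> : (fun y => Complex (gamma_kernel (alpha / 2) (v - ln (M y))) 0 * gam y) =
    (fun y => bessel_symbol alpha y * inv_fourier (phi v) y).
  by apply/funext => y; rewrite bessel_heat_test.
have sphi : schwartz (phi v) by apply: schwartz_heat_test; rewrite ?expR_ge0.
have := Fg sphi.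
rewrite /bessel /dist_inv_fourier /dist_mul /dist_fourier /dist_fun => ->.
apply: le_trans (HB v).
apply: (Re_cintegral_hoelder p0 q0 pq mg) => //.
  have [s1 s2] := cintegrable_cmeasurable (cintegrableZl (Complex (heat_scale w1 w2 w3 w4 w5 (expR (- (alpha / 2 * v)) * expR (- expR (- v))) (expR (- v))) 0)
    (@cintegrable_tmap_wave R (dir_wave (heat_wave (expR (- v)) w1)) (dir_wave (heat_wave (expR (- v)) w2))
     (dir_wave (heat_wave (expR (- v)) w3)) (dir_wave (heat_wave (expR (- v)) w4)) (dir_wave (heat_wave (expR (- v)) w5))
     ltac:(rewrite /= invr_gt0 ltr_wpDr// mulr_ge0 ?expR_ge0//)
     ltac:(rewrite /= invr_gt0 ltr_wpDr// mulr_ge0 ?expR_ge0//)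
     ltac:(rewrite /= invr_gt0 ltr_wpDr// mulr_ge0 ?expR_ge0//)
     ltac:(rewrite /= invr_gt0 ltr_wpDr// mulr_ge0 ?expR_ge0//)
     ltac:(rewrite /= invr_gt0 ltr_wpDr// mulr_ge0 ?expR_ge0//))).
  by split.
rewrite /phi Lp_norm_heat_test ?mulr_ge0 ?expR_ge0//.
by rewrite /gamma_kernel -expRD.
Qed.

(** For each v, Hoelder bounds the pairing of [g] with [phi v], which by [Fg] is the pairing of [F]
    with the transform of the packet weighted by the gamma kernel. Integrating over v restores the
    unweighted packet, whose transform is explicit. *)
Lemma sobolev_test :
  ((gamma_const (alpha / 2) * `|Re (cintegral (leb5 R) setT (fun z => F z *
     tmap w1 w2 w3 w4 w5 (fun w x => amp w * wave (dir_wave w) x) z))|)%:E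
   <= \int[lam]_v (B v)%:E)%E.
Proof.
have gi : cintegrable (leb5 R) gam by exact: cintegrable_tmap_wave.
pose theta (w : R5 mR * R5 mR) : R := - dot5 w.2 w.1.
have mtheta : measurable_fun setT theta.
  by apply: measurableT_comp => //; apply: measurable_dot5; [exact: measurable_snd|exact: measurable_fst].
have mM : measurable_fun setT (M : R5 mR -> R).
  by apply: measurable_funD; [exact: measurable_cst|apply: measurable_dot5; exact: measurable_id].
have := @oscillatory_subordination _ _ _ _ R (sleb5 R) (sleb5 R) theta mtheta (alpha / 2) F gam M B
  (divr_gt0 alpha0 (ltr0n _ 2)) (cintegrable_sleb5 Fi) (cintegrable_sleb5 gi) mM mB.
have E : fourier gam = tmap w1 w2 w3 w4 w5 (fun w x => amp w * wave (dir_wave w) x).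
  apply/funext => z; rewrite (_ : gam = fun x => 1 * tmap w1 w2 w3 w4 w5 (@wave R) x).
    by rewrite fourier_wave// mul1r.
  by apply/funext => x; rewrite mul1r.
have C (h : R5 R -> R[i]) : cintegral (leb5 R) setT (fun z => F z * fourier h z) =
    cintegral (sleb5 R) setT (fun z => F z * cintegral (sleb5 R) setT (fun y => cexp (theta (z, y)) * h y)).
  transitivity (cintegral (leb5 R) setT (fun z => F z * cintegral (sleb5 R) setT (fun y => cexp (- dot5 y z) * h y))).
    by apply: eq_cintegral => z; rewrite fourier_sleb5.
  exact: cintegral_leb5.
move=> S; rewrite -E (C gam).
apply: S => v.
have Cv := C (fun y => Complex (gamma_kernel (alpha / 2) (v - ln (M y))) 0 * gam y).
exact: (eq_ind _ (fun x => `|Re x| <= B v) (Re_bessel_pairing v) _ Cv).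
Qed.

End master.

(** * Measurability on the plane, complex Fubini and averages over frequencies *)

Section plane_measurability.
Variable R : realType.
Local Notation mR := (measurableTypeR R).

(** The sigma-algebra here is the product of the two Borel ones, so an open set is written as the
    countable union of the rational boxes that it contains. *)
Lemma open_measurable_plane (U : set (R * R)) : open U -> measurable (U : set (mR * mR)%type).
Proof.
move=> oU.
pose box (a b c d : rat) : set (mR * mR)%type :=
  (`]ratr a, ratr b[%classic : set mR) `*` (`]ratr c, ratr d[%classic : set mR).
(* A box not contained in U contributes the empty set, which lets the union run over all quadruples
   of rationals. *)
pose F a b c d := [set z | box a b c d z /\ box a b c d `<=` U].
have -> : U = \bigcup_a \bigcup_b \bigcup_c \bigcup_d F a b c d.
  apply/seteqP; split=> [[x y] Uz|z [a _ [b _ [c _ [d _ [Fz]]]]]]; last by apply.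
  have [e /= e0 eU] : nbhs_ball (x, y) U by apply/nbhs_ballP; exact: open_nbhs_nbhs.
  have H (t : R) : exists a b : rat, [/\ t \in `]ratr a, ratr b[ & forall s : R, s \in `]ratr a, ratr b[ -> `|t - s| < e].
    have /rat_in_itvoo[a Ha] : t - e < t by rewrite gtrDl oppr_lt0.
    have /rat_in_itvoo[b Hb] : t < t + e by rewrite ltrDl.
    exists a, b; move: Ha Hb; rewrite !in_itv/= => /andP[a1 a2] /andP[b1 b2].
    split=> [|s]; first by rewrite a2 b1.
    by rewrite in_itv/= => /andP[s1 s2]; rewrite ltr_norml; apply/andP; split; lra.
  have [a [b [xab Hab]]] := H x; have [c [d [ycd Hcd]]] := H y.
  exists a => //; exists b => //; exists c => //; exists d => //; split; first by split.
  move=> [s t] [/= sab tcd]; apply: eU; split => /=; rewrite /ball/=.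
    exact: Hab.
  exact: Hcd.
apply: bigcupT_measurable_rat => a; apply: bigcupT_measurable_rat => b.
apply: bigcupT_measurable_rat => c; apply: bigcupT_measurable_rat => e.
have [sub|nsub] := pselect (box a b c e `<=` U).
  rewrite (_ : F _ _ _ _ = box a b c e); first by apply: measurableX; exact: measurable_itv.
  by apply/seteqP; split=> z // [].
rewrite (_ : F _ _ _ _ = set0); first exact: measurable0.
by apply/seteqP; split=> z // [].
Qed.

Lemma continuous_measurable_plane (f : R * R -> R) :
  continuous f -> measurable_fun setT (f : (mR * mR)%type -> mR).
Proof.
move=> cf; apply: (measurability (@RGenOInfty.G R)).
  exact: RGenOInfty.measurableE.
move=> _ [_ [a ->] <-]; rewrite setTI; apply: open_measurable_plane.
by apply: open_comp.
Qed.

End plane_measurability.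

Section fubini_complex.
Context d1 d2 (T1 : measurableType d1) (T2 : measurableType d2) (R : realType).
Variables (m1 : {sigma_finite_measure set T1 -> \bar R}).
Variables (m2 : {sigma_finite_measure set T2 -> \bar R}).

Lemma sprodE (A : set T1) (B : set T2) : measurable A -> measurable B ->
  sprod m1 m2 (A `*` B) = (m1 A * m2 B)%E.
Proof. exact: product_measure1E. Qed.

Lemma integrable_Rintegral_section (h : T1 * T2 -> R) :
  (sprod m1 m2).-integrable setT (EFin \o h) ->
  (forall x, m2.-integrable setT (EFin \o (fun y => h (x, y)))) ->
  m1.-integrable setT (EFin \o (fun x => \int[m2]_y h (x, y)))%R /\
  (\int[m1]_x (\int[m2]_y h (x, y)) = \int[sprod m1 m2]_w h w)%R.
Proof.
move=> hi hs.
have E : (fun x => (\int[m2]_y h (x, y))%R%:E) = (fun x => \int[m2]_y (h (x, y))%:E)%E.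
  by apply/funext => x; rewrite /Rintegral fineK//; exact: integrable_fin_num (hs x).
split; first by rewrite /comp E; exact: (integrable_fubini_F hi).
have := integral12_prod_meas1 hi; rewrite /fubini_F /= -E => H.
by rewrite /Rintegral; congr fine.
Qed.

Lemma cintegrable_section (h : T1 * T2 -> R[i]) :
  cintegrable (sprod m1 m2) h -> (forall x, cintegrable m2 (fun y => h (x, y))) ->
  cintegrable m1 (fun x => cintegral m2 setT (fun y => h (x, y))) /\
  cintegral m1 setT (fun x => cintegral m2 setT (fun y => h (x, y))) = cintegral (sprod m1 m2) setT h.
Proof.
move=> [h1 h2] hs.
have [i1 e1] := integrable_Rintegral_section h1 (fun x => (hs x).1).
have [i2 e2] := integrable_Rintegral_section h2 (fun x => (hs x).2).
split; first by split.
by apply: complex_eq.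
Qed.

End fubini_complex.

Section gaussian_average.
Context d (X : measurableType d) (R : realType) (mu : {sigma_finite_measure set X -> \bar R}).
Local Notation lam := (@lebesgue_measure R).
Variables (A : X -> R[i]) (eta : X -> R) (a : R).
Hypotheses (a0 : 0 < a) (Ai : cintegrable mu A) (meta : measurable_fun setT eta).

Let h (w : X * R) : R := Re (A w.1 * cexp (w.2 * eta w.1)) * gauss a 0 w.2.

Lemma measurable_averaged : measurable_fun setT h.
Proof.
apply: measurable_funM; last by apply: measurableT_comp => //; exact: measurable_gauss.
have [m1 m2] := cintegrable_cmeasurable Ai.
have me : measurable_fun setT (fun w : X * R => w.2 * eta w.1).
  by apply: measurable_funM => //; apply: measurableT_comp.
have := cmeasurableM (cmeasurable_comp (cintegrable_cmeasurable Ai) (@measurable_fst _ _ X R)) (cmeasurable_cexp me).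
by case.
Qed.

Lemma integrable_averaged : (mu \x lam)%E.-integrable setT (EFin \o h).
Proof.
have D := integrable_tensor (integrable_cabs Ai) (integrable_gauss 0 a0).
apply: le_integrable_real D; first exact: measurable_averaged.
move=> w; rewrite /h normrM (gtr0_norm (gauss_gt0 _ _ _)) ler_wpM2r ?(ltW (gauss_gt0 _ _ _))//.
by rewrite (le_trans (norm_Re_le _))// cabsM cabs_cexp mulr1.
Qed.

(** Exchanging the integrals leaves the Fourier transform of a centred Gaussian, which is real and
    positive: the oscillation becomes a positive weight concentrated where [eta] is small. The
    imaginary part of [A] drops out because its sine integral vanishes. *)
Lemma gaussian_average :
  (\int[lam]_t (gauss a 0 t * \int[mu]_w Re (A w * cexp (t * eta w))) =
   \int[mu]_w (Re (A w) * (Num.sqrt (2 * pi / a) * expR (- (eta w ^+ 2 / (2 * a))))))%R.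
Proof.
have hi := integrable_averaged.
have [r1 r2] := Ai.
have Ri t : mu.-integrable setT (EFin \o (fun w => Re (A w * cexp (t * eta w)))).
  have me : measurable_fun setT (fun w => t * eta w) by apply: measurable_funM.
  apply: le_integrable_real (integrable_cabs Ai).
    by have [] := cmeasurableM (cintegrable_cmeasurable Ai) (cmeasurable_cexp me).
  by move=> w; rewrite (le_trans (norm_Re_le _))// cabsM cabs_cexp mulr1.
transitivity (fine (\int[lam]_t \int[mu]_w (h (w, t))%:E)).
  congr fine; apply: eq_integral => t _.
  have fi : (\int[mu]_w (Re (A w * cexp (t * eta w)))%:E)%E \is a fin_num by exact: integrable_fin_num (Ri t).
  rewrite EFinM /Rintegral fineK// -(integralZl measurableT (Ri t)).
  by apply: eq_integral => w _; rewrite /h /= -EFinM mulrC.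
rewrite -(Fubini hi); congr fine; apply: eq_integral => w _ /=.
have c1 := cos_gauss_integral 0 (eta w) 0 a0; have s1 := sin_gauss_integral 0 (eta w) 0 a0.
have ci : lam.-integrable setT (EFin \o (fun t => cos (eta w * t + 0) * gauss a 0 t)).
  apply: integrable_phase_gauss => //; first exact: measurable_cos_affine.
  by move=> x; exact: norm_cos_le1.
have si : lam.-integrable setT (EFin \o (fun t => sin (eta w * t + 0) * gauss a 0 t)).
  apply: integrable_phase_gauss => //; first exact: measurable_sin_affine.
  by move=> x; exact: norm_sin_le1.
have hE t : h (w, t) = Re (A w) * (cos (eta w * t + 0) * gauss a 0 t) - Im (A w) * (sin (eta w * t + 0) * gauss a 0 t).
  by rewrite /h complexReM /= !addr0 (mulrC t); ring.
have Hi : lam.-integrable setT (EFin \o (fun t => h (w, t))).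
  rewrite (_ : (fun t => _) = fun t => Re (A w) * (cos (eta w * t + 0) * gauss a 0 t) - Im (A w) * (sin (eta w * t + 0) * gauss a 0 t)).
    by apply: integrableB_real; exact: integrableZl_real.
  by apply/funext => t; rewrite hE.
rewrite -[LHS]fineK; last exact: integrable_fin_num Hi.
congr (_%:E); rewrite -/(Rintegral lam setT (fun t => h (w, t))).
under eq_Rintegral => t _ do rewrite hE.
rewrite RintegralB//; [|exact: integrableZl_real|exact: integrableZl_real].
rewrite !RintegralZl// c1 s1 mulr0 addr0 cos0 sin0; ring.
Qed.

End gaussian_average.

Lemma integrable_indic_lty d (T : measurableType d) (R : realType) (mu : {measure set T -> \bar R})
    (k : R) (B : set T) :
  measurable B -> (mu B < +oo)%E -> mu.-integrable setT (EFin \o (fun x => k * \1_B x)).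
Proof.
move=> mB Boo; apply: integrableZl_real; apply/integrableP; split.
  by apply/measurable_EFinP; exact: measurable_indic.
under eq_integral => x _ do rewrite /= ger0_norm//.
by rewrite integral_indic// setIT.
Qed.

Lemma sprod_box d1 d2 (T1 : measurableType d1) (T2 : measurableType d2) (R : realType)
    (m1 : {sigma_finite_measure set T1 -> \bar R}) (m2 : {sigma_finite_measure set T2 -> \bar R})
    (A : set T1) (B : set T2) (a b : R) :
  measurable A -> measurable B -> m1 A = a%:E -> m2 B = b%:E -> sprod m1 m2 (A `*` B) = (a * b)%:E.
Proof. by move=> mA mB Aa Bb; apply: etrans (sprodE m1 m2 mA mB) _; rewrite Aa Bb EFinM. Qed.

Lemma Im_mulr_real (R : realType) (z : R[i]) (r : R) : Im (z * Complex r 0) = Im z * r.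
Proof. by rewrite complexImM /= mulr0 add0r. Qed.

(** * Pairing torus averages with packets *)

Section pairing.
Variable R : realType.
Local Notation mR := (measurableTypeR R).
Local Notation lam := (@lebesgue_measure R).

Definition itvc (L : R) : set mR := `[- L, L]%classic.
Definition cube5 (L : R) : set (R5 mR) :=
  itvc L `*` itvc L `*` itvc L `*` itvc L `*` itvc L.
Definition period2 : set (R2 mR) := `[0, 2 * pi[%classic `*` `[0, 2 * pi[%classic.

Lemma measurable_period2 : measurable period2.
Proof. by apply: measurableX; exact: measurable_itv. Qed.

Lemma measurable_cube5 L : measurable (cube5 L).
Proof. by do 4! (apply: measurableX; last exact: measurable_itv); exact: measurable_itv. Qed.

Lemma lebesgue_itvc L : 0 <= L -> lam (itvc L) = (2 * L)%:E.
Proof.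
move=> L0; rewrite /itvc lebesgue_measure_itv/= lte_fin.
case: ltP => [_|LL]; first by rewrite -EFinD opprK; congr (_%:E); ring.
have -> : L = 0 by lra.
by rewrite mulr0.
Qed.

Lemma sleb5_cube5 L : 0 <= L -> sleb5 R (cube5 L) = ((2 * L) ^+ 5)%:E.
Proof.
move=> L0; have mI : measurable (itvc L) by exact: measurable_itv.
have lI := lebesgue_itvc L0.
have m2 : measurable (itvc L `*` itvc L) by exact: measurableX.
have m3 : measurable (itvc L `*` itvc L `*` itvc L) by exact: measurableX.
have m4 : measurable (itvc L `*` itvc L `*` itvc L `*` itvc L) by exact: measurableX.
have E2 : sleb2 R (itvc L `*` itvc L) = ((2 * L) ^+ 2)%:E.
  by rewrite exprSr expr1; exact: sprod_box.
have E3 : sleb3 R (itvc L `*` itvc L `*` itvc L) = ((2 * L) ^+ 3)%:E.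
  by rewrite exprSr; exact: sprod_box.
have E4 : sleb4 R (itvc L `*` itvc L `*` itvc L `*` itvc L) = ((2 * L) ^+ 4)%:E.
  by rewrite exprSr; exact: sprod_box.
by rewrite exprSr; exact: sprod_box.
Qed.

Lemma sleb2_period2 : sleb2 R period2 = ((2 * pi) ^+ 2)%:E.
Proof.
have m : measurable (`[0, 2 * pi[%classic : set mR) by exact: measurable_itv.
have l : lam `[0, 2 * pi[%classic = (2 * pi)%:E.
  by rewrite lebesgue_measure_itv/= lte_fin mulr_gt0 ?pi_gt0// oppr0 adde0.
by rewrite exprSr expr1; exact: sprod_box.
Qed.

Definition torus_shift (w : R5 R * R2 R) : R3 R := w.1.1.1 - torus_param w.1.1.2 w.1.2 w.2.

Lemma measurable_torus_shift : measurable_fun setT (torus_shift : (R5 mR * R2 mR)%type -> R3 mR).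
Proof.
have [h1 h2 h3 h4 h5] := measurable_coord R.
have f1 := @measurable_fst _ _ (R5 mR) (R2 mR).
have f2 := @measurable_snd _ _ (R5 mR) (R2 mR).
have a1 := measurableT_comp (@measurable_fst _ _ mR mR) f2.
have a2 := measurableT_comp (@measurable_snd _ _ mR mR) f2.
have mc := continuous_measurable_fun (@continuous_cos R).
have ms := continuous_measurable_fun (@continuous_sin R).
have x1 := measurableT_comp h1 f1; have x2 := measurableT_comp h2 f1; have x3 := measurableT_comp h3 f1.
have t := measurableT_comp h4 f1; have s := measurableT_comp h5 f1.
have c1 := measurableT_comp mc a1; have s1 := measurableT_comp ms a1.
have c2 := measurableT_comp mc a2; have s2 := measurableT_comp ms a2.
rewrite (_ : torus_shift = fun w : (R5 R * R2 R)%type =>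
  ((w.1.1.1.1.1 - (w.1.1.2 + w.1.2 * cos w.2.1) * cos w.2.2,
    w.1.1.1.1.2 - (w.1.1.2 + w.1.2 * cos w.2.1) * sin w.2.2),
   w.1.1.1.2 - w.1.2 * sin w.2.1)); last by [].
have r := measurable_funD t (measurable_funM s c1).
apply: measurable_fun_pair; [apply: measurable_fun_pair|].
- exact: (measurable_funB x1 (measurable_funM r c2)).
- exact: (measurable_funB x2 (measurable_funM r s2)).
- exact: (measurable_funB x3 (measurable_funM s s1)).
Qed.

Variables (psi : R2 R -> R[i]) (Kpsi rho : R).
Hypotheses (mpsi : @cmeasurable R _ (R2 mR) psi) (psiK : forall ts, cabs (psi ts) <= Kpsi)
  (psi_supp : forall ts, psi ts != 0 -> `|ts.1| <= rho /\ `|ts.2| <= rho).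
Variables (c : R[i]) (E : set (R3 mR)) (L : R) (P : R5 R -> R) (KP lambda : R).
Hypotheses (mE : measurable E)
  (EL : forall x, E x -> [/\ `|x.1.1| <= L, `|x.1.2| <= L & `|x.2| <= L])
  (mP : measurable_fun setT (P : R5 mR -> R)) (PK : forall z, 0 <= P z <= KP).

Definition cap_wave (x : R3 R) : R[i] := c * (Complex (\1_E x) 0 * cexp (lambda * x.2)).

Definition test_wave (z : R5 R) : R[i] := Complex (P z) 0 * cexp (lambda * (z.2 - z.1.1.2)).

Definition phase_density (w : R5 R * R2 R) : R[i] :=
  psi (w.1.1.2, w.1.2) * c * Complex (P w.1 * (\1_E (torus_shift w) * \1_period2 w.2)) 0.

(* What is left of the oscillation of [cap_wave] and [test_wave]: lambda (x3 - s sin a) + lambda (s - x3) = lambda s (1 - sin a). *)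
Definition phase (w : R5 R * R2 R) : R := w.1.2 * (1 - sin w.2.1).

(** The kernel whose integral over all angles is the localised average; the indicator of [period2]
    replaces the restriction of the domain. *)
Let k0 (w : R5 R * R2 R) : R[i] :=
  psi (w.1.1.2, w.1.2) * (cap_wave (torus_shift w) * Complex (\1_period2 w.2) 0).

(** If x - torus_param t s a lies in [E] and (t, s) in the support of [psi], then each coordinate of
    x is at most L + |t| + |s| <= L + 2 rho. Hence the bounded kernel [k0] vanishes off a box of
    finite measure. *)
Let L' := L + 2 * rho.
Let Box : set (R5 mR * R2 mR)%type := cube5 L' `*` period2.

Lemma Kpsi_ge0 : 0 <= Kpsi.
Proof. exact: le_trans (cabs_ge0 _) (psiK (0, 0)). Qed.

Lemma measurable_Box : measurable Box.
Proof. by apply: measurableX; [exact: measurable_cube5|exact: measurable_period2]. Qed.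

Lemma Box_lty : 0 <= L' -> (sprod (sleb5 R) (sleb2 R) Box < +oo)%E.
Proof.
move=> L0; rewrite /Box sprodE; [|exact: measurable_cube5|exact: measurable_period2].
by rewrite sleb5_cube5// sleb2_period2 -EFinM ltry.
Qed.

Lemma torus_param_le t s (a : R2 R) :
  [/\ `|(torus_param t s a).1.1| <= `|t| + `|s|, `|(torus_param t s a).1.2| <= `|t| + `|s| &
      `|(torus_param t s a).2| <= `|t| + `|s|].
Proof.
have H (x : R) : `|s * cos x| <= `|s| by rewrite normrM ler_piMr ?norm_cos_le1.
have J : `|t + s * cos a.1| <= `|t| + `|s| by rewrite (le_trans (ler_normD _ _))// lerD2l H.
split; rewrite /=.
- by rewrite normrM (le_trans _ J)// ler_piMr ?norm_cos_le1.
- by rewrite normrM (le_trans _ J)// ler_piMr ?norm_sin_le1.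
- by rewrite normrM (le_trans (_ : _ <= `|s|)) ?lerDr// ler_piMr ?norm_sin_le1.
Qed.

Lemma shift_in_Box w : psi (w.1.1.2, w.1.2) != 0 -> E (torus_shift w) -> period2 w.2 -> Box w.
Proof.
case: w => [[[[[x1 x2] x3] t] s] a] /= /psi_supp[/= tr sr] /EL[/= e1 e2 e3] pa; split=> //=.
have [/= b1 b2 b3] := torus_param_le t s a.
have r0 : 0 <= rho by apply: le_trans tr.
have L0 : 0 <= L by apply: le_trans e1.
have I (x : R) : `|x| <= L' -> itvc L' x by rewrite /itvc /= in_itv/= -ler_norml.
have T (x y : R) : `|x - y| <= L -> `|y| <= `|t| + `|s| -> `|x| <= L'.
  move=> xy yy; rewrite -[x](subrK y) (le_trans (ler_normD _ _))// /L'; lra.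
split; [split; [split; [split|]|]|] => /=; apply: I.
- exact: T e1 b1.
- exact: T e2 b2.
- exact: T e3 b3.
- rewrite /L'; lra.
- rewrite /L'; lra.
Qed.

Lemma complex0_cases (z : R[i]) : z = 0 \/ z != 0.
Proof. by case: (eqVneq z 0) => [->|]; [left|right]. Qed.

Lemma indic_cases (T : Type) (B : set T) (x : T) : (\1_B x = 1 :> R /\ B x) \/ \1_B x = 0 :> R.
Proof.
rewrite indicE; case: (pselect (B x)) => Bx.
  by left; rewrite mem_set.
by right; rewrite memNset.
Qed.

Lemma cabs0 : cabs (0 : R[i]) = 0.
Proof. by rewrite cabsE /= expr0n addr0 sqrtr0. Qed.

Lemma cabs_real (r : R) : 0 <= r -> cabs (Complex r 0) = r.
Proof. by move=> r0; rewrite real_polarE cabs_polar. Qed.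

Lemma cabs_k0 w : cabs (k0 w) <= Kpsi * cabs c * \1_Box w.
Proof.
have K0 := Kpsi_ge0.
have r0 : 0 <= Kpsi * cabs c * \1_Box w by rewrite !mulr_ge0 ?cabs_ge0.
rewrite /k0 /cap_wave; case: (complex0_cases (psi (w.1.1.2, w.1.2))) => [->|p0].
  by rewrite mul0r cabs0.
case: (indic_cases E (torus_shift w)) => [[-> Ew]|->]; last first.
  by rewrite (_ : Complex 0 0 = 0)// mul0r mulr0 mul0r mulr0 cabs0.
case: (indic_cases period2 w.2) => [[-> Pw]|->]; last first.
  by rewrite (_ : Complex 0 0 = 0)// !mulr0 cabs0.
have Bw := shift_in_Box p0 Ew Pw.
rewrite indicE mem_set// mulr1 !cabsM cabs_cexp !cabs_real// !mulr1.
by rewrite ler_wpM2r ?cabs_ge0.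
Qed.

Lemma cmeasurable_real d (T : measurableType d) (h : T -> R) : measurable_fun setT h ->
  cmeasurable (fun x => Complex (h x) 0).
Proof. by move=> mh; split => //; exact: measurable_cst. Qed.

Lemma cmeasurable_cst d (T : measurableType d) (z : R[i]) : cmeasurable (fun _ : T => z).
Proof. by split; exact: measurable_cst. Qed.

Lemma cmeasurable_psi : @cmeasurable R _ (R5 mR * R2 mR)%type (fun w => psi (w.1.1.2, w.1.2)).
Proof.
have [_ _ _ h4 h5] := measurable_coord R.
apply: (cmeasurable_comp mpsi); apply: measurable_fun_pair.
  exact: (measurableT_comp h4 measurable_fst).
exact: (measurableT_comp h5 measurable_fst).
Qed.

Lemma cmeasurable_cap : @cmeasurable R _ (R3 mR) cap_wave.
Proof.
apply: cmeasurableM; first exact: cmeasurable_cst.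
apply: cmeasurableM; first by apply: cmeasurable_real; exact: measurable_indic.
apply: cmeasurable_cexp; apply: measurable_funM; first exact: measurable_cst.
exact: measurable_snd.
Qed.

Lemma cmeasurable_k0 : @cmeasurable R _ (R5 mR * R2 mR)%type k0.
Proof.
apply: cmeasurableM; first exact: cmeasurable_psi.
apply: cmeasurableM; first exact: (cmeasurable_comp cmeasurable_cap measurable_torus_shift).
apply: cmeasurable_real; apply: measurableT_comp; last exact: measurable_snd.
by apply: measurable_indic; exact: measurable_period2.
Qed.

Lemma test_waveM w : k0 w * test_wave w.1 = phase_density w * cexp (lambda * phase w).
Proof.
rewrite /k0 /test_wave /phase_density /cap_wave !cexpE !real_polarE.
rewrite -!mulrA; congr (_ * (_ * _)).
by rewrite !polarM; congr polar; rewrite /phase /=; ring.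
Qed.

Hypothesis L'0 : 0 <= L'.

Lemma cintegrable_k0 : cintegrable (sprod (sleb5 R) (sleb2 R)) k0.
Proof.
by apply: le_cintegrable (integrable_indic_lty _ measurable_Box (Box_lty L'0));
  [exact: cmeasurable_k0|exact: cabs_k0].
Qed.

Lemma cintegrable_k0_section z : cintegrable (sleb2 R) (fun a => k0 (z, a)).
Proof.
have f2 : (sleb2 R period2 < +oo)%E by rewrite sleb2_period2 ltry.
apply: le_cintegrable (integrable_indic_lty (Kpsi * cabs c) measurable_period2 f2).
  apply: (cmeasurable_comp cmeasurable_k0); apply: measurable_fun_pair => //; exact: measurable_cst.
move=> a; apply: le_trans (cabs_k0 _) _; rewrite ler_wpM2l ?mulr_ge0 ?cabs_ge0 ?Kpsi_ge0//.
case: (indic_cases Box (z, a)) => [[-> [_ Pa]]|->//].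
by rewrite indicE mem_set.
Qed.

Lemma cintegrable_cap_section z : cintegrable (sleb2 R) (fun a => cap_wave (torus_shift (z, a)) * Complex (\1_period2 a) 0).
Proof.
have f2 : (sleb2 R period2 < +oo)%E by rewrite sleb2_period2 ltry.
apply: le_cintegrable (integrable_indic_lty (cabs c) measurable_period2 f2).
  apply: cmeasurableM; last by apply: cmeasurable_real; apply: measurable_indic; exact: measurable_period2.
  apply: (cmeasurable_comp (cmeasurable_comp cmeasurable_cap measurable_torus_shift)).
  apply: measurable_fun_pair => //; exact: measurable_cst.
move=> a; rewrite cabsM [X in _ * X]cabs_real//; apply: ler_wpM2r => //.
rewrite /cap_wave !cabsM cabs_cexp mulr1 cabs_real// ler_piMr ?cabs_ge0//.
Qed.

Lemma local_avgE z : local_torus_avg psi cap_wave z = cintegral (sleb2 R) setT (fun a => k0 (z, a)).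
Proof.
apply: etrans (esym (cintegralZl (psi (z.1.2, z.2)) (cintegrable_cap_section z))); congr (_ * _).
rewrite /torus_avg /torus_measure /cintegral /=; congr Complex.
  rewrite Rintegral_mkcond /Rintegral leb2E; congr fine; apply: eq_integral => a _.
  rewrite patchE Re_mulr_real indicE; case: ifP => _; by rewrite ?mulr1 ?mulr0.
rewrite Rintegral_mkcond /Rintegral leb2E; congr fine; apply: eq_integral => a _.
rewrite patchE Im_mulr_real indicE; case: ifP => _; by rewrite ?mulr1 ?mulr0.
Qed.

Lemma cintegrable_local_avg : cintegrable (leb5 R) (local_torus_avg psi cap_wave).
Proof.
have [[H1 H2] _] := cintegrable_section cintegrable_k0 cintegrable_k0_section.
rewrite (_ : local_torus_avg psi cap_wave = fun z => cintegral (sleb2 R) setT (fun a => k0 (z, a))).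
  by split; rewrite leb5E.
by apply/funext => z; exact: local_avgE.
Qed.

Lemma cintegrable_phase_density : cintegrable (sprod (sleb5 R) (sleb2 R)) phase_density.
Proof.
apply: le_cintegrable (integrableZl_real KP (integrable_cabs cintegrable_k0)).
  apply: cmeasurableM; first by apply: cmeasurableM; [exact: cmeasurable_psi|exact: cmeasurable_cst].
  apply: cmeasurable_real; apply: measurable_funM; first exact: (measurableT_comp mP measurable_fst).
  apply: measurable_funM; apply: measurableT_comp; [exact: measurable_indic|exact: measurable_torus_shift|
    apply: measurable_indic; exact: measurable_period2|exact: measurable_snd].
move=> w; have [P0 Pw] := andP (PK w.1).
have -> : cabs (phase_density w) = P w.1 * cabs (k0 w).
  rewrite /phase_density /k0 /cap_wave !cabsM cabs_cexp !cabs_real ?mulr_ge0//; ring.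
by rewrite /= ler_wpM2r ?cabs_ge0.
Qed.

Lemma measurable_phase : measurable_fun setT (phase : (R5 mR * R2 mR)%type -> R).
Proof.
have [_ _ _ _ h5] := measurable_coord R.
apply: measurable_funM; first exact: (measurableT_comp h5 measurable_fst).
apply: measurable_funB => //; apply: measurableT_comp; first exact: (continuous_measurable_fun (@continuous_sin R)).
exact: (measurableT_comp measurable_fst measurable_snd).
Qed.

(** After Fubini, [lambda] occurs only in the factor [cexp (lambda * phase w)]. This is the shape to
    which the average over frequencies applies. *)
Lemma torus_pairing :
  Re (cintegral (leb5 R) setT (fun z => local_torus_avg psi cap_wave z * test_wave z)) =
  (\int[sprod (sleb5 R) (sleb2 R)]_w Re (phase_density w * cexp (lambda * phase w)))%R.
Proof.
pose k w := test_wave w.1 * k0 w.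
have mph : measurable_fun setT (fun w : (R5 mR * R2 mR)%type => lambda * phase w).
  by apply: measurable_funM => //; exact: measurable_phase.
have ki : cintegrable (sprod (sleb5 R) (sleb2 R)) k.
  have -> : k = fun w => phase_density w * cexp (lambda * phase w).
    by apply/funext => w; rewrite /k mulrC test_waveM.
  apply: le_cintegrable (integrable_cabs cintegrable_phase_density).
    by apply: cmeasurableM; [exact: cintegrable_cmeasurable cintegrable_phase_density|exact: cmeasurable_cexp].
  by move=> w; rewrite cabsM cabs_cexp mulr1.
have ks z : cintegrable (sleb2 R) (fun a => k (z, a)) by exact: (cintegrableZl (test_wave z) (cintegrable_k0_section z)).
have [_ Ek] := cintegrable_section ki ks.
have -> : cintegral (leb5 R) setT (fun z => local_torus_avg psi cap_wave z * test_wave z) =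
    cintegral (sleb5 R) setT (fun z => cintegral (sleb2 R) setT (fun a => k (z, a))).
  apply: etrans (cintegral_leb5 _) _; apply: eq_cintegral => z.
  apply: etrans (esym (cintegralZl (test_wave z) (cintegrable_k0_section z))).
  by rewrite mulrC -local_avgE.
rewrite Ek; apply: eq_Rintegral => w _.
by rewrite /k mulrC test_waveM.
Qed.

End pairing.

(** * Choice of representatives and properties of the cutoff *)

Section bounded_representation.
Variable R : realType.
Local Notation mR := (measurableTypeR R).

Lemma bounded_sobolev_repr (p alpha : R) (T : (R3 R -> R[i]) -> (R5 R -> R[i])) :
  bounded_Lp_sobolev p alpha T ->
  exists2 K, 0 < K & forall f b, 0 < b -> Lp (leb3 R) p f -> (Lp_norm (leb3 R) p f <= b%:E)%E ->
    exists g, [/\ @cmeasurable R _ (R5 mR) g, (Lp_norm (leb5 R) p g <= (K * b)%:E)%E &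
      dist_eq (bessel alpha (T f)) (dist_fun g)].
Proof.
(* The Sobolev norm is an infimum. Enlarging K, with b > 0, makes the bound strict, so that a
   representative below it can be picked. *)
move=> [K HK]; exists (`|K| + 1); first by rewrite ltr_wpDl.
move=> f b b0 fp fb; have [_ H] := HK _ fp.
have N0 : (0 <= Lp_norm (leb3 R) p f)%E by exact: Lnorm_ge0.
have Hlt : (sobolev_norm p alpha (T f) < ((`|K| + 1) * b)%:E)%E.
  apply: le_lt_trans H _; apply: (@le_lt_trans _ _ (`|K| * b)%:E).
    apply: (@le_trans _ _ (`|K|%:E * Lp_norm (leb3 R) p f)%E).
      by apply: lee_wpmul2r => //; rewrite lee_fin ler_norm.
    by rewrite EFinM; apply: lee_wpmul2l => //; rewrite lee_fin.
  by rewrite lte_fin ltr_pM2r// ltrDl.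
have [y [g [_ [mg _] Hg] <-] gy] := ereal_inf_lt Hlt.
by exists g; split => //; exact: ltW.
Qed.

End bounded_representation.

Section cutoff.
Variables (R : realType) (psi : R2 R -> R[i]).
Local Notation mR := (measurableTypeR R).
Hypothesis spsi : smooth psi.

Lemma smooth_continuous : continuous (Re \o psi) /\ continuous (Im \o psi).
Proof.
by split=> ts; have [dr di] := spsi [::] ts; exact: differentiable_continuous.
Qed.

Lemma smooth_cmeasurable : @cmeasurable R _ (R2 mR) psi.
Proof.
have [cr ci] := smooth_continuous.
by split; exact: continuous_measurable_plane.
Qed.

Lemma smooth_Re_mul_continuous (c : R[i]) : continuous (fun ts => Re (psi ts * c)).
Proof.
have [cr ci] := smooth_continuous => ts.
rewrite (_ : (fun ts => _) = fun ts => Re (psi ts) * Re c - Im (psi ts) * Im c).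
  by apply: cvgB; apply: cvgMl; [exact: cr|exact: ci].
by apply/funext => x; rewrite complexReM.
Qed.

(** The quotient is 1 at [ts0]. Normalising in this way replaces a complex cutoff by a real part
    that is positive near the chosen point. *)
Lemma smooth_Re_quotient_near ts0 : psi ts0 != 0 -> exists2 rho, 0 < rho &
  forall ts, `|ts.1 - ts0.1| <= rho -> `|ts.2 - ts0.2| <= rho -> 1 / 2 <= Re (psi ts * (psi ts0)^-1).
Proof.
move=> p0; have C := @smooth_Re_mul_continuous (psi ts0)^-1 ts0.
have E0 : Re (psi ts0 * (psi ts0)^-1) = 1 by rewrite mulfV.
have : \forall ts \near ts0, 1 / 2 < Re (psi ts * (psi ts0)^-1).
  by apply: (cvgr_gt _ C); rewrite E0; lra.
move=> /nbhs_ballP[e /= e0 He]; exists (e / 2); first by rewrite divr_gt0.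
move=> ts h1 h2; apply/ltW/He; split; rewrite /ball/= distrC.
  by apply: le_lt_trans h1 _; lra.
by apply: le_lt_trans h2 _; lra.
Qed.

Hypothesis cpsi : compact (supp psi).

Lemma supp_bounded : exists2 rho, 0 <= rho & forall ts, psi ts != 0 -> `|ts.1| <= rho /\ `|ts.2| <= rho.
Proof.
have [M [_ HM]] := compact_bounded cpsi.
exists (`|M| + 1); first by rewrite addr_ge0.
move=> ts p0; have := HM (`|M| + 1).
have -> : M < `|M| + 1 by rewrite (le_lt_trans (ler_norm _))// ltrDl.
move=> /(_ isT ts (@subset_closure _ _ ts p0)) H.
by split; apply: le_trans H; [exact: norm_fst_le|exact: norm_snd_le].
Qed.

Lemma smooth_cabs_bounded : exists K, forall ts, cabs (psi ts) <= K.
Proof.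
have [cr ci] := smooth_continuous.
have cG : continuous (fun ts => `|Re (psi ts)| + `|Im (psi ts)|).
  by move=> ts; apply: cvgD; apply: (@cvg_norm R R^o); [exact: cr|exact: ci].
have [M [_ HM]] := compact_bounded (continuous_compact (continuous_subspaceT cG) cpsi).
exists (`|M| + 1) => ts; case: (complex0_cases (psi ts)) => [->|p0].
  by rewrite cabs0 addr_ge0.
apply: le_trans (cabs_le _) _; apply: le_trans (ler_norm _) _.
apply: (HM (`|M| + 1)); first by rewrite (le_lt_trans (ler_norm _))// ltrDl.
by exists ts => //; exact: subset_closure.
Qed.

End cutoff.

(** * Elementary real estimates *)

Section calculus.
Variable R : realType.
Implicit Types x y : R.

Lemma powR_expR_ln x s : 0 < x -> x `^ s = expR (s * ln x).
Proof. by move=> x0; rewrite /powR gt_eqF. Qed.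

Lemma ler_powR_npos x y s : s <= 0 -> 0 < x -> x <= y -> y `^ s <= x `^ s.
Proof.
move=> s0 x0 xy; have y0 := lt_le_trans x0 xy.
by rewrite !powR_expR_ln// ler_expR ler_wnM2l// ler_ln.
Qed.

Lemma ler_dist_cos x y : `|cos x - cos y| <= `|x - y|.
Proof.
wlog xy : x y / x <= y.
  by move=> H; have [/H//|/ltW/H] := leP x y; rewrite distrC [leRHS]distrC.
have [//|z _ E] := @MVT_segment R cos (fun t => - sin t) x y xy (fun t _ => is_derive_cos t) _.
  by apply: continuous_subspaceT; exact: continuous_cos.
by rewrite distrC [leRHS]distrC E normrM normrN ler_piMl// norm_sin_le1.
Qed.

Lemma ler_dist_sin x y : `|sin x - sin y| <= `|x - y|.
Proof.
wlog xy : x y / x <= y.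
  by move=> H; have [/H//|/ltW/H] := leP x y; rewrite distrC [leRHS]distrC.
have [//|z _ E] := @MVT_segment R sin cos x y xy (fun t _ => is_derive_sin t) _.
  by apply: continuous_subspaceT; exact: continuous_sin.
by rewrite distrC [leRHS]distrC E normrM ler_piMl// norm_cos_le1.
Qed.

(** From 1 - cos y = 2 sin (y/2)^2 with y = x - pi / 2. This quadratic vanishing is the degeneracy
    of the phase behind the threshold 1/2. *)
Lemma one_sub_sin_le x : 0 <= 1 - sin x <= (x - pi / 2) ^+ 2.
Proof.
rewrite subr_ge0 sin_le1/=.
have -> : sin x = cos (x - pi / 2) by rewrite cosB cos_pihalf sin_pihalf mulr0 add0r mulr1.
set y := x - pi / 2.
have -> : 1 - cos y = 2 * sin (y / 2) ^+ 2.
  have -> : cos y = cos (y / 2 + y / 2) by congr cos; lra.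
  rewrite cosD -!expr2 cos2sin2; ring.
have : sin (y / 2) ^+ 2 <= (y / 2) ^+ 2.
  have := ler_dist_sin (y / 2) 0; rewrite sin0 !subr0 => H.
  by rewrite -(real_normK (num_real (sin _))) -[leRHS](real_normK (num_real _)) lerXn2r// nnegrE.
have := sqr_ge0 y; lra.
Qed.

Lemma powR_unbounded (C s : R) (N0 : nat) : 0 < s -> exists2 n, (N0 <= n)%N & C < n%:R `^ s.
Proof.
move=> s0; pose x := (`|C| + 1) `^ s^-1.
have [n Hn] : exists n : nat, x < n%:R by exists (Num.bound x); apply: archi_boundP; exact: powR_ge0.
exists (maxn N0 n); first exact: leq_maxl.
apply: (@lt_le_trans _ _ (x `^ s)).
  by rewrite -powRrM mulVf ?gt_eqF// powRr1 ?addr_ge0// (le_lt_trans (ler_norm _))// ltrDl.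
apply: ge0_ler_powR; rewrite ?nnegrE ?powR_ge0 ?(ltW s0)//.
by rewrite (le_trans (ltW Hn))// ler_nat leq_maxr.
Qed.

(** With X = n^2 rho^2 / 2 and k = m + 1, the bound X^k exp (- X) <= k! reads n^(2 k) exp (- X) <=
    M. As m + 1 <= 2 k, the quantity n^m exp (- X) is at most M / n. *)
Lemma gauss_tail_small (C c rho : R) (m : nat) : 0 < c -> 0 < rho ->
  exists N0 : nat, forall n : nat, (N0 < n)%N ->
    C * (n%:R ^+ m * expR (- (n%:R ^+ 2 * rho ^+ 2 / 2))) <= c.
Proof.
move=> c0 r0; pose k := m.+1; pose M := k`!%:R * (2 / rho ^+ 2) ^+ k.
have M0 : 0 < M by rewrite mulr_gt0 ?exprn_gt0 ?divr_gt0 ?exprn_gt0 ?ltr0n ?fact_gt0.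
pose x := (`|C| + 1) * M / c; exists (Num.bound x) => n Hn.
have n1 : 1 <= n%:R :> R by rewrite ler1n (leq_ltn_trans _ Hn).
have n0 : 0 < n%:R :> R by apply: lt_le_trans n1.
have B : n%:R ^+ m * expR (- (n%:R ^+ 2 * rho ^+ 2 / 2)) <= M / n%:R.
  rewrite ler_pdivlMr//.
  have E := @exprn_expR_le R k (n%:R ^+ 2 * rho ^+ 2 / 2) ltac:(by rewrite divr_ge0// mulr_ge0// sqr_ge0).
  set e := expR _ in E *.
  have F : n%:R ^+ (2 * k) * e <= M.
    rewrite /M; have -> : n%:R ^+ (2 * k) * e = (n%:R ^+ 2 * rho ^+ 2 / 2) ^+ k * e * (2 / rho ^+ 2) ^+ k.
      rewrite -mulrA [e * _]mulrC mulrA -exprMn exprM; congr (_ ^+ k * _); field.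
      by rewrite gt_eqF.
    by rewrite ler_wpM2r// exprn_ge0// divr_ge0// sqr_ge0.
  apply: le_trans F; rewrite mulrAC -exprSr ler_wpM2r ?expR_ge0//.
  by rewrite ler_weXn2l// mul2n -addnn leq_addr.
have X : x < n%:R.
  apply: lt_trans (_ : _ < (Num.bound x)%:R) _; last by rewrite ltr_nat.
  by apply: archi_boundP; apply: divr_ge0; [apply: mulr_ge0; [exact: addr_ge0|exact: ltW]|exact: ltW].
have t0 : 0 <= n%:R ^+ m * expR (- (n%:R ^+ 2 * rho ^+ 2 / 2)) by rewrite mulr_ge0 ?expR_ge0 ?exprn_ge0 ?ltW.
apply: (@le_trans _ _ ((`|C| + 1) * (M / n%:R))).
  apply: (@le_trans _ _ ((`|C| + 1) * (n%:R ^+ m * expR (- (n%:R ^+ 2 * rho ^+ 2 / 2))))).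
    by apply: ler_wpM2r => //; rewrite (le_trans (ler_norm _))// lerDl.
  by apply: ler_wpM2l => //; rewrite addr_ge0.
rewrite mulrA ler_pdivrMr// [leRHS]mulrC -ler_pdivrMr//; exact: ltW.
Qed.

End calculus.

Section heat_factor_formula.
Variable R : realType.

Definition heat_const (q : R) : R := Num.sqrt (2 * pi) * Num.sqrt (2 * pi / q) `^ q^-1.

Lemma heat_const_ge0 q : 0 <= heat_const q.
Proof. by rewrite mulr_ge0 ?sqrtr_ge0 ?powR_ge0. Qed.

(** The power - 1/2 from the amplitude and the power 1/(2 q) from the Gaussian integral add up to -
    1/(2 p) by conjugacy. *)
Lemma heat_factorE (p q : R) (w : wave_param R) u : 0 < q -> p^-1 + q^-1 = 1 -> 0 < wa w -> 0 <= u ->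
  heat_factor q w u = heat_const q * (expR (- heat_energy w u) * (wa w + 2 * u) `^ (- (2 * p)^-1)).
Proof.
move=> q0 pq a0 u0; rewrite /heat_factor /heat_const; set x := wa w + 2 * u.
have x0 : 0 < x by rewrite ltr_wpDr// mulr_ge0.
have P0 : 0 < 2 * pi :> R by rewrite mulr_gt0// pi_gt0.
have -> : Num.sqrt (2 * pi / x) = Num.sqrt (2 * pi) * x `^ (- 2^-1).
  by rewrite sqrtrM ?ltW// powRN powR12_sqrt ?ltW// sqrtrV ?ltW.
have -> : Num.sqrt (2 * pi * x / q) `^ q^-1 = Num.sqrt (2 * pi / q) `^ q^-1 * x `^ ((2 * q)^-1).
  have -> : 2 * pi * x / q = (2 * pi / q) * x by rewrite mulrAC.
  rewrite sqrtrM ?divr_ge0 ?ltW// powRM ?sqrtr_ge0//; congr (_ * _).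
  by rewrite -powR12_sqrt ?ltW// -powRrM -invfM.
have E : x `^ (- (2 * p)^-1) = x `^ (- 2^-1) * x `^ ((2 * q)^-1).
  rewrite -powRD ?(gt_eqF x0) ?implybT//; congr (_ `^ _).
  rewrite !invfM (_ : p^-1 = 1 - q^-1); last by rewrite -pq addrK.
  ring.
rewrite E; ring.
Qed.

End heat_factor_formula.

(** * Upper and lower bounds for the pairing with a Gaussian pulse *)

Section pulse.
Variable R : realType.
Local Notation mR := (measurableTypeR R).
Local Notation lam := (@lebesgue_measure R).

Definition pulse_amp (a b : R) : R := Num.sqrt (2 * pi / a) ^+ 3 * Num.sqrt (2 * pi / b) ^+ 2.

(* The modulus of the Fourier transform of the Gaussian packets chosen in [pulse_waves]. *)
Definition pulse (a b t0 s0 : R) (z : R5 R) : R := pulse_amp a b *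
  (gauss a^-1 0 z.1.1.1.1 * gauss a^-1 0 z.1.1.1.2 * gauss a^-1 0 z.1.1.2 *
   (gauss b^-1 t0 z.1.2 * gauss b^-1 s0 z.2)).

Lemma pulse_amp_ge0 a b : 0 <= pulse_amp a b.
Proof. by rewrite mulr_ge0// exprn_ge0// sqrtr_ge0. Qed.

Lemma measurable_pulse a b t0 s0 : measurable_fun setT (pulse a b t0 s0 : R5 mR -> R).
Proof.
have [h1 h2 h3 h4 h5] := measurable_coord R.
have g1 := measurableT_comp (measurable_gauss a^-1 0) h1.
have g2 := measurableT_comp (measurable_gauss a^-1 0) h2.
have g3 := measurableT_comp (measurable_gauss a^-1 0) h3.
have g4 := measurableT_comp (measurable_gauss b^-1 t0) h4.
have g5 := measurableT_comp (measurable_gauss b^-1 s0) h5.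
apply: measurable_funM; first exact: measurable_cst.
exact: (measurable_funM (measurable_funM (measurable_funM g1 g2) g3) (measurable_funM g4 g5)).
Qed.

Lemma pulse_le a b t0 s0 z : 0 < a -> 0 < b ->
  0 <= pulse a b t0 s0 z <= pulse_amp a b * (gauss b^-1 t0 z.1.2 * gauss b^-1 s0 z.2).
Proof.
move=> a0 b0; have A0 := pulse_amp_ge0 a b.
have g0 d x y : 0 <= gauss d x y :> R by rewrite ltW ?gauss_gt0.
have g1 x y : gauss a^-1 x y <= 1 by rewrite gauss_le1// invr_ge0 ltW.
rewrite /pulse !mulr_ge0//= ler_wpM2l// ler_piMl ?mulr_ge0//.
by rewrite mulr_ile1 ?mulr_ge0// mulr_ile1.
Qed.

Lemma pulse_bound a b t0 s0 z : 0 < a -> 0 < b -> 0 <= pulse a b t0 s0 z <= pulse_amp a b.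
Proof.
move=> a0 b0; have /andP[-> /= H] := pulse_le t0 s0 z a0 b0; apply: le_trans H _.
have g0 d x y : 0 <= gauss d x y :> R by rewrite ltW ?gauss_gt0.
have g1 x y : gauss b^-1 x y <= 1 by rewrite gauss_le1// invr_ge0 ltW.
by rewrite ler_piMr ?pulse_amp_ge0// mulr_ile1.
Qed.

(** The transform turns the frequencies t0 and s0 of the last two packets into centres, and the
    centres l and - l into the oscillations in x3 and s. The constant phase l s0 cancels the product
    of frequency and centre in the last packet, so that exactly exp (i l (s - x3)) remains. *)
Lemma pulse_waves a b t0 s0 l z :
  tmap (Wave a 0 0 0) (Wave a 0 0 0) (Wave a l 0 0) (Wave b 0 t0 0) (Wave b (- l) s0 (l * s0))
    (fun w x => amp w * wave (dir_wave w) x) z = test_wave (pulse a b t0 s0) l z.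
Proof.
rewrite /tmap /tensor5 /test_wave /wave /amp /= !real_polarE cexpE !polarM; congr polar; last by ring.
rewrite /pulse /pulse_amp; ring.
Qed.

Lemma Lp_norm_cap_wave (p m : R) (c : R[i]) (E : set (R3 mR)) l : 0 < p -> 0 <= m ->
  measurable E -> leb3 R E = m%:E -> Lp_norm (leb3 R) p (cap_wave c E l) = (cabs c * m `^ p^-1)%:E.
Proof.
move=> p0 m0 mE Em; rewrite (@Lp_norm_integral _ _ _ _ p (cabs c `^ p * m))//.
  by rewrite powRM ?powR_ge0// -powRrM mulfV ?gt_eqF// powRr1// cabs_ge0.
transitivity (\int[leb3 R]_x ((cabs c `^ p)%:E * (\1_E x)%:E))%E.
  apply: eq_integral => x _; rewrite -EFinM /cap_wave !cabsM cabs_cexp mulr1 cabs_real; last by case: (indic_cases R E x) => [[->]|->].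
  congr (_%:E); case: (indic_cases R E x) => [[-> _]|->]; first by rewrite !mulr1.
  by rewrite !mulr0 powR0// gt_eqF.
rewrite ge0_integralZl//.
- by rewrite integral_indic// setIT Em EFinM.
- by apply/measurable_EFinP; exact: measurable_indic.
- by rewrite lee_fin powR_ge0.
Qed.

Section test.
Variables (psi : R2 R -> R[i]) (Kpsi rho : R).
Hypotheses (mpsi : @cmeasurable R _ (R2 mR) psi) (psiK : forall ts, cabs (psi ts) <= Kpsi)
  (psi_supp : forall ts, psi ts != 0 -> `|ts.1| <= rho /\ `|ts.2| <= rho).
Variables (c : R[i]) (E : set (R3 mR)) (L : R).
Hypotheses (mE : measurable E)
  (EL : forall x, E x -> [/\ `|x.1.1| <= L, `|x.1.2| <= L & `|x.2| <= L]) (L'0 : 0 <= L + 2 * rho).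

Section upper.
Variables (p q alpha Bd a b t0 s0 l : R) (g : R5 R -> R[i]).
Hypotheses (p0 : 0 < p) (q0 : 0 < q) (pq : p^-1 + q^-1 = 1) (alpha0 : 0 < alpha) (a0 : 0 < a) (b0 : 0 < b).
Hypotheses (mg : @cmeasurable R _ (R5 mR) g) (gB : (Lp_norm (leb5 R) p g <= Bd%:E)%E) (Bd0 : 0 <= Bd)
  (Fg : dist_eq (bessel alpha (local_torus_avg psi (cap_wave c E l))) (dist_fun g)).

(** Here [aa] and [bb] are the squared widths in x and in (t, s): the exponents collect - 1/(2 p)
    three times and twice. Of the energies of the two packets with frequency centres l and - l, the
    one in x3 is kept and the one in s is bounded by 1. *)
Definition test_bound (k aa bb ll v : R) : R := let u := expR (- v) in
  k * (gamma_kernel (alpha / 2) v * (expR (- (u * (aa * ll ^+ 2 / (aa + 2 * u)))) *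
    ((aa + 2 * u) `^ (- (3 / (2 * p))) * (bb + 2 * u) `^ (- p^-1)))).

Lemma measurable_expRN : measurable_fun setT (fun v : R => expR (- v)).
Proof. by apply: measurableT_comp => //; exact: measurable_expR. Qed.

Lemma measurable_test_bound k aa bb ll : 0 <= aa -> measurable_fun setT (test_bound k aa bb ll).
Proof.
move=> aa0; have mu := measurable_expRN.
have ma x : measurable_fun setT (fun v : R => x + 2 * expR (- v)).
  by apply: measurable_funD => //; exact: measurable_funM.
have mi : measurable_fun setT (fun v : R => (aa + 2 * expR (- v))^-1).
  rewrite (_ : (fun v => _) = fun v : R => (aa + 2 * expR (- v)) `^ (-1)).
    exact: (measurableT_comp (measurable_powR _) (ma _)).
  by apply/funext => v; rewrite powR_inv1// addr_ge0// mulr_ge0// expR_ge0.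
apply: measurable_funM => //; apply: measurable_funM; first exact: measurable_gamma_kernel.
apply: measurable_funM.
  apply: (measurableT_comp (@measurable_expR R)); apply: measurableT_comp => //.
  apply: measurable_funM => //; exact: measurable_funM.
apply: measurable_funM; exact: (measurableT_comp (measurable_powR _) (ma _)).
Qed.

Lemma torus_sobolev_test :
  ((gamma_const (alpha / 2) *
    `|(\int[sprod (sleb5 R) (sleb2 R)]_w Re (phase_density psi c E (pulse a b t0 s0) w * cexp (l * phase w)))%R|)%:E
   <= \int[lam]_v (test_bound (Bd * heat_const q ^+ 5) a b l v)%:E)%E.
Proof.
rewrite -(torus_pairing mpsi psiK psi_supp c l mE EL (measurable_pulse a b t0 s0) (fun z => pulse_bound t0 s0 z a0 b0) L'0).
have -> : (fun z => local_torus_avg psi (cap_wave c E l) z * test_wave (pulse a b t0 s0) l z) =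
  (fun z => local_torus_avg psi (cap_wave c E l) z *
     tmap (Wave a 0 0 0) (Wave a 0 0 0) (Wave a l 0 0) (Wave b 0 t0 0) (Wave b (- l) s0 (l * s0))
    (fun w x => amp w * wave (dir_wave w) x) z).
  by apply/funext => z; rewrite pulse_waves.
apply: (@sobolev_test R p q alpha Bd _ g) => //.
- exact (cintegrable_local_avg mpsi psiK psi_supp c l mE EL L'0).
- exact: measurable_test_bound (ltW a0).
move=> v; cbv zeta; set u := expR (- v); have u0 : 0 < u by exact: expR_gt0.
have hc := heat_const_ge0 q.
have x0 : 0 < a + 2 * u by rewrite ltr_wpDr// mulr_ge0 ?ltW.
have y0 : 0 < b + 2 * u by rewrite ltr_wpDr// mulr_ge0 ?ltW.
rewrite !(heat_factorE (p := p)) ?(ltW u0)// /heat_energy /= expr0n /= !mulr0 !mul0r !mulr0 oppr0 expR0.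
rewrite /test_bound -/u.
set e3 := expR _; set e5 := expR _.
set X := (a + 2 * u) `^ (- (2 * p)^-1); set Y := (b + 2 * u) `^ (- (2 * p)^-1).
have X0 : 0 <= X by exact: powR_ge0.
have Y0 : 0 <= Y by exact: powR_ge0.
have pn0 : p != 0 by rewrite gt_eqF.
have -> : (a + 2 * u) `^ (- (3 / (2 * p))) = X ^+ 3.
  by rewrite /X -powR_mulrn ?powR_ge0// -powRrM; congr (_ `^ _); field.
have -> : (b + 2 * u) `^ (- p^-1) = Y ^+ 2.
  by rewrite /Y -powR_mulrn ?powR_ge0// -powRrM; congr (_ `^ _); field.
have e51 : e5 <= 1.
  rewrite -expR0 ler_expR oppr_le0; apply: mulr_ge0; first exact: ltW.
  by apply: divr_ge0; [apply: mulr_ge0; [exact: ltW|exact: sqr_ge0]|exact: ltW].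
have G0 := gamma_kernel_gt0 (alpha / 2) v.
set h := heat_const q in hc *; set G := gamma_kernel _ _ in G0 *.
have -> : Bd * (G * (h * (1 * X) * (h * (1 * X)) * (h * (e3 * X)) * (h * (1 * Y)) * (h * (e5 * Y)))) =
  Bd * h ^+ 5 * (G * (e3 * (X ^+ 3 * Y ^+ 2))) * e5 by ring.
by rewrite ler_piMr// !mulr_ge0 ?exprn_ge0 ?expR_ge0 ?(ltW G0).
Qed.

End upper.

Section lower.
Variables (P : R5 R -> R) (KP : R).
Hypotheses (mP : measurable_fun setT (P : R5 mR -> R)) (PK : forall z, 0 <= P z <= KP).
Variables (th : R5 mR * R2 mR -> R) (N : set (R5 mR * R2 mR)%type) (g d th0 Th mN : R).
Hypotheses (mth : measurable_fun setT th) (thB : forall w, 0 <= th w <= Th) (mNs : measurable N)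
  (NmN : sprod (sleb5 R) (sleb2 R) N = mN%:E) (g0 : 0 <= g) (d0 : 0 <= d) (th00 : 0 <= th0).
Hypothesis near : forall w : R5 R * R2 R, N w ->
  [/\ 1 / 2 <= Re (psi (w.1.1.2, w.1.2) * c), g <= P w.1, th0 <= th w, E (torus_shift w) & period2 w.2].
Hypothesis far : forall w : R5 R * R2 R, Re (psi (w.1.1.2, w.1.2) * c) < 0 -> P w.1 <= d.

Let Box : set (R5 mR * R2 mR)%type := cube5 (L + 2 * rho) `*` @period2 R.
Let mBox := (2 * (L + 2 * rho)) ^+ 5 * (2 * pi) ^+ 2.

(** On [N] the gain is g th0 / 2. Elsewhere a loss occurs only where the real part of psi c is
    negative; there the pulse is at most [d], and [psi] does not vanish, so the point lies in
    [Box]. *)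
Lemma phase_density_lower w :
  g * th0 / 2 * \1_N w - Kpsi * cabs c * d * Th * \1_Box w <= Re (phase_density psi c E P w) * th w.
Proof.
rewrite /phase_density Re_mulr_real; set r := Re _.
have Th0 : 0 <= Th by have /andP[h1 h2] := thB w; exact: le_trans h2.
have K0 : 0 <= Kpsi := Kpsi_ge0 psiK.
have [P0 _] := andP (PK w.1); have [t0 tT] := andP (thB w).
have I0 (S : set (R5 mR * R2 mR)%type) : 0 <= \1_S w :> R by case: (indic_cases R S w) => [[->]|->].
have F0 : 0 <= Kpsi * cabs c * d * Th * \1_Box w by rewrite !mulr_ge0 ?cabs_ge0.
case: (indic_cases R N w) => [[-> Nw]|->].
  have [h1 h2 h3 h4 h5] := near Nw.
  have -> : \1_E (torus_shift w) = 1 :> R by rewrite indicE mem_set.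
  have -> : \1_(@period2 R) w.2 = 1 :> R by rewrite indicE mem_set.
  rewrite !mulr1.
  have : g * th0 / 2 <= r * P w.1 * th w.
    have -> : g * th0 / 2 = 1 / 2 * g * th0 by ring.
    by rewrite ler_pM ?mulr_ge0// ler_pM// divr_ge0.
  by lra.
rewrite mulr0 sub0r; case: (indic_cases R E (torus_shift w)) => [[-> Ew]|->]; last first.
  by rewrite mul0r !mulr0 mul0r oppr_le0.
case: (indic_cases R (@period2 R) w.2) => [[-> Pw]|->]; last first.
  by rewrite !mulr0 mul0r oppr_le0.
rewrite !mulr1; have [r0|r0] := leP 0 r.
  by rewrite (@le_trans _ _ 0) ?oppr_le0// !mulr_ge0.
have pn0 : psi (w.1.1.2, w.1.2) != 0.
  by apply: contraTneq r0 => e; rewrite /r e mul0r ltxx.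
have -> : \1_Box w = 1 :> R by rewrite indicE mem_set//; exact: (shift_in_Box psi_supp EL).
rewrite mulr1 lerNl -mulNr -mulNr -mulrA.
have -> : Kpsi * cabs c * d * Th = (Kpsi * cabs c) * (d * Th) by ring.
have Rr : - r <= Kpsi * cabs c.
  rewrite -ltr0_norm// (le_trans (norm_Re_le _))// cabsM ler_wpM2r ?cabs_ge0//.
apply: ler_pM => //; first by rewrite oppr_ge0 ltW.
  exact: mulr_ge0.
by apply: ler_pM => //; exact: far.
Qed.

Lemma integrable_phase_real :
  (sprod (sleb5 R) (sleb2 R)).-integrable setT (EFin \o (fun w => Re (phase_density psi c E P w) * th w)).
Proof.
have D := cintegrable_phase_density mpsi psiK psi_supp c 0 mE EL mP PK L'0.
have Th0 : 0 <= Th by have /andP[h1 h2] := thB ((0, 0, 0, 0, 0), (0, 0)); exact: le_trans h2.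
apply: le_integrable_real (integrableZl_real Th (integrable_cabs D)).
  by apply: measurable_funM => //; have [] := cintegrable_cmeasurable D.
move=> w; have [t0 tT] := andP (thB w).
by rewrite normrM mulrC ler_pM// ?norm_Re_le// ger0_norm.
Qed.

Lemma integral_phase_lower :
  g * th0 / 2 * mN - Kpsi * cabs c * d * Th * mBox <=
  (\int[sprod (sleb5 R) (sleb2 R)]_w (Re (phase_density psi c E P w) * th w))%R.
Proof.
have mB : measurable Box by exact: measurable_Box.
have BE : sprod (sleb5 R) (sleb2 R) Box = mBox%:E.
  apply: sprod_box; [exact: measurable_cube5|exact: measurable_period2|exact: sleb5_cube5|exact: sleb2_period2].
have lN : (sprod (sleb5 R) (sleb2 R) N < +oo)%E by rewrite NmN ltry.
have lB : (sprod (sleb5 R) (sleb2 R) Box < +oo)%E by rewrite BE ltry.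
have iN := integrable_indic_lty (g * th0 / 2) mNs lN.
have iB := integrable_indic_lty (Kpsi * cabs c * d * Th) mB lB.
have I1 (k m : R) (S : set (R5 mR * R2 mR)%type) : measurable S -> sprod (sleb5 R) (sleb2 R) S = m%:E ->
    (\int[sprod (sleb5 R) (sleb2 R)]_w (k * \1_S w))%R = k * m.
  move=> mS SE; have lS : (sprod (sleb5 R) (sleb2 R) S < +oo)%E by rewrite SE ltry.
  have e : (\int[sprod (sleb5 R) (sleb2 R)]_w (\1_S w)%:E)%E = m%:E.
    by apply: etrans (integral_indic _ measurableT mS) _; rewrite setIT.
  rewrite RintegralZl//; first by rewrite /Rintegral e.
  have := integrable_indic_lty 1 mS lS.
  by rewrite (_ : (fun x => 1 * \1_S x) = \1_S)//; apply/funext => x; rewrite mul1r.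
rewrite -(I1 _ _ _ mNs NmN) -(I1 _ _ _ mB BE) -RintegralB//.
apply: le_Rintegral => //; first exact: integrableB_real.
  exact: integrable_phase_real.
by move=> w _; exact: phase_density_lower.
Qed.

End lower.

End test.
End pulse.

(** * Neighbourhoods of a torus *)

Section geometry.
Variable R : realType.
Local Notation mR := (measurableTypeR R).
Local Notation lam := (@lebesgue_measure R).

Definition ivl (x r : R) : set mR := `[x - r, x + r]%classic.

Lemma ivlP x r y : ivl x r y <-> `|y - x| <= r.
Proof. by rewrite /ivl /= in_itv/= ler_distl. Qed.

Lemma measurable_ivl x r : measurable (ivl x r).
Proof. exact: measurable_itv. Qed.

Lemma lebesgue_ivl x r : 0 <= r -> lam (ivl x r) = (2 * r)%:E.
Proof.
move=> r0; rewrite /ivl lebesgue_measure_itv/= lte_fin.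
case: ltP => [_|xx]; first by rewrite -EFinB; congr (_%:E); ring.
have -> : r = 0 by lra.
by rewrite mulr0.
Qed.

Lemma lebesgue_itv_co (x d : R) : 0 <= d -> lam `[x, x + d[%classic = d%:E.
Proof.
move=> d0; rewrite lebesgue_measure_itv/= lte_fin.
case: ltP => [_|xx]; first by rewrite -EFinB; congr (_%:E); ring.
by have -> : d = 0 by lra.
Qed.

Definition cube3 (r : R) (y : R3 R) : set (R3 mR) := ivl y.1.1 r `*` ivl y.1.2 r `*` ivl y.2 r.

Lemma measurable_cube3 r y : measurable (cube3 r y).
Proof. by do 2! (apply: measurableX; last exact: measurable_ivl); exact: measurable_ivl. Qed.

Lemma cube3P r y x : cube3 r y x <-> [/\ `|x.1.1 - y.1.1| <= r, `|x.1.2 - y.1.2| <= r & `|x.2 - y.2| <= r].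
Proof.
split=> [[[/ivlP h1 /ivlP h2] /ivlP h3]|[h1 h2 h3]]; first by split.
by split; [split|]; apply/ivlP.
Qed.

Lemma sleb3_cube3 (r : R) y : 0 <= r -> sleb3 R (cube3 r y) = ((2 * r) ^+ 3)%:E.
Proof.
move=> r0; have m x := measurable_ivl x r; have l x := lebesgue_ivl x r0.
rewrite exprSr; apply: sprod_box => //; [exact: measurableX| |exact: l].
by rewrite expr2; apply: sprod_box; [exact: m|exact: m|exact: l|exact: l].
Qed.

Lemma leb3_cube3 (r : R) y : 0 <= r -> leb3 R (cube3 r y) = ((2 * r) ^+ 3)%:E.
Proof. by rewrite leb3E; exact: sleb3_cube3. Qed.

(** The first angle is left adjustable, to single out a window at pi / 2 in the oscillating example.
    The form 0 + 1 makes both angular intervals instances of [lebesgue_itv_co]. *)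
Definition near_set (r e t0 s0 x d : R) : set (R5 mR * R2 mR)%type :=
  ivl 0 r `*` ivl 0 r `*` ivl 0 r `*` ivl t0 e `*` ivl s0 e `*`
  (`[x, x + d[%classic `*` `[0, 0 + 1[%classic).

Lemma near_setP r e t0 s0 x d w : near_set r e t0 s0 x d w ->
  [/\ `|w.1.1.1.1.1| <= r, `|w.1.1.1.1.2| <= r & `|w.1.1.1.2| <= r] /\
  [/\ `|w.1.1.2 - t0| <= e, `|w.1.2 - s0| <= e, x <= w.2.1 < x + d & 0 <= w.2.2 < 1].
Proof.
move=> [[[[[/ivlP h1 /ivlP h2] /ivlP h3] /ivlP h4] /ivlP h5] [h6 h7]].
move: h1 h2 h3 h6 h7; rewrite !subr0 /= !in_itv/= add0r => h1 h2 h3 h6 h7.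
by split; split.
Qed.

Lemma measurable_near_set r e t0 s0 x d : measurable (near_set r e t0 s0 x d).
Proof.
apply: measurableX; last by apply: measurableX; exact: measurable_itv.
by do 4! (apply: measurableX; last exact: measurable_ivl); exact: measurable_ivl.
Qed.

Lemma sprod_near_set r e t0 s0 x d : 0 <= r -> 0 <= e -> 0 <= d ->
  sprod (sleb5 R) (sleb2 R) (near_set r e t0 s0 x d) = ((2 * r) ^+ 3 * (2 * e) ^+ 2 * d)%:E.
Proof.
move=> r0 e0 d0; have m y s := measurable_ivl y s.
have lr := lebesgue_ivl 0 r0; have le y := lebesgue_ivl y e0.
have m2 : measurable (ivl 0 r `*` ivl 0 r) by exact: measurableX.
have m3 : measurable (ivl 0 r `*` ivl 0 r `*` ivl 0 r) by exact: measurableX.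
have m4 : measurable (ivl 0 r `*` ivl 0 r `*` ivl 0 r `*` ivl t0 e) by exact: measurableX.
have m5 : measurable (ivl 0 r `*` ivl 0 r `*` ivl 0 r `*` ivl t0 e `*` ivl s0 e) by exact: measurableX.
have mi y s : measurable (`[y, y + s[%classic : set mR) by exact: measurable_itv.
have md : measurable (`[x, x + d[%classic `*` `[0, 0 + 1[%classic : set (mR * mR)%type) by exact: measurableX.
have E2 : sleb2 R (ivl 0 r `*` ivl 0 r) = (2 * r * (2 * r))%:E by exact: sprod_box.
have E3 : sleb3 R (ivl 0 r `*` ivl 0 r `*` ivl 0 r) = (2 * r * (2 * r) * (2 * r))%:E by exact: sprod_box.
have E4 : sleb4 R (ivl 0 r `*` ivl 0 r `*` ivl 0 r `*` ivl t0 e) = (2 * r * (2 * r) * (2 * r) * (2 * e))%:E.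
  by apply: sprod_box => //; exact: le.
have E5 : sleb5 R (ivl 0 r `*` ivl 0 r `*` ivl 0 r `*` ivl t0 e `*` ivl s0 e) =
    (2 * r * (2 * r) * (2 * r) * (2 * e) * (2 * e))%:E by apply: sprod_box => //; exact: le.
have Ed : sleb2 R (`[x, x + d[%classic `*` `[0, 0 + 1[%classic) = (d * 1)%:E.
  by apply: sprod_box => //; exact: lebesgue_itv_co.
have -> : (2 * r) ^+ 3 * (2 * e) ^+ 2 * d =
    2 * r * (2 * r) * (2 * r) * (2 * e) * (2 * e) * (d * 1) by ring.
exact: sprod_box.
Qed.

(** Each of the five coordinates is within one width of its centre and costs a factor exp (-
    1/2). *)
Lemma pulse_near (a b t0 s0 : R) (z : R5 R) : 0 < a -> 0 < b ->
  z.1.1.1.1 ^+ 2 <= a -> z.1.1.1.2 ^+ 2 <= a -> z.1.1.2 ^+ 2 <= a ->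
  (z.1.2 - t0) ^+ 2 <= b -> (z.2 - s0) ^+ 2 <= b ->
  pulse_amp a b * expR (- (5 / 2)) <= pulse a b t0 s0 z.
Proof.
move=> a0 b0 h1 h2 h3 h4 h5; rewrite /pulse ler_wpM2l ?pulse_amp_ge0// /gauss -!expRD ler_expR !subr0.
have H (x y : R) : 0 < x -> y <= x -> x^-1 * y <= 1.
  by move=> x0 yx; rewrite ler_pdivrMl// mulr1.
have := H _ _ a0 h1; have := H _ _ a0 h2; have := H _ _ a0 h3.
have := H _ _ b0 h4; have := H _ _ b0 h5; lra.
Qed.

Lemma pulse_far (a b t0 s0 rho : R) (z : R5 R) : 0 < a -> 0 < b -> 0 <= rho ->
  (`|z.1.2 - t0| <= rho -> `|z.2 - s0| <= rho -> False) ->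
  pulse a b t0 s0 z <= pulse_amp a b * expR (- (b^-1 * rho ^+ 2 / 2)).
Proof.
move=> a0 b0 r0 far; have /andP[_ H] := pulse_le t0 s0 z a0 b0; apply: le_trans H _.
rewrite ler_wpM2l ?pulse_amp_ge0// /gauss -!expRD ler_expR.
have bi : 0 < b^-1 by rewrite invr_gt0.
have sq (x : R) : rho < `|x| -> rho ^+ 2 <= x ^+ 2.
  by move=> h; rewrite -[leRHS](real_normK (num_real _)) lerXn2r// ?nnegrE// ltW.
have P (x : R) : 0 <= b^-1 * x ^+ 2 by rewrite mulr_ge0 ?sqr_ge0// ltW.
have Q (x : R) : rho < `|x| -> b^-1 * rho ^+ 2 <= b^-1 * x ^+ 2.
  by move=> h; rewrite ler_wpM2l ?(ltW bi)// sq.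
have := P (z.1.2 - t0); have := P (z.2 - s0).
have [h1|h1] := leP `|z.1.2 - t0| rho; last by have := Q _ h1; lra.
have [h2|h2] := leP `|z.2 - s0| rho; last by have := Q _ h2; lra.
by case: (far h1 h2).
Qed.

(** The change of the radius t + s cos a contributes (2 + s0) e, and rotating a radius of size at
    most t0 + s0 contributes (t0 + s0) e. *)
Lemma torus_param_lip t s t0 s0 (a b : R2 R) (e : R) : 0 <= t0 -> 0 <= s0 ->
  `|t - t0| <= e -> `|s - s0| <= e -> `|a.1 - b.1| <= e -> `|a.2 - b.2| <= e ->
  let y := torus_param t s a in let y0 := torus_param t0 s0 b in
  let r := (2 + t0 + 2 * s0) * e in
  [/\ `|y.1.1 - y0.1.1| <= r, `|y.1.2 - y0.1.2| <= r & `|y.2 - y0.2| <= r].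
Proof.
move=> t00 s00 ht hs h1 h2 /=; have e0 : 0 <= e by apply: le_trans ht.
have sc (f g : R -> R) : (forall x, `|f x| <= 1) -> (forall x y, `|f x - f y| <= `|x - y|) ->
    `|s * f a.1 - s0 * f b.1| <= e + s0 * e.
  move=> f1 fl; have -> : s * f a.1 - s0 * f b.1 = (s - s0) * f a.1 + s0 * (f a.1 - f b.1) by ring.
  rewrite (le_trans (ler_normD _ _))// lerD// normrM.
    by rewrite -[leRHS]mulr1 ler_pM.
  by rewrite (ger0_norm s00) ler_wpM2l// (le_trans (fl _ _)).
have cosb x : `|cos x| <= 1 :> R by exact: norm_cos_le1.
have sinb x : `|sin x| <= 1 :> R by exact: norm_sin_le1.
have C := sc cos cos cosb (@ler_dist_cos R); have S := sc sin sin sinb (@ler_dist_sin R).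
set A := t + s * cos a.1; set A0 := t0 + s0 * cos b.1.
have AA : `|A - A0| <= 2 * e + s0 * e.
  have -> : A - A0 = (t - t0) + (s * cos a.1 - s0 * cos b.1) by rewrite /A /A0; ring.
  by rewrite (le_trans (ler_normD _ _))//; lra.
have A0b : `|A0| <= t0 + s0.
  rewrite (le_trans (ler_normD _ _))// (ger0_norm t00) lerD2l normrM (ger0_norm s00).
  by rewrite ler_piMr.
have pr (f : R -> R) : (forall x, `|f x| <= 1) -> (forall x y, `|f x - f y| <= `|x - y|) ->
    `|A * f a.2 - A0 * f b.2| <= (2 + t0 + 2 * s0) * e.
  move=> f1 fl; have -> : A * f a.2 - A0 * f b.2 = (A - A0) * f a.2 + A0 * (f a.2 - f b.2) by ring.
  have B1 : `|(A - A0) * f a.2| <= 2 * e + s0 * e.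
    by rewrite normrM (le_trans _ AA)// ler_piMr.
  have B2 : `|A0 * (f a.2 - f b.2)| <= (t0 + s0) * e.
    by rewrite normrM ler_pM// (le_trans (fl _ _)).
  by rewrite (le_trans (ler_normD _ _))//; lra.
split; [exact: (pr _ cosb (@ler_dist_cos R))|exact: (pr _ sinb (@ler_dist_sin R))|].
have : 0 <= t0 * e by exact: mulr_ge0.
have : 0 <= s0 * e by exact: mulr_ge0.
lra.
Qed.

(* The centres are [- torus_param] because the average of f at x involves f (x - torus_param t s a). *)
Definition torus_cap (t0 s0 r : R) (n : nat) : set (R3 mR) :=
  \big[setU/set0]_(i < n) \big[setU/set0]_(j < n)
    cube3 r (- torus_param t0 s0 (i%:R / n%:R, j%:R / n%:R)).

Lemma torus_capE t0 s0 r n : torus_cap t0 s0 r n =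
  \bigcup_(i in `I_n) \bigcup_(j in `I_n) cube3 r (- torus_param t0 s0 (i%:R / n%:R, j%:R / n%:R)).
Proof.
rewrite (bigcup_mkord n (fun i => \bigcup_(j in `I_n) cube3 r (- torus_param t0 s0 (i%:R / n%:R, j%:R / n%:R)))).
apply: eq_bigr => i _.
by rewrite (bigcup_mkord n (fun j => cube3 r (- torus_param t0 s0 (i%:R / n%:R, j%:R / n%:R)))).
Qed.

Lemma measurable_torus_cap t0 s0 r n : measurable (torus_cap t0 s0 r n).
Proof.
by apply: bigsetU_measurable => i _; apply: bigsetU_measurable => j _; exact: measurable_cube3.
Qed.

(** Subadditivity over n^2 cubes of side 2 r. For r = O(1/n) this is O(1/n), the order of the volume
    of a neighbourhood of a surface patch. *)
Lemma leb3_torus_cap (t0 s0 r : R) n : 0 <= r ->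
  (leb3 R (torus_cap t0 s0 r n) <= (n%:R ^+ 2 * (2 * r) ^+ 3)%:E)%E.
Proof.
move=> r0; pose c i j := cube3 r (- torus_param t0 s0 (i%:R / n%:R, j%:R / n%:R)).
have mc i j : measurable (c i j) by exact: measurable_cube3.
have H i : (leb3 R (\big[setU/set0]_(j < n) c i j) <= (n%:R * (2 * r) ^+ 3)%:E)%E.
  apply: le_trans (le_mu_bigsetU (leb3 R) (fun j _ => mc i j)) _.
  rewrite (eq_bigr (fun=> ((2 * r) ^+ 3)%:E)); last by move=> j _; exact: leb3_cube3.
  by rewrite sumEFin lee_fin sumr_const card_ord [leRHS]mulr_natl.
have mU i : measurable (\big[setU/set0]_(j < n) c i j) by apply: bigsetU_measurable => j _; exact: mc.
apply: le_trans (le_mu_bigsetU (leb3 R) (fun i _ => mU i)) _.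
apply: (@le_trans _ _ (\sum_(i < n) (n%:R * (2 * r) ^+ 3)%:E)%E).
  by apply: lee_sum => i _; exact: H.
rewrite sumEFin lee_fin sumr_const card_ord.
by rewrite -[leLHS]mulr_natl expr2 mulrA.
Qed.

(** Rounding both angles down to the grid moves them by at most 1/n, to which [torus_param_lip]
    applies; the 3 in place of 2 accounts for x, itself of size 1/n. *)
Lemma torus_cap_cover (t0 s0 : R) n (w : R5 R * R2 R) : 0 <= t0 -> 0 <= s0 -> (0 < n)%N ->
  [/\ `|w.1.1.1.1.1| <= n%:R^-1, `|w.1.1.1.1.2| <= n%:R^-1 & `|w.1.1.1.2| <= n%:R^-1] ->
  `|w.1.1.2 - t0| <= n%:R^-1 -> `|w.1.2 - s0| <= n%:R^-1 -> 0 <= w.2.1 < 1 -> 0 <= w.2.2 < 1 ->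
  torus_cap t0 s0 ((3 + t0 + 2 * s0) / n%:R) n (torus_shift w).
Proof.
move=> t00 s00 n0 [x1 x2 x3] ht hs a1 a2; have n0' : 0 < n%:R :> R by rewrite ltr0n.
have grid (x : R) : 0 <= x < 1 -> exists2 i : 'I_n, True & `|x - i%:R / n%:R| <= n%:R^-1.
  move=> /andP[x0 x1']; have nx0 : 0 <= n%:R * x by rewrite mulr_ge0// ltW.
  have /andP[h1 h2] := truncn_itv nx0.
  have kn : (Num.truncn (n%:R * x) < n)%N.
    by rewrite -(ltr_nat R) (le_lt_trans h1)// gtr_pMr.
  exists (Ordinal kn) => //=.
  rewrite -[x in x - _](mulKf (lt0r_neq0 n0')) mulrC -mulrBl normrM [`|_^-1|]gtr0_norm ?invr_gt0//.
  apply: ler_piMl; first by rewrite invr_ge0 ltW.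
  by rewrite ger0_norm ?subr_ge0// lerBlDl natr1; exact: ltW.
have [i _ hi] := grid _ a1; have [j _ hj] := grid _ a2.
rewrite torus_capE; exists i => //=; exists j => //=.
apply/cube3P.
have [/= l1 l2 l3] := @torus_param_lip w.1.1.2 w.1.2 t0 s0 w.2 (i%:R / n%:R, j%:R / n%:R) n%:R^-1 t00 s00 ht hs hi hj.
have T (x y z : R) : `|x| <= n%:R^-1 -> `|y - z| <= (2 + t0 + 2 * s0) / n%:R ->
    `|x - y + z| <= (3 + t0 + 2 * s0) / n%:R.
  move=> hx hy; have -> : x - y + z = x - (y - z) by ring.
  rewrite (le_trans (ler_normB _ _))// (le_trans (lerD hx hy))//.
  by rewrite [leRHS](_ : _ = n%:R^-1 + (2 + t0 + 2 * s0) / n%:R)//; ring.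
by split=> /=; rewrite opprK; exact: T.
Qed.

Lemma torus_cap_bounded (t0 s0 r : R) n x : 0 <= t0 -> 0 <= s0 -> torus_cap t0 s0 r n x ->
  [/\ `|x.1.1| <= r + t0 + s0, `|x.1.2| <= r + t0 + s0 & `|x.2| <= r + t0 + s0].
Proof.
move=> t00 s00; rewrite torus_capE => -[i /= _] [j /= _ /cube3P].
move=> /= [h1 h2 h3]; have [/= p1 p2 p3] := torus_param_le t0 s0 (i%:R / n%:R, j%:R / n%:R).
move: p1 p2 p3; rewrite (ger0_norm t00) (ger0_norm s00) => p1 p2 p3.
have T (y z : R) : `|y - - z| <= r -> `|z| <= t0 + s0 -> `|y| <= r + t0 + s0.
  move=> hy hz; rewrite -[y](addrK z) (le_trans (ler_normB _ _))// -addrA lerD//.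
  by rewrite -[X in _ + X]opprK.
by split; [exact: T h1 p1|exact: T h2 p2|exact: T h3 p3].
Qed.

End geometry.

Section powers.
Variable R : realType.

Lemma powR_inv_sqr (y x : R) : 0 < y -> (y^-1 ^+ 2) `^ x = y `^ (- (2 * x)).
Proof.
move=> y0; have yi : 0 < y^-1 by rewrite invr_gt0.
rewrite !powR_expR_ln ?exprn_gt0//; congr expR.
rewrite lnXn// lnV ?posrE//; ring.
Qed.

Lemma gamma_kernel_powR (a b v : R) : gamma_kernel a v * expR (- v) `^ (- b) = gamma_kernel (a - b) v.
Proof.
rewrite powR_expR_ln ?expR_gt0// expRK /gamma_kernel -expRD; congr expR; ring.
Qed.

Lemma integral_gamma_kernelZ (k a : R) : 0 <= k -> 0 < a ->
  (\int[@lebesgue_measure R]_v (k * gamma_kernel a v)%:E = (k * gamma_const a)%:E)%E.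
Proof.
move=> k0 a0; under eq_integral => v _ do rewrite EFinM.
rewrite ge0_integralZl//.
- have E := integral_gamma_kernel a0 0.
  rewrite (_ : (fun v : R => (gamma_kernel a (v + 0))%:E) = fun v => (gamma_kernel a v)%:E) in E.
    by rewrite EFinM; exact: (congr1 (fun x => (k%:E * x)%E) E).
  by apply/funext => v; rewrite addr0.
- by apply/measurable_EFinP; exact: measurable_gamma_kernel.
- by move=> v _; rewrite lee_fin ltW// gamma_kernel_gt0.
Qed.

Lemma one_le_2pi : 1 <= 2 * pi :> R.
Proof. by have := @pi_ge2 R; lra. Qed.

Lemma pulse_amp_isotropic (y : R) : 0 < y -> pulse_amp (y^-1 ^+ 2) (y^-1 ^+ 2) = Num.sqrt (2 * pi) ^+ 5 * y ^+ 5.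
Proof.
move=> y0; have -> : pulse_amp (y^-1 ^+ 2) (y^-1 ^+ 2) = Num.sqrt (2 * pi / y^-1 ^+ 2) ^+ 5 by rewrite /pulse_amp -exprD.
rewrite -exprMn; congr (_ ^+ 5); rewrite sqrtrM ?mulr_ge0 ?pi_ge0//; congr (_ * _).
by rewrite exprVn invrK sqrtr_sqr gtr0_norm.
Qed.

(** The amplitude y^5 compensates the volume (2 / y)^5 of the near set; 16 is 2^5 times the lower
    bound 1/2 for the normalised cutoff. *)
Lemma pulse_main_part (y e X : R) : y != 0 ->
  y ^+ 5 * (e * 1 / 2 * ((2 * y^-1) ^+ 3 * (2 * y^-1) ^+ 2 * 1) - X) = 16 * e - y ^+ 5 * X.
Proof. by move=> y0; field. Qed.

End powers.

(** * The example of small caps *)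

Section blowup.
Variable R : realType.
Local Notation mR := (measurableTypeR R).
Local Notation lam := (@lebesgue_measure R).
Variables (psi : R2 R -> R[i]) (Kpsi rho : R).
Hypotheses (mpsi : @cmeasurable R _ (R2 mR) psi) (psiK : forall ts, cabs (psi ts) <= Kpsi)
  (psi_supp : forall ts, psi ts != 0 -> `|ts.1| <= rho /\ `|ts.2| <= rho).
Variables (c : R[i]) (t0 s0 rho1 : R).
Hypotheses (c0 : 0 < cabs c) (rho0 : 0 <= rho) (rho10 : 0 < rho1) (t00 : 0 < t0) (s00 : 0 < s0).
Hypothesis psi_near : forall ts, `|ts.1 - t0| <= rho1 -> `|ts.2 - s0| <= rho1 -> 1 / 2 <= Re (psi ts * c).

Section cap.
Variables (E : set (R3 mR)) (L : R).
Hypotheses (mE : measurable E)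
  (EL : forall x, E x -> [/\ `|x.1.1| <= L, `|x.1.2| <= L & `|x.2| <= L]) (L0 : 0 <= L).

Let L'0 : 0 <= L + 2 * rho.
Proof. by rewrite addr_ge0// mulr_ge0. Qed.

Definition box_volume : R := (2 * (L + 2 * rho)) ^+ 5 * (2 * pi) ^+ 2.

(** The weight [th] will be the constant 1 for small caps and the averaged oscillation in the other
    example, so one lower bound serves both. *)
Lemma weighted_phase_lower (a b r e x d th0 Th : R) (th : R5 mR * R2 mR -> R) :
  0 < a -> 0 < b -> 0 <= r -> 0 <= e -> 0 <= d -> r ^+ 2 <= a -> e ^+ 2 <= b -> e <= rho1 ->
  measurable_fun setT th -> (forall w, 0 <= th w <= Th) -> 0 <= th0 ->
  (forall w, near_set r e t0 s0 x d w -> [/\ th0 <= th w, E (torus_shift w) & period2 w.2]) ->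
  pulse_amp a b * (expR (- (5 / 2)) * th0 / 2 * ((2 * r) ^+ 3 * (2 * e) ^+ 2 * d) -
    Kpsi * cabs c * Th * box_volume * expR (- (b^-1 * rho1 ^+ 2 / 2))) <=
  (\int[sprod (sleb5 R) (sleb2 R)]_w (Re (phase_density psi c E (pulse a b t0 s0) w) * th w))%R.
Proof.
move=> a0 b0 r0 e0 d0 ra eb er mth thB th00 N.
have A0 := pulse_amp_ge0 a b.
have sq (y z h : R) : 0 <= z -> z ^+ 2 <= h -> `|y| <= z -> y ^+ 2 <= h.
  move=> z0 zh yz; apply: le_trans zh.
  by rewrite -[leLHS](real_normK (num_real _)) lerXn2r// ?nnegrE.
have := @integral_phase_lower R psi Kpsi rho mpsi psiK psi_supp c E L mE EL L'0 _ _
  (measurable_pulse a b t0 s0) (fun z => pulse_bound t0 s0 z a0 b0) th (near_set r e t0 s0 x d)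
  (pulse_amp a b * expR (- (5 / 2))) (pulse_amp a b * expR (- (b^-1 * rho1 ^+ 2 / 2))) th0 Th _
  mth thB (measurable_near_set r e t0 s0 x d) (sprod_near_set t0 s0 x r0 e0 d0)
  (mulr_ge0 A0 (expR_ge0 _)) (mulr_ge0 A0 (expR_ge0 _)) th00.
move=> H; apply: le_trans (H _ _).
- rewrite /box_volume le_eqVlt; apply/orP; left; apply/eqP; ring.
- move=> w Nw; have [h1 h2 h3] := N w Nw; split => //.
    have [_ [/= ht hs _ _]] := near_setP Nw.
    by apply: psi_near => /=; [exact: le_trans ht _|exact: le_trans hs _].
  have [[x1 x2 x3] [ht hs _ _]] := near_setP Nw.
  by apply: pulse_near => //; [exact: sq r0 ra x1|exact: sq r0 ra x2|exact: sq r0 ra x3|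
    exact: sq e0 eb ht|exact: sq e0 eb hs].
- move=> w neg; apply: pulse_far => //; first exact: ltW.
  move=> ht hs; have := @psi_near (w.1.1.2, w.1.2) ht hs.
  by move=> h; have := le_lt_trans h neg; rewrite ltNge divr_ge0.
Qed.

Section bounded.
Variables (p q alpha K : R).
Hypotheses (p1 : 1 < p) (pq : p^-1 + q^-1 = 1) (q0 : 0 < q) (alpha0 : 0 < alpha) (K0 : 0 < K).
Hypothesis repr : forall f b, 0 < b -> Lp (leb3 R) p f -> (Lp_norm (leb3 R) p f <= b%:E)%E ->
    exists g, [/\ @cmeasurable R _ (R5 mR) g, (Lp_norm (leb5 R) p g <= (K * b)%:E)%E &
      dist_eq (bessel alpha (local_torus_avg psi f)) (dist_fun g)].

Lemma bounded_torus_test (m a b l : R) : 0 < m -> (leb3 R E <= m%:E)%E -> 0 < a -> 0 < b ->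
  ((gamma_const (alpha / 2) *
    `|(\int[sprod (sleb5 R) (sleb2 R)]_w Re (phase_density psi c E (pulse a b t0 s0) w * cexp (l * phase w)))%R|)%:E
   <= \int[lam]_v (test_bound p alpha (K * cabs c * heat_const q ^+ 5 * m `^ p^-1) a b l v)%:E)%E.
Proof.
move=> m0 Em a0 b0; have p0 : 0 < p by apply: lt_trans p1.
have Efin : leb3 R E \is a fin_num by rewrite ge0_fin_numE// (le_lt_trans Em)// ltry.
pose m' := fine (leb3 R E).
have Em' : leb3 R E = m'%:E by rewrite fineK.
have m'0 : 0 <= m' by exact: fine_ge0.
have m'm : m' <= m by rewrite -lee_fin -Em'.
have NE := Lp_norm_cap_wave c l p0 m'0 mE Em'.
have b'0 : 0 < cabs c * m `^ p^-1 by rewrite mulr_gt0// powR_gt0.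
have Lpf : Lp (leb3 R) p (cap_wave c E l) by split; [exact: cmeasurable_cap|rewrite NE ltry].
have Nb : (Lp_norm (leb3 R) p (cap_wave c E l) <= (cabs c * m `^ p^-1)%:E)%E.
  rewrite NE lee_fin ler_wpM2l ?(ltW c0)//.
  by apply: ge0_ler_powR; rewrite ?nnegrE ?invr_ge0 ?(ltW p0) ?(ltW m0).
have [g [mg gB Fg]] := repr b'0 Lpf Nb.
have := torus_sobolev_test mpsi psiK psi_supp mE EL L'0 t0 s0 p0 q0 pq alpha0 a0 b0 mg gB _ Fg.
move=> H; apply: le_trans (H _) _; first by rewrite ltW// mulr_gt0.
rewrite (_ : K * (cabs c * m `^ p^-1) * heat_const q ^+ 5 = K * cabs c * heat_const q ^+ 5 * m `^ p^-1)//.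
ring.
Qed.

End bounded.
End cap.

Section small_caps.
Variables (p q alpha K : R).
Hypotheses (p2 : 2 <= p) (pq : p^-1 + q^-1 = 1) (q0 : 0 < q) (K0 : 0 < K).
Hypothesis repr : forall f b, 0 < b -> Lp (leb3 R) p f -> (Lp_norm (leb3 R) p f <= b%:E)%E ->
    exists g, [/\ @cmeasurable R _ (R5 mR) g, (Lp_norm (leb5 R) p g <= (K * b)%:E)%E &
      dist_eq (bessel alpha (local_torus_avg psi f)) (dist_fun g)].

(** The total exponent 5/(2 p) is split: 5/(2 p) - beta/2, nonnegative by hypothesis, is spent on
    [a], and beta/2 on u, where it merely lowers the order of the gamma kernel. *)
Lemma isotropic_test_bound (k a beta v : R) : 0 <= k -> 0 < a -> 0 <= beta -> beta <= 5 / p ->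
  test_bound p alpha k a a 0 v <=
  k * a `^ (- (5 / (2 * p) - beta / 2)) * gamma_kernel (alpha / 2 - beta / 2) v.
Proof.
move=> k0 a0 b0 bp; rewrite /test_bound expr0n /= mulr0 mul0r mulr0 oppr0 expR0 mul1r.
set u := expR (- v); have u0 : 0 < u by exact: expR_gt0.
have p0 : 0 < p by apply: lt_le_trans p2.
have x0 : 0 < a + 2 * u by rewrite addr_gt0// mulr_gt0.
have -> : (a + 2 * u) `^ (- (3 / (2 * p))) * (a + 2 * u) `^ (- p^-1) =
    (a + 2 * u) `^ (- (5 / (2 * p) - beta / 2)) * (a + 2 * u) `^ (- (beta / 2)).
  rewrite -!powRD ?(gt_eqF x0) ?implybT//; congr (_ `^ _); field; exact: lt0r_neq0.
rewrite -gamma_kernel_powR -/u -mulrA ler_wpM2l// [leRHS]mulrCA ler_wpM2l ?(ltW (gamma_kernel_gt0 _ _))//.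
have bp' : 0 <= 5 / (2 * p) - beta / 2.
  by rewrite (_ : 5 / (2 * p) = 5 / p / 2); [move: bp; lra|field; exact: lt0r_neq0].
apply: ler_pM; rewrite ?powR_ge0//.
  by apply: ler_powR_npos => //; [rewrite oppr_le0|rewrite lerDl mulr_ge0 ?ltW].
by apply: ler_powR_npos => //; [rewrite oppr_le0 divr_ge0|lra].
Qed.

Let C := 3 + t0 + 2 * s0.
Let L := C + t0 + s0.
Let E n := torus_cap t0 s0 (C / n%:R) n.
Let r n : R := n%:R^-1.

Let C0 : 0 < C. Proof. by rewrite /C; have [] := (t00, s00); lra. Qed.

Let L0 : 0 <= L. Proof. by rewrite /L; have [[]] := (t00, s00, C0); lra. Qed.

Let mE n : measurable (E n). Proof. exact: measurable_torus_cap. Qed.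

Let EL n x : (0 < n)%N -> E n x -> [/\ `|x.1.1| <= L, `|x.1.2| <= L & `|x.2| <= L].
Proof.
move=> n0; have CnC : C / n%:R <= C by rewrite ler_piMr ?(ltW C0)// invf_le1 ?ler1n ?ltr0n.
move=> /(torus_cap_bounded (ltW t00) (ltW s00)) [h1 h2 h3].
by split; [apply: le_trans h1 _|apply: le_trans h2 _|apply: le_trans h3 _]; rewrite lerD2r lerD2r.
Qed.

Lemma small_caps_lower : exists N1, forall n, (N1 < n)%N ->
  Num.sqrt (2 * pi) ^+ 5 * (8 * expR (- (5 / 2))) <= (\int[sprod (sleb5 R) (sleb2 R)]_w
    Re (phase_density psi c (E n) (pulse (r n ^+ 2) (r n ^+ 2) t0 s0) w * cexp (0 * phase w)))%R.
Proof.
set e5 := expR (- (5 / 2)); have e50 : 0 < e5 by exact: expR_gt0.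
(* The power 5 comes from the amplitude n^5 of the pulse; the error is kept below half of the main
   term [16 * e5]. *)
have [N1 HN1] := @gauss_tail_small R (Kpsi * cabs c * box_volume L) (8 * e5) rho1 5 (mulr_gt0 (ltr0n _ 8) e50) rho10.
exists (maxn N1 (Num.bound rho1^-1)) => n nN.
have nN1 : (N1 < n)%N by apply: leq_ltn_trans nN; exact: leq_maxl.
have nrho : rho1^-1 < n%:R.
  apply: (@lt_trans _ _ (Num.bound rho1^-1)%:R).
    by apply: archi_boundP; rewrite invr_ge0 ltW.
  by rewrite ltr_nat; apply: leq_ltn_trans nN; exact: leq_maxr.
have n0' : (0 < n)%N by apply: leq_ltn_trans nN1.
have n0 : 0 < n%:R :> R by rewrite ltr0n.
have r0 : 0 < r n by rewrite invr_gt0.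
have rr : r n <= rho1 by rewrite -[leRHS]invrK lef_pV2 ?posrE ?invr_gt0// ltW.
have W := @weighted_phase_lower (E n) L (mE n) (fun x => EL n0') L0 (r n ^+ 2) (r n ^+ 2) (r n) (r n) 0 1 1 1 (fun=> 1)
  (exprn_gt0 2 r0) (exprn_gt0 2 r0) (ltW r0) (ltW r0) ler01 (lexx _) (lexx _) rr (measurable_cst _).
rewrite (_ : (\int[_]_w _)%R = (\int[sprod (sleb5 R) (sleb2 R)]_w
    (Re (phase_density psi c (E n) (pulse (r n ^+ 2) (r n ^+ 2) t0 s0) w) * 1))%R); last first.
  by apply: eq_Rintegral => w _; rewrite mul0r /cexp cos0 sin0 Re_mulr_real.
apply: le_trans (W _ ler01 _).
- rewrite (pulse_amp_isotropic n0); have := HN1 n nN1; rewrite -/e5.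
  have -> : (r n ^+ 2)^-1 * rho1 ^+ 2 / 2 = n%:R ^+ 2 * rho1 ^+ 2 / 2 by rewrite /r exprVn invrK.
  set ex := expR (- (n%:R ^+ 2 * rho1 ^+ 2 / 2)) => H.
  rewrite -[leRHS]mulrA ler_wpM2l ?exprn_ge0 ?sqrtr_ge0// pulse_main_part ?lt0r_neq0//.
  rewrite lerBrDr (_ : 16 * e5 = 8 * e5 + 8 * e5); last by ring.
  rewrite lerD2l; apply: le_trans H; rewrite le_eqVlt; apply/orP; left; apply/eqP; ring.
- by move=> w; rewrite ler01 lexx.
- move=> w /near_setP[hx [ht hs h1 h2]]; rewrite add0r in h1.
  split=> //; first exact: (torus_cap_cover (ltW t00) (ltW s00) n0' hx ht hs).
  move: h1 h2 => /andP[a1 a2] /andP[a3 a4].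
  by split; rewrite /= in_itv/= ?a1 ?a3 /= (lt_le_trans _ (one_le_2pi R)).
Qed.

(** Count of powers: the volume 8 C^3 / n gives n^(- 1/p), and the squared width n^(- 2) raised to -
    (5/(2 p) - beta/2) gives n^(5/p - beta). Convergence over v uses beta < alpha. *)
Lemma small_caps_upper (k beta : R) n : (0 < n)%N -> 0 <= k -> 0 <= beta -> beta < alpha -> beta <= 5 / p ->
  (\int[lam]_v (test_bound p alpha (k * (n%:R ^+ 2 * (2 * (C / n%:R)) ^+ 3) `^ p^-1)
     (r n ^+ 2) (r n ^+ 2) 0 v)%:E <=
   (k * (8 * C ^+ 3) `^ p^-1 * gamma_const (alpha / 2 - beta / 2) * n%:R `^ (4 / p - beta))%:E)%E.
Proof.
move=> n0' k0 b0 ba bp; have p0 : 0 < p by apply: lt_le_trans p2.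
have n0 : 0 < n%:R :> R by rewrite ltr0n.
have r0 : 0 < r n by rewrite invr_gt0.
set k1 := k * _; have k10 : 0 <= k1 by rewrite mulr_ge0// powR_ge0.
pose k' := k1 * (r n ^+ 2) `^ (- (5 / (2 * p) - beta / 2)).
have k'0 : 0 <= k' by rewrite mulr_ge0// powR_ge0.
apply: (@le_trans _ _ (\int[lam]_v (k' * gamma_kernel (alpha / 2 - beta / 2) v)%:E)%E).
  apply: ge0_le_integral => //.
  - move=> v _; rewrite lee_fin /test_bound; apply: mulr_ge0 => //.
    by rewrite !mulr_ge0 ?expR_ge0 ?powR_ge0// ltW// gamma_kernel_gt0.
  - by apply/measurable_EFinP; apply: measurable_test_bound; exact: sqr_ge0.
  - apply/measurable_EFinP; apply: measurable_funM; first exact: measurable_cst.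
    exact: measurable_gamma_kernel.
  - by move=> v _; rewrite lee_fin; apply: isotropic_test_bound => //; exact: exprn_gt0.
rewrite integral_gamma_kernelZ//; last by rewrite -mulrBl divr_gt0// subr_gt0.
rewrite lee_fin /k' /k1.
have -> : n%:R ^+ 2 * (2 * (C / n%:R)) ^+ 3 = 8 * C ^+ 3 * n%:R^-1 by field; exact: lt0r_neq0.
rewrite powRM ?mulr_ge0 ?exprn_ge0 ?(ltW C0) ?invr_ge0 ?(ltW n0)//.
rewrite /r powR_inv_sqr//.
have -> : n%:R^-1 `^ p^-1 = n%:R `^ (- p^-1) :> R.
  by rewrite -[in LHS](powR_inv1 (ltW n0)) -powRrM mulN1r.
have -> : 4 / p - beta = - p^-1 + (- (2 * - (5 / (2 * p) - beta / 2))).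
  by field; exact: lt0r_neq0.
rewrite powRD ?(gt_eqF n0) ?implybT//.
rewrite le_eqVlt; apply/orP; left; apply/eqP; ring.
Qed.

Lemma four_div_blowup : 4 / p < alpha -> False.
Proof.
move=> pa; have p0 : 0 < p by apply: lt_le_trans p2.
have p1 : 1 < p by apply: lt_le_trans p2; rewrite ltr1n.
have fp0 : 0 < 4 / p by rewrite divr_gt0.
have alpha0 : 0 < alpha by apply: lt_trans pa.
have pip : 0 < p^-1 by rewrite invr_gt0.
(* The candidates are the midpoint of 4/p and alpha and the midpoint 9/(2 p) of 4/p and 5/p; the
   smaller one meets all three bounds. *)
have [beta [bp ba b5]] : exists beta, [/\ 4 / p < beta, beta < alpha & beta < 5 / p].
  exists (Num.min ((4 / p + alpha) / 2) (9 / 2 / p)); rewrite lt_min !gt_min; split; first by apply/andP; split; lra.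
    by apply/orP; left; lra.
  by apply/orP; right; lra.
have b0 : 0 < beta by apply: lt_trans bp.
pose k := K * cabs c * heat_const q ^+ 5.
have k0 : 0 <= k by rewrite /k !mulr_ge0 ?(ltW K0) ?cabs_ge0 ?exprn_ge0 ?heat_const_ge0.
pose M := k * (8 * C ^+ 3) `^ p^-1 * gamma_const (alpha / 2 - beta / 2).
have G0 : 0 < gamma_const (alpha / 2) :> R by rewrite gamma_const_gt0// divr_gt0.
pose cA := gamma_const (alpha / 2) * (Num.sqrt (2 * pi) ^+ 5 * (8 * expR (- (5 / 2)))) : R.
have cA0 : 0 < cA.
  apply: mulr_gt0 => //; apply: mulr_gt0; last by rewrite mulr_gt0// expR_gt0.
  by rewrite exprn_gt0// sqrtr_gt0 mulr_gt0// pi_gt0.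
have [N1 HN1] := small_caps_lower.
have dp : 0 < beta - 4 / p by rewrite subr_gt0.
have [n nN nC] := powR_unbounded (M / cA) N1.+1 dp.
have n0' : (0 < n)%N by apply: leq_ltn_trans nN.
have n0 : 0 < n%:R :> R by rewrite ltr0n.
have r0 : 0 < r n by rewrite invr_gt0.
have Cn : 0 <= C / n%:R by rewrite divr_ge0// ltW.
have m0 : 0 < n%:R ^+ 2 * (2 * (C / n%:R)) ^+ 3 by rewrite mulr_gt0// exprn_gt0// mulr_gt0// divr_gt0.
have T := bounded_torus_test (mE n) (fun x => EL n0') L0 p1 pq q0 alpha0 K0 repr 0 m0
  (leb3_torus_cap t0 s0 n Cn) (exprn_gt0 2 r0) (exprn_gt0 2 r0).
have U := small_caps_upper n0' k0 (ltW b0) ba (ltW b5).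
have Z : cA <= M * n%:R `^ (4 / p - beta).
  rewrite -lee_fin; apply: le_trans U; apply: le_trans T.
  by rewrite lee_fin /cA ler_wpM2l ?(ltW G0)//; apply: le_trans (HN1 n nN) _; exact: ler_norm.
have pn : 0 < n%:R `^ (4 / p - beta) :> R by rewrite powR_gt0.
have Q : n%:R `^ (4 / p - beta) * n%:R `^ (beta - 4 / p) = 1 :> R.
  by rewrite -powRD ?(gt_eqF n0) ?implybT// (_ : _ + _ = 0) ?powRr0//; ring.
have : M < cA * n%:R `^ (beta - 4 / p) by rewrite mulrC -ltr_pdivrMr.
apply/negP; rewrite -leNgt.
apply: le_trans (ler_wpM2r (powR_ge0 _ _) Z) _.
by rewrite -mulrA Q mulr1.
Qed.

End small_caps.
End blowup.

(** * The oscillating example *)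

Section averaged_bound.
Context {d : measure_display} {X : measurableType d} {R : realType}.
Variable mu : {sigma_finite_measure set X -> \bar R}.
Local Notation mR := (measurableTypeR R).
Local Notation lam := (@lebesgue_measure R).
Variables (A : X -> R[i]) (eta : X -> R) (a : R).
Hypotheses (a0 : 0 < a) (Ai : cintegrable mu A) (meta : measurable_fun setT eta).

Lemma integrable_average_section : lam.-integrable setT
  (EFin \o (fun t => gauss a 0 t * (\int[mu]_w Re (A w * cexp (t * eta w)))%R)).
Proof.
pose h (w : mR * X) : R := gauss a 0 w.1 * Re (A w.2 * cexp (w.1 * eta w.2)).
have [m1 m2] := cintegrable_cmeasurable Ai.
have mc : @cmeasurable R _ (mR * X)%type (fun w => A w.2 * cexp (w.1 * eta w.2)).
  apply: cmeasurableM; first exact: (cmeasurable_comp (cintegrable_cmeasurable Ai) (@measurable_snd _ _ mR X)).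
  by apply: cmeasurable_cexp; apply: measurable_funM => //; exact: (measurableT_comp meta).
have mh : measurable_fun setT h.
  apply: measurable_funM; last by have [] := mc.
  exact: (measurableT_comp (measurable_gauss _ _)).
have g0 t : 0 <= gauss a 0 t by rewrite ltW ?gauss_gt0.
have hle w : `|h w| <= gauss a 0 w.1 * cabs (A w.2).
  rewrite /h normrM ger0_norm ?g0// ler_wpM2l//.
  by rewrite (le_trans (norm_Re_le _))// cabsM cabs_cexp mulr1.
have hi : (sprod lam mu).-integrable setT (EFin \o h).
  by apply: le_integrable_real (integrable_tensor (integrable_gauss 0 a0) (integrable_cabs Ai)).
have si t : mu.-integrable setT (EFin \o (fun w => Re (A w * cexp (t * eta w)))).
  apply: le_integrable_real (integrable_cabs Ai).
    have mt : measurable_fun setT (fun w => t * eta w) by exact: measurable_funM.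
    by have [] := cmeasurableM (cintegrable_cmeasurable Ai) (cmeasurable_cexp mt).
  by move=> w; rewrite (le_trans (norm_Re_le _))// cabsM cabs_cexp mulr1.
have hs t : mu.-integrable setT (EFin \o (fun w => h (t, w))).
  exact: (integrableZl_real (gauss a 0 t) (si t)).
have [H _] := integrable_Rintegral_section hi hs.
rewrite (_ : (fun t => _) = fun t => (\int[mu]_w h (t, w))%R)//.
by apply/funext => t; exact: (esym (RintegralZl (gauss a 0 t) measurableT (si t))).
Qed.

(** The bounds at the single frequencies are integrated against the Gaussian: [gaussian_average]
    evaluates the left side, and Tonelli moves the frequency integral inside on the right, where for
    fixed v it is explicit. *)
Lemma averaged_bound (G : R) (B : R * R -> R) : 0 <= G -> measurable_fun setT (B : mR * mR -> R) ->
  (forall w, 0 <= B w) ->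
  (forall t, ((G * `|(\int[mu]_w Re (A w * cexp (t * eta w)))%R|)%:E <= \int[lam]_v (B (t, v))%:E)%E) ->
  ((G * (\int[mu]_w (Re (A w) * (Num.sqrt (2 * pi / a) * expR (- (eta w ^+ 2 / (2 * a))))))%R)%:E <=
   \int[lam]_v \int[lam]_t (gauss a 0 t * B (t, v))%:E)%E.
Proof.
move=> G0 mB B0 H; pose J t := (\int[mu]_w Re (A w * cexp (t * eta w)))%R.
have g0 t : 0 <= gauss a 0 t by rewrite ltW ?gauss_gt0.
have Ji := integrable_average_section.
have Jn : lam.-integrable setT (EFin \o (fun t => `|gauss a 0 t * J t|)).
  by apply: (le_integrable_real _ _ (integrable_norm Ji)) => //=;
    [apply: measurableT_comp => //; apply/measurable_EFinP; exact: (measurable_int _ Ji)|move=> t; rewrite normr_id].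
have nJ : (\int[lam]_t (`|gauss a 0 t * J t|)%:E)%E = (\int[lam]_t `|gauss a 0 t * J t|)%R%:E.
  by rewrite /Rintegral fineK//; exact: (integrable_fin_num _ Jn).
have mJ : measurable_fun setT (fun t => gauss a 0 t * J t) by apply/measurable_EFinP; exact: (measurable_int _ Ji).
apply: (@le_trans _ _ (\int[lam]_t (G * `|gauss a 0 t * J t|)%:E)%E).
  under eq_integral => t _ do rewrite EFinM.
  rewrite ge0_integralZl//; last first.
    by apply/measurable_EFinP; exact: measurableT_comp.
  rewrite nJ -EFinM lee_fin ler_wpM2l// -(gaussian_average a0 Ai meta).
  apply: le_trans (ler_norm _) _; exact: le_normr_Rintegral.
have mBs t : measurable_fun setT (fun v : mR => B (t, v)).
  by apply: (measurableT_comp mB); exact: measurable_pair1.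
have mf : measurable_fun setT (fun w : mR * mR => (gauss a 0 w.1 * B w)%:E).
  apply/measurable_EFinP; apply: measurable_funM => //; exact: (measurableT_comp (measurable_gauss _ _)).
have f0 (w : mR * mR) : (0 <= (gauss a 0 w.1 * B w)%:E)%E by rewrite lee_fin mulr_ge0.
rewrite -(@fubini_tonelli _ _ _ _ R lam lam (fun w : mR * mR => (gauss a 0 w.1 * B w)%:E) mf f0).
apply: ge0_le_integral => //=.
- by move=> t _; rewrite lee_fin mulr_ge0.
- by apply/measurable_EFinP; apply: measurable_funM => //; exact: measurableT_comp.
- exact: (measurable_fun_fubini_tonelli_F _ mf f0).
- move=> t _.
  apply: (@le_trans _ _ ((gauss a 0 t)%:E * \int[lam]_v (B (t, v))%:E)%E).
    apply: (@le_trans _ _ ((gauss a 0 t)%:E * (G * `|J t|)%:E)%E).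
      by rewrite -EFinM lee_fin normrM (ger0_norm (g0 t)) mulrCA.
    by apply: lee_wpmul2l; [rewrite lee_fin|exact: H].
  have Z : (\int[lam]_v ((gauss a 0 t)%:E * (B (t, v))%:E) = (gauss a 0 t)%:E * \int[lam]_v (B (t, v))%:E)%E.
    apply: ge0_integralZl => //; [by apply/measurable_EFinP; exact: mBs|by move=> v _; rewrite lee_fin|by rewrite lee_fin].
  rewrite -Z le_eqVlt; apply/orP; left; apply/eqP; apply: eq_integral => v _.
  by rewrite EFinM.
Qed.

End averaged_bound.

Section gaussian_in_frequency.
Variable R : realType.

Lemma half_pi_add1_le : pi / 2 + 1 <= 2 * pi :> R.
Proof. by have := @pi_ge2 R; lra. Qed.

Local Notation mR := (measurableTypeR R).
Local Notation lam := (@lebesgue_measure R).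

Lemma integral_gauss_damped (a y k : R) : 0 < a -> 0 <= y -> 0 <= k ->
  (\int[lam]_t (gauss a 0 t * (k * expR (- (y * t ^+ 2))))%:E = (k * Num.sqrt (2 * pi / (a + 2 * y)))%:E)%E.
Proof.
move=> a0 y0 k0; have ay : 0 < a + 2 * y by rewrite ltr_wpDr// mulr_ge0.
transitivity (\int[lam]_t (k%:E * (gauss (a + 2 * y) 0 t)%:E))%E.
  apply: eq_integral => t _; rewrite -EFinM /gauss mulrCA -expRD; congr (k * expR _)%:E; by field.
rewrite ge0_integralZl//.
- by rewrite integral_gauss.
- by apply/measurable_EFinP; exact: measurable_gauss.
- by move=> t _; rewrite lee_fin ltW ?gauss_gt0.
Qed.

(** Interpolation: x^(- 1/2) is split into the powers - (1 - beta)/2 and - beta/2. The first is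
    estimated by the summand y^(- 2) of x, the second by u / (1 + 2 u), with (1 + 2 u)^(beta/2) <= 1
    + 2 u. *)
Lemma sqrt_damped_le (y u beta : R) : 0 < y -> 0 < u -> 0 <= beta <= 1 ->
  Num.sqrt (2 * pi / (y^-1 ^+ 2 + 2 * (u / (1 + 2 * u)))) <=
  Num.sqrt (2 * pi) * y `^ (1 - beta) * (u `^ (- (beta / 2)) * (1 + 2 * u)).
Proof.
move=> y0 u0 /andP[b0 b1]; have u1 : 0 < 1 + 2 * u by rewrite addr_gt0// mulr_gt0.
have v0 : 0 < u / (1 + 2 * u) by rewrite divr_gt0.
have a0 : 0 < y^-1 ^+ 2 by rewrite exprn_gt0// invr_gt0.
set x := _ + _; have x0 : 0 < x by rewrite addr_gt0// mulr_gt0.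
have P0 : 0 < 2 * pi :> R by rewrite mulr_gt0// pi_gt0.
rewrite sqrtrM ?(ltW P0)// -mulrA ler_wpM2l ?sqrtr_ge0//.
have -> : Num.sqrt x^-1 = x `^ (- ((1 - beta) / 2)) * x `^ (- (beta / 2)).
  rewrite -powRD ?(gt_eqF x0) ?implybT// sqrtrV ?(ltW x0)// -powR12_sqrt ?(ltW x0)// -powRN.
  by congr (_ `^ _); field.
apply: ler_pM; rewrite ?powR_ge0//.
  have -> : y `^ (1 - beta) = (y^-1 ^+ 2) `^ (- ((1 - beta) / 2)).
    by rewrite powR_inv_sqr//; congr (_ `^ _); field.
  apply: ler_powR_npos => //; first by rewrite oppr_le0 divr_ge0// subr_ge0.
  by rewrite lerDl mulr_ge0// ltW.
apply: (@le_trans _ _ ((u / (1 + 2 * u)) `^ (- (beta / 2)))).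
  apply: ler_powR_npos => //; first by rewrite oppr_le0 divr_ge0.
  by rewrite /x; lra.
rewrite powRM ?(ltW u0) ?invr_ge0 ?(ltW u1)// ler_wpM2l ?powR_ge0//.
rewrite -(powR_inv1 (ltW u1)) -powRrM mulN1r opprK ler1_powR//; lra.
Qed.

End gaussian_in_frequency.

Section oscillatory_blowup.
Variable R : realType.
Local Notation mR := (measurableTypeR R).
Local Notation lam := (@lebesgue_measure R).
Variables (psi : R2 R -> R[i]) (Kpsi rho : R).
Hypotheses (mpsi : @cmeasurable R _ (R2 mR) psi) (psiK : forall ts, cabs (psi ts) <= Kpsi)
  (psi_supp : forall ts, psi ts != 0 -> `|ts.1| <= rho /\ `|ts.2| <= rho).
Variables (c : R[i]) (t0 s0 rho1 : R).
Hypotheses (c0 : 0 < cabs c) (rho0 : 0 <= rho) (rho10 : 0 < rho1) (t00 : 0 < t0) (s00 : 0 < s0).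
Hypothesis psi_near : forall ts, `|ts.1 - t0| <= rho1 -> `|ts.2 - s0| <= rho1 -> 1 / 2 <= Re (psi ts * c).
Variables (p q alpha K : R).
Hypotheses (p2 : 2 <= p) (pq : p^-1 + q^-1 = 1) (q0 : 0 < q) (K0 : 0 < K).
Hypothesis repr : forall f b, 0 < b -> Lp (leb3 R) p f -> (Lp_norm (leb3 R) p f <= b%:E)%E ->
    exists g, [/\ @cmeasurable R _ (R5 mR) g, (Lp_norm (leb5 R) p g <= (K * b)%:E)%E &
      dist_eq (bessel alpha (local_torus_avg psi f)) (dist_fun g)].

(** Large enough for [E] to contain x - torus_param t s a whenever the coordinates of x are at most
    1 and (t, s) is within 1 of (t0, s0). *)
Let L := 1 + (t0 + 1) + (s0 + 1).
Let E := cube3 L 0.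
Let r n : R := n%:R^-1.
(** The frequency scale of the average. The exponent is even so that the angular window of length
    Lam^(- 1/2) is n^(- k). *)
Let Lam n k : R := n%:R ^+ (2 * k).
Let gam : R := expR (- ((s0 + 1) ^+ 2 / 2)).
Let e5 : R := expR (- (5 / 2)).

Let L0 : 0 < L. Proof. by rewrite /L; have [] := (t00, s00); lra. Qed.

Let mE : measurable E. Proof. exact: measurable_cube3. Qed.

Let EL x : E x -> [/\ `|x.1.1| <= L, `|x.1.2| <= L & `|x.2| <= L].
Proof. by move=> /cube3P; rewrite /= !subr0. Qed.

Let leb3E' : (leb3 R E <= ((2 * L) ^+ 3)%:E)%E.
Proof. by rewrite leb3_cube3 ?(ltW L0). Qed.

Lemma pulse_amp_unit (y : R) : 0 < y -> pulse_amp 1 (y^-1 ^+ 2) = Num.sqrt (2 * pi) ^+ 5 * y ^+ 2.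
Proof.
move=> y0; rewrite /pulse_amp divr1.
have -> : Num.sqrt (2 * pi / y^-1 ^+ 2) = Num.sqrt (2 * pi) * y.
  rewrite sqrtrM ?mulr_ge0 ?pi_ge0//; congr (_ * _).
  by rewrite exprVn invrK sqrtr_sqr gtr0_norm.
ring.
Qed.

(** The amplitude y^2 compensates the area of the (t, s) square; the height l = y^(2 k) of the
    averaged weight against the window length y^(- k) leaves y^k. *)
Lemma oscillatory_main_part (S y l g e X : R) (k : nat) : y != 0 -> l != 0 -> l = (y ^+ k) ^+ 2 ->
  S ^+ 5 * y ^+ 2 * (e * (S * l * g) / 2 * ((2 * 1) ^+ 3 * (2 * y^-1) ^+ 2 * (y ^+ k)^-1) - X * (S * l) ) =
  S ^+ 6 * (16 * e * g * y ^+ k - y ^+ (2 * k + 2) * X).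
Proof.
move=> y0 l0 ->; have yk : y ^+ k != 0 by rewrite expf_neq0.
rewrite exprD mulnC exprM; field; by rewrite y0 yk.
Qed.

(** On the window 1 - sin a <= n^(- 2 k) = 1 / Lam, so Lam times the phase is at most s0 + 1 and the
    averaged weight is bounded below uniformly in n. *)
Lemma phase_small n k (w : R5 R * R2 R) : (0 < n)%N -> `|w.1.2 - s0| <= r n ->
  pi / 2 <= w.2.1 < pi / 2 + (n%:R ^+ k)^-1 ->
  gam <= expR (- (phase w ^+ 2 / (2 * (Lam n k)^-1 ^+ 2))).
Proof.
move=> n0' hs /andP[a1 a2]; have n0 : 0 < n%:R :> R by rewrite ltr0n.
have s1 : `|w.1.2| <= s0 + 1.
  rewrite -[w.1.2](subrK s0) (le_trans (ler_normD _ _))// (ger0_norm (ltW s00)) addrC lerD2l.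
  by rewrite (le_trans hs)// invf_le1 ?ler1n.
have Lk : Lam n k = (n%:R ^+ k) ^+ 2 by rewrite /Lam mulnC exprM.
set y := n%:R ^+ k in a2 Lk; have y0 : 0 < y by rewrite exprn_gt0.
have /andP[f0 f1] := one_sub_sin_le w.2.1.
have f2 : 1 - sin w.2.1 <= y^-1 ^+ 2.
  apply: le_trans f1 _; rewrite lerXn2r ?nnegrE ?subr_ge0 ?invr_ge0 ?(ltW y0)//.
  by rewrite lerBlDl ltW.
have P : `|phase w| <= (s0 + 1) * y^-1 ^+ 2.
  by rewrite /phase normrM (ger0_norm f0) ler_pM.
have P2 : phase w ^+ 2 <= ((s0 + 1) * y^-1 ^+ 2) ^+ 2.
  rewrite -[leLHS](real_normK (num_real _)) lerXn2r ?nnegrE//.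
  by rewrite mulr_ge0 ?exprn_ge0 ?invr_ge0 ?(ltW y0)// addr_ge0// ltW.
rewrite /gam ler_expR lerN2 Lk.
have -> : (s0 + 1) ^+ 2 / 2 = ((s0 + 1) * y^-1 ^+ 2) ^+ 2 / (2 * (y ^+ 2)^-1 ^+ 2).
  by field; exact: lt0r_neq0.
by rewrite ler_wpM2r// invr_ge0 mulr_ge0// exprn_ge0// invr_ge0 exprn_ge0// ltW.
Qed.

Lemma oscillatory_lower k : exists N1, forall n, (N1 < n)%N ->
  Num.sqrt (2 * pi) ^+ 6 * (8 * (e5 * gam)) * n%:R ^+ k <=
  (\int[sprod (sleb5 R) (sleb2 R)]_w (Re (phase_density psi c E (pulse 1 (r n ^+ 2) t0 s0) w) *
    (Num.sqrt (2 * pi / (Lam n k)^-1 ^+ 2) * expR (- (phase w ^+ 2 / (2 * (Lam n k)^-1 ^+ 2))))))%R.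
Proof.
have eg0 : 0 < e5 * gam by rewrite mulr_gt0// expR_gt0.
(* In the error the amplitude contributes n^2 and the height of the averaged weight n^(2 k). *)
have [N1 HN1] := @gauss_tail_small R (Kpsi * cabs c * box_volume rho L) (8 * (e5 * gam)) rho1 (2 * k + 2)
  (mulr_gt0 (ltr0n _ 8) eg0) rho10.
exists (maxn N1 (Num.bound rho1^-1)) => n nN.
have nN1 : (N1 < n)%N by apply: leq_ltn_trans nN; exact: leq_maxl.
have nrho : rho1^-1 < n%:R.
  apply: (@lt_trans _ _ (Num.bound rho1^-1)%:R).
    by apply: archi_boundP; rewrite invr_ge0 ltW.
  by rewrite ltr_nat; apply: leq_ltn_trans nN; exact: leq_maxr.
have n0' : (0 < n)%N by apply: leq_ltn_trans nN1.
have n0 : 0 < n%:R :> R by rewrite ltr0n.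
have n1 : 1 <= n%:R :> R by rewrite ler1n.
have r0 : 0 < r n by rewrite invr_gt0.
have rr : r n <= rho1 by rewrite -[leRHS]invrK lef_pV2 ?posrE ?invr_gt0// ltW.
have r1 : r n <= 1 by rewrite invf_le1.
have y0 : 0 < n%:R ^+ k :> R by rewrite exprn_gt0.
have d0 : 0 < (n%:R ^+ k)^-1 :> R by rewrite invr_gt0.
have d1 : (n%:R ^+ k)^-1 <= 1 :> R by rewrite invf_le1// exprn_ege1.
have l0 : 0 < Lam n k by rewrite exprn_gt0.
have sE : Num.sqrt (2 * pi / (Lam n k)^-1 ^+ 2) = Num.sqrt (2 * pi) * Lam n k.
  rewrite sqrtrM ?mulr_ge0 ?pi_ge0//; congr (_ * _).
  by rewrite exprVn invrK sqrtr_sqr gtr0_norm.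
set S := Num.sqrt (2 * pi) in sE *; have S0 : 0 < S by rewrite sqrtr_gt0 mulr_gt0// pi_gt0.
rewrite sE; pose th (w : R5 mR * R2 mR) := S * Lam n k * expR (- (phase w ^+ 2 / (2 * (Lam n k)^-1 ^+ 2))).
have mth : measurable_fun setT th.
  apply: measurable_funM => //; apply: (measurableT_comp (@measurable_expR R)); apply: measurableT_comp => //.
  apply: measurable_funM => //; apply: measurable_funX; exact: measurable_phase.
have thB w : 0 <= th w <= S * Lam n k.
  rewrite /th mulr_ge0 ?expR_ge0 ?mulr_ge0 ?(ltW S0) ?(ltW l0)//=.
  rewrite ler_piMr ?mulr_ge0 ?(ltW S0) ?(ltW l0)// -expR0 ler_expR oppr_le0.
  by rewrite divr_ge0 ?sqr_ge0// mulr_ge0// sqr_ge0.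
have th0 : 0 <= S * Lam n k * gam by rewrite !mulr_ge0 ?expR_ge0 ?(ltW S0) ?(ltW l0).
have W := @weighted_phase_lower R psi Kpsi rho mpsi psiK psi_supp c t0 s0 rho1 rho0 rho10 psi_near E L mE EL (ltW L0)
  1 (r n ^+ 2) 1 (r n) (pi / 2) (n%:R ^+ k)^-1 (S * Lam n k * gam) (S * Lam n k) th
  ltr01 (exprn_gt0 2 r0) ler01 (ltW r0) (ltW d0) _ (lexx _) rr mth thB th0.
apply: le_trans (W _ _).
- rewrite (pulse_amp_unit n0) -/S -/e5; have := HN1 n nN1.
  have -> : (r n ^+ 2)^-1 * rho1 ^+ 2 / 2 = n%:R ^+ 2 * rho1 ^+ 2 / 2 by rewrite /r exprVn invrK.
  set ex := expR (- (n%:R ^+ 2 * rho1 ^+ 2 / 2)) => H.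
  have -> : Kpsi * cabs c * (S * Lam n k) * box_volume rho L * ex =
     Kpsi * cabs c * box_volume rho L * ex * (S * Lam n k) by ring.
  rewrite oscillatory_main_part ?(lt0r_neq0 n0) ?(lt0r_neq0 l0)//; last by rewrite /Lam mulnC exprM.
  rewrite -mulrA ler_wpM2l ?exprn_ge0 ?(ltW S0)//.
  rewrite lerBrDr (_ : 16 * e5 * gam * n%:R ^+ k = 8 * (e5 * gam) * n%:R ^+ k + 8 * (e5 * gam) * n%:R ^+ k); last by ring.
  rewrite lerD2l; apply: (@le_trans _ _ (8 * (e5 * gam))); last first.
    by rewrite ler_peMr ?exprn_ege1// mulr_ge0// ltW.
  apply: le_trans H; rewrite le_eqVlt; apply/orP; left; apply/eqP; ring.
- by rewrite expr1n.
- move=> w /near_setP[[x1 x2 x3] [ht hs h1 h2]].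
  have [t1 s1] : `|w.1.1.2| <= t0 + 1 /\ `|w.1.2| <= s0 + 1.
    split; [rewrite -[w.1.1.2](subrK t0)|rewrite -[w.1.2](subrK s0)];
      rewrite (le_trans (ler_normD _ _))// ?(ger0_norm (ltW s00)) ?(ger0_norm (ltW t00)) addrC lerD2l.
      exact: le_trans ht r1.
    exact: le_trans hs r1.
  split.
  + rewrite /th ler_wpM2l ?mulr_ge0 ?(ltW S0) ?(ltW l0)//; exact: (phase_small n0' hs h1).
  + have [p1 p2' p3] := torus_param_le w.1.1.2 w.1.2 w.2.
    have T (x y : R) : `|x| <= 1 -> `|y| <= `|w.1.1.2| + `|w.1.2| -> `|x - y| <= L.
      move=> hx hy; rewrite (le_trans (ler_normB _ _))// /L -addrA; apply: lerD => //.
      by apply: le_trans hy _; exact: lerD.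
    by apply/cube3P; rewrite /= !subr0; split; exact: T.
  + have P2 := one_le_2pi R; move: h1 h2 => /andP[a1 a2] /andP[a3 a4].
    have pi0 := pi_gt0 R; have pi2 := pi_ge2 R.
    split; rewrite /= in_itv/= ?a3 /=; last exact: lt_le_trans a4 P2.
    apply/andP; split; first by apply: le_trans a1; rewrite divr_ge0// ltW.
    apply: lt_le_trans a2 _; apply: (@le_trans _ _ (pi / 2 + 1)); first by rewrite lerD2l.
    exact: half_pi_add1_le.
Qed.

(** The x-factor of unit width is bounded by 1, and b^(- 1/p) is the price of localising t and s.
    The energy factor is kept exactly, since it carries the decay in l. *)
Lemma unit_test_bound (k b l v : R) : 0 <= k -> 0 < b ->
  test_bound p alpha k 1 b l v <= k * b `^ (- p^-1) *
    gamma_kernel (alpha / 2) v * expR (- (expR (- v) / (1 + 2 * expR (- v)) * l ^+ 2)).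
Proof.
move=> k0 b0; rewrite /test_bound; set u := expR (- v); have u0 : 0 < u by exact: expR_gt0.
have p0 : 0 < p by apply: lt_le_trans p2.
have -> : u * (1 * l ^+ 2 / (1 + 2 * u)) = u / (1 + 2 * u) * l ^+ 2 by rewrite mul1r mulrCA mulrC.
set e := expR (- (_ * _)); set G := gamma_kernel _ _.
have X1 : (1 + 2 * u) `^ (- (3 / (2 * p))) <= 1.
  have n0 : - (3 / (2 * p)) <= 0 by rewrite oppr_le0 divr_ge0// mulr_ge0// ltW.
  apply: le_trans (ler_powR_npos n0 ltr01 (_ : 1 <= 1 + 2 * u)) _; last by rewrite powR1.
  by rewrite lerDl mulr_ge0// ltW.
have Y1 : (b + 2 * u) `^ (- p^-1) <= b `^ (- p^-1).
  by apply: ler_powR_npos => //; [rewrite oppr_le0 invr_ge0 ltW|rewrite lerDl mulr_ge0// ltW].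
have G0 : 0 <= G by rewrite ltW ?gamma_kernel_gt0.
rewrite -!mulrA ler_wpM2l// [leRHS]mulrCA ler_wpM2l// mulrC ler_wpM2r ?expR_ge0//.
by rewrite -[leRHS]mul1r; apply: ler_pM; rewrite ?powR_ge0.
Qed.

Let damp (k : R) (w : R * R) : R :=
  k * gamma_kernel (alpha / 2) w.2 * expR (- (expR (- w.2) / (1 + 2 * expR (- w.2)) * w.1 ^+ 2)).

Let measurable_damp k : measurable_fun setT (damp k : mR * mR -> R).
Proof.
have mu : measurable_fun setT (fun w : mR * mR => expR (- w.2)).
  exact: (measurableT_comp (@measurable_expRN R) measurable_snd).
have mi : measurable_fun setT (fun w : mR * mR => (1 + 2 * expR (- w.2))^-1).
  rewrite (_ : (fun w : mR * mR => _) = fun w : mR * mR => (1 + 2 * expR (- w.2)) `^ (-1)).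
    apply: (measurableT_comp (measurable_powR _)); apply: measurable_funD => //; exact: measurable_funM.
  by apply/funext => w; rewrite powR_inv1// addr_ge0// mulr_ge0// expR_ge0.
apply: measurable_funM.
  apply: measurable_funM => //; exact: (measurableT_comp (measurable_gamma_kernel _) measurable_snd).
apply: (measurableT_comp (@measurable_expR R)); apply: measurableT_comp => //.
apply: measurable_funM; first exact: measurable_funM.
exact: (measurable_funX _ measurable_fst).
Qed.

(** For fixed v the integral over t is Gaussian, and [sqrt_damped_le] bounds it. Its factor u^(-
    beta/2) lowers the order of the gamma kernel by beta/2, and the term 2 u in 1 + 2 u raises it by
    one, hence the two constants. *)
Lemma oscillatory_upper (k y beta : R) : 0 <= k -> 0 < y -> 0 <= beta <= 1 -> beta < alpha ->
  (\int[lam]_v \int[lam]_t (gauss (y^-1 ^+ 2) 0 t * damp k (t, v))%:E <=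
   (k * Num.sqrt (2 * pi) * y `^ (1 - beta) *
     (gamma_const (alpha / 2 - beta / 2) + 2 * gamma_const (alpha / 2 - beta / 2 + 1)))%:E)%E.
Proof.
move=> k0 y0 b01 ba; have a0 : 0 < y^-1 ^+ 2 by rewrite exprn_gt0// invr_gt0.
have S0 : 0 <= Num.sqrt (2 * pi) :> R by exact: sqrtr_ge0.
set k1 := k * _ * _; have k10 : 0 <= k1 by rewrite !mulr_ge0// powR_ge0.
have ab : 0 < alpha / 2 - beta / 2 by rewrite -mulrBl divr_gt0// subr_gt0.
have gp a' v : 0 <= gamma_kernel a' v :> R by rewrite ltW ?gamma_kernel_gt0.
rewrite mulrDr EFinD mulrA -(integral_gamma_kernelZ k10 ab).
have k120 : 0 <= k1 * 2 by rewrite mulr_ge0.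
rewrite -(integral_gamma_kernelZ k120 (addr_gt0 ab ltr01)) -ge0_integralD//; first last.
- by apply/measurable_EFinP; apply: measurable_funM => //; exact: measurable_gamma_kernel.
- by move=> v _; rewrite lee_fin mulr_ge0.
- by apply/measurable_EFinP; apply: measurable_funM => //; exact: measurable_gamma_kernel.
- by move=> v _; rewrite lee_fin mulr_ge0.
have d0 (w : mR * mR) : 0 <= damp k w by rewrite !mulr_ge0 ?expR_ge0.
have mf : measurable_fun setT (fun w : mR * mR => (gauss (y^-1 ^+ 2) 0 w.1 * damp k w)%:E).
  apply/measurable_EFinP; apply: measurable_funM; last exact: measurable_damp.
  exact: (measurableT_comp (measurable_gauss _ _)).
have f0 (w : mR * mR) : (0 <= (gauss (y^-1 ^+ 2) 0 w.1 * damp k w)%:E)%E.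
  by rewrite lee_fin mulr_ge0// ltW ?gauss_gt0.
apply: ge0_le_integral => //.
- by move=> v _; apply: integral_ge0 => t _; exact: (f0 (t, v)).
- exact: (measurable_fun_fubini_tonelli_G _ mf f0).
- by apply: emeasurable_funD; apply/measurable_EFinP; apply: measurable_funM => //; exact: measurable_gamma_kernel.
move=> v _; set u := expR (- v); have u0 : 0 < u by exact: expR_gt0.
have u1 : 0 < 1 + 2 * u by rewrite addr_gt0// mulr_gt0.
rewrite (integral_gauss_damped a0 (ltW (divr_gt0 u0 u1)) (mulr_ge0 k0 (gp (alpha / 2) v))).
rewrite -EFinD lee_fin.
apply: le_trans (ler_wpM2l (mulr_ge0 k0 (gp _ _)) (sqrt_damped_le y0 u0 b01)) _.
have E1 : gamma_kernel (alpha / 2) v * u `^ (- (beta / 2)) = gamma_kernel (alpha / 2 - beta / 2) v.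
  exact: gamma_kernel_powR.
have E2 : gamma_kernel (alpha / 2 - beta / 2) v * u = gamma_kernel (alpha / 2 - beta / 2 + 1) v.
  by rewrite -[in LHS](powRr1 (ltW u0)) -[in LHS](opprK 1) gamma_kernel_powR opprK.
rewrite -E2 -E1 le_eqVlt; apply/orP; left; apply/eqP; rewrite /k1; ring.
Qed.

Lemma half_blowup : 1 / 2 < alpha -> False.
Proof.
move=> ha; have p0 : 0 < p by apply: lt_le_trans p2.
have p1 : 1 < p by apply: lt_le_trans p2; rewrite ltr1n.
have alpha0 : 0 < alpha by lra.
have [beta [b1 ba b2]] : exists beta, [/\ 1 / 2 < beta, beta < alpha & beta < 1].
  exists (Num.min ((1 / 2 + alpha) / 2) (3 / 4)); rewrite lt_min !gt_min; split; first by apply/andP; split; lra.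
    by apply/orP; left; lra.
  by apply/orP; right; lra.
have b01 : 0 <= beta <= 1 by apply/andP; split; lra.
have bb : 0 < 2 * beta - 1 by lra.
(* For k > x the lower bound n^k outgrows the upper bound n^(2/p + 2 k (1 - beta)), as k (2 beta -
   1) > 2/p. *)
pose x := 2 / p / (2 * beta - 1).
have [k kx] : exists k : nat, x < k%:R.
  by exists (Num.bound x); apply: archi_boundP; rewrite divr_ge0 ?(ltW bb)// divr_ge0// ltW.
have dp : 0 < k%:R * (2 * beta - 1) - 2 / p by rewrite subr_gt0 -ltr_pdivrMr.
pose m := (2 * L) ^+ 3; have m0 : 0 < m by rewrite exprn_gt0// mulr_gt0.
pose k1 := K * cabs c * heat_const q ^+ 5 * m `^ p^-1.
have k10 : 0 <= k1 by rewrite !mulr_ge0 ?(ltW K0) ?cabs_ge0 ?exprn_ge0 ?heat_const_ge0 ?powR_ge0.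
pose GG := gamma_const (alpha / 2 - beta / 2) + 2 * gamma_const (alpha / 2 - beta / 2 + 1) : R.
pose M := k1 * Num.sqrt (2 * pi) * GG.
have G0 : 0 < gamma_const (alpha / 2) :> R by rewrite gamma_const_gt0// divr_gt0.
pose cB := gamma_const (alpha / 2) * (Num.sqrt (2 * pi) ^+ 6 * (8 * (e5 * gam))).
have cB0 : 0 < cB.
  apply: mulr_gt0 => //; apply: mulr_gt0; last by rewrite mulr_gt0// mulr_gt0 ?expR_gt0.
  by rewrite exprn_gt0// sqrtr_gt0 mulr_gt0// pi_gt0.
have [N1 HN1] := oscillatory_lower k.
have [n nN nC] := powR_unbounded (M / cB) N1.+1 dp.
have n0' : (0 < n)%N by apply: leq_ltn_trans nN.
have n0 : 0 < n%:R :> R by rewrite ltr0n.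
have r0 : 0 < r n by rewrite invr_gt0.
have l0 : 0 < Lam n k by rewrite exprn_gt0.
have ai : 0 < (Lam n k)^-1 ^+ 2 by rewrite exprn_gt0// invr_gt0.
pose k2 := k1 * (r n ^+ 2) `^ (- p^-1); have k20 : 0 <= k2 by rewrite mulr_ge0// powR_ge0.
have L'0 : 0 <= L + 2 * rho by rewrite addr_ge0 ?mulr_ge0// ltW.
have Di := cintegrable_phase_density mpsi psiK psi_supp c 0 mE EL (measurable_pulse 1 (r n ^+ 2) t0 s0)
  (fun z => pulse_bound t0 s0 z ltr01 (exprn_gt0 2 r0)) L'0.
have T : forall l, ((gamma_const (alpha / 2) * `|(\int[sprod (sleb5 R) (sleb2 R)]_w
    Re (phase_density psi c E (pulse 1 (r n ^+ 2) t0 s0) w * cexp (l * phase w)))%R|)%:E <=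
    \int[lam]_v (damp k2 (l, v))%:E)%E.
  move=> l; apply: le_trans (bounded_torus_test mpsi psiK psi_supp t0 s0 c0 rho0 mE EL (ltW L0) p1 pq q0 alpha0 K0 repr l m0
    leb3E' ltr01 (exprn_gt0 2 r0)) _.
  apply: ge0_le_integral => //.
  - move=> v _; rewrite lee_fin /test_bound; apply: mulr_ge0 => //.
    by rewrite !mulr_ge0 ?expR_ge0 ?powR_ge0// ltW// gamma_kernel_gt0.
  - by apply/measurable_EFinP; apply: measurable_test_bound.
  - by apply/measurable_EFinP; apply: (measurableT_comp (measurable_damp k2)); exact: measurable_pair1.
  - by move=> v _; rewrite lee_fin; apply: unit_test_bound => //; exact: exprn_gt0.
have d0 w : 0 <= damp k2 w.
  by apply: mulr_ge0; [apply: mulr_ge0 => //; rewrite ltW// gamma_kernel_gt0|exact: expR_ge0].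
have V := averaged_bound ai Di (@measurable_phase R) (ltW G0) (measurable_damp k2) d0 T.
have U := oscillatory_upper k20 l0 b01 ba.
have Z : cB * n%:R ^+ k <= k2 * Num.sqrt (2 * pi) * Lam n k `^ (1 - beta) * GG.
  rewrite -lee_fin; apply: le_trans U; apply: le_trans V.
  by rewrite lee_fin /cB -mulrA ler_wpM2l ?(ltW G0)//; exact: HN1.
have : M < cB * n%:R `^ (k%:R * (2 * beta - 1) - 2 / p) by rewrite mulrC -ltr_pdivrMr.
apply/negP; rewrite -leNgt.
have E1 : k2 * Num.sqrt (2 * pi) * Lam n k `^ (1 - beta) * GG =
    M * n%:R `^ (2 / p + (2 * k)%:R * (1 - beta)).
  rewrite /k2 /M /r powR_inv_sqr// /Lam -powR_mulrn ?(ltW n0)// -powRrM.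
  rewrite powRD ?(gt_eqF n0) ?implybT// (_ : - (2 * - p^-1) = 2 / p); last by ring.
  ring.
have E2 : n%:R `^ (k%:R * (2 * beta - 1) - 2 / p) = n%:R ^+ k * n%:R `^ (- (2 / p + (2 * k)%:R * (1 - beta))) :> R.
  rewrite -[n%:R ^+ k]powR_mulrn ?(ltW n0)// -powRD ?(gt_eqF n0) ?implybT//; congr (_ `^ _).
  by rewrite natrM; ring.
rewrite E2 mulrA; apply: le_trans (ler_wpM2r (powR_ge0 _ _) Z) _.
by rewrite E1 -mulrA -powRD ?(gt_eqF n0) ?implybT// subrr powRr0 mulr1.
Qed.

End oscillatory_blowup.

Theorem mainTheorem5 (R : realType) (p alpha : R) (psi : R2 R -> R[i]) :
  2 <= p ->
  smooth psi ->
  (exists ts, psi ts != 0) ->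
  compact (supp psi) ->
  supp psi `<=` @Jstar R ->
  Num.min (1 / 2) (4 / p) < alpha ->
  ~ bounded_Lp_sobolev p alpha (local_torus_avg psi).
Proof.
move=> p2 spsi [ts0 psi0] cpsi suppJ alpha_gt bnd.
have [s0 st] := suppJ _ (@subset_closure _ _ ts0 psi0); have t0 := lt_trans s0 st.
have p0 : 0 < p by apply: lt_le_trans p2.
have p1 : 0 < p - 1 by rewrite subr_gt0; apply: lt_le_trans p2; rewrite ltr1n.
have q0 : 0 < p / (p - 1) by rewrite divr_gt0.
have pq : p^-1 + (p / (p - 1))^-1 = 1 by field; rewrite !lt0r_neq0.
have c0 : 0 < cabs (psi ts0)^-1.
  rewrite lt0r cabs_ge0 andbT; apply/eqP => c0; have := @cabs_real R 1 ler01.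
  have E : (psi ts0)^-1 * psi ts0 = Complex 1 0 := mulVf psi0.
  by rewrite -E cabsM c0 mul0r => /esym/eqP; rewrite oner_eq0.
have [K K0 repr] := bounded_sobolev_repr bnd.
have mpsi := smooth_cmeasurable spsi.
have [Kpsi psiK] := smooth_cabs_bounded spsi cpsi.
have [rho rho0 psi_supp] := supp_bounded cpsi.
have [rho1 rho10 near] := smooth_Re_quotient_near spsi psi0.
move: alpha_gt; rewrite gt_min => /orP[ha|ha].
  exact: (half_blowup mpsi psiK psi_supp c0 rho0 rho10 t0 s0 near p2 pq q0 K0 repr ha).
exact: (four_div_blowup mpsi psiK psi_supp c0 rho0 rho10 t0 s0 near p2 pq q0 K0 repr ha).
Qed.
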